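(* Let $A$ be a separable $C^*$-algebra, let $J$ be a real antisymmetric $n\times n$ matrix, and let $T\in\mathcal{B}^*(\overline{S^A(\mathbb{R}^n)})$ satisfy $TR_g=R_gT$ for every $g\in S^A(\mathbb{R}^n)$. If $T$ is translation-smooth, then $T$ is Heisenberg-smooth.
   Context: $S^A(\mathbb{R}^n)$ is the space of $C^\infty$ functions $f:\mathbb{R}^n\to A$ with $\sup_x\|x^\alpha\partial^\beta f(x)\|<\infty$ for all multi-indices $\alpha,\beta$, with $A$-valued inner product $\langle f,g\rangle=\int f(x)^*g(x)\,dx$ and norm $\|f\|_2=\|\langle f,f\rangle\|^{1/2}$; $\overline{S^A(\mathbb{R}^n)}$ is its completion (a Hilbert $A$-module). $\mathcal{B}^*(\overline{S^A(\mathbb{R}^n)})$ is the set of continuous linear operators $T$ on $\overline{S^A(\mathbb{R}^n)}$ having an adjoint, i.e. a continuous linear operator $T^*$ with $\langle Tu,v\rangle=\langle u,T^*v\rangle$ for all $u,v$. Write $\bar d u=(2\pi)^{-n/2}du$. For $f,g\in S^A(\mathbb{R}^n)$, $f\times_J g(x)=\int f(x+Ju)g(x+v)e^{iu\cdot v}\,\bar d u\,\bar d v$ (oscillatory integral; equivalently $f\times_J g(x)=\int e^{ix\cdot\xi}\hat f(\xi)g(x+J\xi)\,\bar d\xi$ with $\hat f(\xi)=\int e^{-iy\cdot\xi}f(y)\,\bar d y$), which lies in $S^A(\mathbb{R}^n)$. $R_g$ is the continuous operator on the Banach space $\overline{S^A(\mathbb{R}^n)}$ extending $R_gf=f\times_J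 g$. For $z,\zeta\in\mathbb{R}^n$, $E_{z,\zeta}u(x)=e^{i\zeta\cdot x}u(x-z)$ (extended to $\overline{S^A(\mathbb{R}^n)}$, where it is unitary), and $T_{z,\zeta}=E_{z,\zeta}^{-1}TE_{z,\zeta}$. $T$ is Heisenberg-smooth if $(z,\zeta)\mapsto T_{z,\zeta}$ is $C^\infty$ on $\mathbb{R}^{2n}$ (operator norm), and translation-smooth if $z\mapsto T_{z,0}$ is $C^\infty$ on $\mathbb{R}^n$ (operator norm). *)

(* Defs.v *)
From HB Require Import structures.
From mathcomp Require Import all_boot all_order all_algebra.
From mathcomp Require Import all_classical all_reals all_analysis.
From mathcomp Require Import complex.

Set Implicit Arguments.
Unset Strict Implicit.
Unset Printing Implicit Defensive.

Import Order.TTheory GRing.Theory Num.Theory.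
Import numFieldNormedType.Exports.
Local Open Scope classical_set_scope.
Local Open Scope complex_scope.
Local Open Scope ring_scope.

(* A complex Banach space is a real one, so that the library's derivatives    *)
(* along vectors of R^n apply, on which C acts, extending the action of R.    *)
HB.mixin Record isComplexBanach (R : realType) V of CompleteNormedModule R V := {
  cscale : R[i] -> V -> V ;
  cscaleA : forall z w v, cscale z (cscale w v) = cscale (z * w) v ;
  cscaleDl : forall z w v, cscale (z + w) v = cscale z v + cscale w v ;
  cscaleDr : forall z u v, cscale z (u + v) = cscale z u + cscale z v ;
  cscale_real : forall (r : R) v, cscale r%:C v = r *: v ;
  norm_cscale : forall z v, `|cscale z v| = Normc.normc z * `|v|
}.

#[short(type="complexBanachType")]
HB.structure Definition ComplexBanach (R : realType) :=
  {V of isComplexBanach R V & CompleteNormedModule R V}.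

Notation "z *c: v" := (cscale z v) (at level 40) : ring_scope.

(* The algebra need not have a unit. *)
HB.mixin Record isCStarAlgebra (R : realType) A of ComplexBanach R A := {
  amul : A -> A -> A ;
  star : A -> A ;
  amulA : forall a b c, amul a (amul b c) = amul (amul a b) c ;
  amulDl : forall a b c, amul (a + b) c = amul a c + amul b c ;
  amulDr : forall a b c, amul a (b + c) = amul a b + amul a c ;
  cscaleAl : forall z a b, amul (z *c: a) b = z *c: amul a b ;
  cscaleAr : forall z a b, amul a (z *c: b) = z *c: amul a b ;
  starK : forall a, star (star a) = a ;
  starD : forall a b, star (a + b) = star a + star b ;
  starZ : forall z a, star (z *c: a) = (conjc z) *c: star a ;
  starM : forall a b, star (amul a b) = amul (star b) (star a) ;
  norm_amul : forall a b, `|amul a b| <= `|a| * `|b| ;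
  norm_starM : forall a, `|amul (star a) a| = `|a| ^+ 2
}.

#[short(type="cstarAlgType")]
HB.structure Definition CStarAlgebra (R : realType) :=
  {A of isCStarAlgebra R A & ComplexBanach R A}.

Notation "a *a b" := (amul a b) (at level 40, left associativity) : ring_scope.

Definition is_separable (T : topologicalType) := exists2 D : set T, countable D & dense D.

(* Right Hilbert A-modules; an element of A is positive when it is of the     *)
(* form b^* b.                                                                *)
HB.mixin Record isHilbertModule (R : realType) (A : cstarAlgType R) E
    of ComplexBanach R E := {
  ract : E -> A -> E ;
  inner : E -> E -> A ;
  ractA : forall u a b, ract (ract u a) b = ract u (a *a b) ;
  ractDl : forall u v a, ract (u + v) a = ract u a + ract v a ;
  ractDr : forall u a b, ract u (a + b) = ract u a + ract u b ;
  ractZl : forall z u a, ract (z *c: u) a = z *c: ract u a ;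
  ractZr : forall z u a, ract u (z *c: a) = z *c: ract u a ;
  innerDr : forall u v w, inner u (v + w) = inner u v + inner u w ;
  innerZr : forall z u v, inner u (z *c: v) = z *c: inner u v ;
  innerMr : forall u v a, inner u (ract v a) = inner u v *a a ;
  star_inner : forall u v, star (inner u v) = inner v u ;
  inner_pos : forall u, exists b, inner u u = star b *a b ;
  norm_inner : forall u, `|u| ^+ 2 = `|inner u u|
}.

#[short(type="hilbertModType")]
HB.structure Definition HilbertModule (R : realType) (A : cstarAlgType R) :=
  {E of isHilbertModule R A E & ComplexBanach R E}.

Section bounded_operators.
Context {R : realType} {E : complexBanachType R}.

Definition is_bop (f : E -> E) : bool :=
  `[< (forall z u v, f (z *c: u + v) = z *c: f u + f v) /\ continuous f >].

Record bop := Bop { bopf :> E -> E ; bopP : is_bop bopf }.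

HB.instance Definition _ := [isSub for bopf].
HB.instance Definition _ := [Choice of bop by <:].

Lemma bop_cts (T : bop) : continuous T.
Proof. by have /asboolP[] := bopP T. Qed.

Lemma bop_clin (T : bop) z u v : T (z *c: u + v) = z *c: T u + T v.
Proof. by have /asboolP[h _] := bopP T. Qed.

Lemma is_bop_submod : GRing.submod_closed (is_bop : {pred (E -> E)}).
Proof.
split.
  rewrite /in_mem/=; apply/asboolP; split.
    move=> z u v; rewrite /= /GRing.zero /= addr0.
    have : z *c: (0 : E) + z *c: 0 = z *c: 0 by rewrite -cscaleDr addr0.
    by move/(congr1 (fun x => x - z *c: 0)); rewrite addrK subrr => ->.
  by move=> x; exact: cvg_cst.
move=> r f g /asboolP[fl fc] /asboolP[gl gc]; apply/asboolP; split.
  move=> z u v.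
  have E1 (w : E) : (r *: f + g) w = r *: f w + g w by [].
  rewrite !E1 fl gl -!cscale_real !cscaleDr !cscaleA [r%:C * z]mulrC.
  by rewrite addrACA.
by move=> x; apply: cvgD; [apply: cvgZr; exact: fc|exact: gc].
Qed.

HB.instance Definition _ := GRing.isSubmodClosed.Build R (E -> E) is_bop is_bop_submod.
HB.instance Definition _ := [SubChoice_isSubLmodule of bop by <:].

Lemma bop_linear (T : bop) : linear T.
Proof. by move=> r u v; rewrite -!cscale_real bop_clin. Qed.

Definition opnorm (T : bop) : R := sup [set `|T u| | u in [set u | `|u| <= 1]].

Lemma opnorm_has_sup (T : bop) : has_sup [set `|T u| | u in [set u | `|u| <= 1]].
Proof.
split; first by exists `|T 0|, 0 => //=; rewrite normr0.
pose L := HB.pack_for {linear E -> E} (T : E -> E)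
  (GRing.isLinear.Build _ _ _ _ _ (bop_linear T)).
have /linear_boundedP[M [_ hM]] : bounded_near L (nbhs 0).
  by apply/linear_bounded_continuous; exact: bop_cts.
have M1 : M < `|M| + 1 by rewrite (le_lt_trans (ler_norm _))// ltrDl.
exists (`|M| + 1) => _ [u u1 <-]; apply: le_trans (hM _ M1 u) _.
by rewrite ler_piMr// addr_ge0.
Qed.

Lemma ler_opnorm (T : bop) u : `|T u| <= opnorm T * `|u|.
Proof.
have T0 : T 0 = 0.
  by have := bop_linear T (-1) 0 0; rewrite scaler0 addr0 scaleN1r addNr.
have TZ (r : R) w : T (r *: w) = r *: T w.
  by have := bop_linear T r w 0; rewrite T0 !addr0.
have [->|u0] := eqVneq u 0; first by rewrite T0 !normr0 mulr0.
have nu : 0 < `|u| by rewrite normr_gt0.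
have -> : u = `|u| *: (`|u|^-1 *: u) by rewrite scalerA divff ?gt_eqF// scale1r.
rewrite TZ normrZ normr_id [leRHS]mulrC.
rewrite [`| `|u| *: _|]normrZ normr_id [`|_^-1 *: u|]normrZ normfV normr_id.
rewrite mulVf ?gt_eqF// mulr1 ler_wpM2l//.
apply: ub_le_sup; first by have [] := opnorm_has_sup T.
by exists (`|u|^-1 *: u) => //=; rewrite normrZ normfV normr_id mulVf// gt_eqF.
Qed.

Lemma opnorm_le (T : bop) (M : R) :
  (forall u, `|u| <= 1 -> `|T u| <= M) -> opnorm T <= M.
Proof.
move=> h; apply: ge_sup; first by have [] := opnorm_has_sup T.
by move=> _ [u u1 <-]; exact: h.
Qed.

Lemma opnorm_ge0 (T : bop) : 0 <= opnorm T.
Proof.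
apply: le_trans (normr_ge0 (T 0)) _.
apply: ub_le_sup; first by have [] := opnorm_has_sup T.
by exists 0 => //=; rewrite normr0.
Qed.

Lemma opnormD (S T : bop) : opnorm (S + T) <= opnorm S + opnorm T.
Proof.
apply: opnorm_le => u u1; apply: le_trans (ler_normD (S u) (T u)) _.
by apply: lerD; (apply: le_trans (ler_opnorm _ _) _; rewrite ler_piMr// opnorm_ge0).
Qed.

Lemma opnormZ (r : R) (T : bop) : opnorm (r *: T) = `|r| * opnorm T.
Proof.
have le s (S : bop) : opnorm (s *: S) <= `|s| * opnorm S.
  apply: opnorm_le => u u1; rewrite [`|_|](normrZ s (S u)) ler_wpM2l//.
  by apply: le_trans (ler_opnorm _ _) _; rewrite ler_piMr// opnorm_ge0.
apply/eqP; rewrite eq_le le /=.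
have [->|r0] := eqVneq r 0; first by rewrite normr0 mul0r opnorm_ge0.
have := le r^-1 (r *: T); rewrite scalerA mulVf// scale1r normfV.
by rewrite mulrC ler_pdivlMr ?normr_gt0// mulrC.
Qed.

Lemma opnorm0_eq0 (T : bop) : opnorm T = 0 -> T = 0.
Proof.
move=> h; apply/val_inj/funext => u /=; apply/eqP.
by rewrite -normr_le0; have := ler_opnorm T u; rewrite h mul0r.
Qed.

HB.instance Definition _ := Lmodule_isNormed.Build R bop opnormD opnormZ opnorm0_eq0.

Lemma is_bop_comp (S T : bop) : is_bop (S \o T).
Proof.
apply/asboolP; split; first by move=> z u v; rewrite /= !bop_clin.
by move=> x; apply: continuous_comp; exact: bop_cts.
Qed.

Definition bcomp (S T : bop) : bop := Bop (is_bop_comp S T).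

Lemma is_bop_id : is_bop (@idfun E).
Proof. by apply/asboolP; split => // x; exact: cvg_id. Qed.

Definition bid : bop := Bop is_bop_id.

(* the inverse of T when T is invertible, and 0 otherwise *)
Definition binv (T : bop) : bop :=
  xget 0 [set S | bcomp S T = bid /\ bcomp T S = bid].

End bounded_operators.
Arguments bop {R} E.

Section smooth.
Context {R : realType} {V : normedModType R}.

(* e.g., partials [:: i; j] f is the derivative along i of that along j *)
Fixpoint partials m (s : seq 'I_m) (f : 'rV[R]_m -> V) : 'rV[R]_m -> V :=
  if s is i :: s' then fun x => 'D_(delta_mx 0 i) (partials s' f) x else f.

Definition smooth m (f : 'rV[R]_m -> V) :=
  forall s : seq 'I_m, continuous (partials s f) /\
    forall x i, derivable (partials s f) x (delta_mx 0 i).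

End smooth.

Section integral.
Context {R : realType} {V : completeNormedModType R}.
Local Notation mu := (@lebesgue_measure R).

(* The list s of pairs (B, a) stands for the simple function \sum 1_B a.      *)
Definition is_step (s : seq (set (measurableTypeR R) * V)) :=
  forall p, p \in s -> measurable p.1 /\ (mu p.1 < +oo)%E.
Definition step_fun (s : seq (set (measurableTypeR R) * V)) (t : R) : V :=
  \sum_(p <- s) (\1_(p.1) t : R) *: p.2.
Definition step_int (s : seq (set (measurableTypeR R) * V)) : V :=
  \sum_(p <- s) fine (mu p.1) *: p.2.

Definition is_bochner (f : R -> V) (a : V) :=
  exists s : nat -> seq (set (measurableTypeR R) * V),
    [/\ forall k, is_step (s k),
        forall k, measurable_fun [set: measurableTypeR R]
                    (fun t : measurableTypeR R => `|f t - step_fun (s k) t|),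
        (fun k => \int[mu]_t (`|f t - step_fun (s k) t|)%:E)%E @ \oo --> 0%E &
        (fun k => step_int (s k)) @ \oo --> a].

(* the Bochner integral over R, with value 0 if f is not integrable *)
Definition bochner (f : R -> V) : V := xget 0 [set a | is_bochner f a].

(* The integral over R^n, as an iterated integral: the integrands below are   *)
(* continuous and rapidly decreasing, so Fubini's theorem applies.            *)
Fixpoint integralRn n : ('rV[R]_n -> V) -> V :=
  if n is n'.+1 then fun f : 'rV[R]_(1 + n') -> V =>
    bochner (fun t => integralRn (fun y : 'rV[R]_n' => f (row_mx t%:M y)))
  else fun f => f 0.

(* integration against (2 pi)^(-n/2) dx *)
Definition dbar n (f : 'rV[R]_n -> V) : V :=
  (Num.sqrt (2 * pi) ^- n) *: integralRn f.

End integral.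

Section theory.
Context {R : realType} {n : nat} {A : cstarAlgType R}.
Implicit Types (f g : 'rV[R]_n -> A) (x y z zeta xi : 'rV[R]_n) (J : 'M[R]_n).

Definition dot x y : R := \sum_i x 0 i * y 0 i.
Definition cexp (t : R) : R[i] := cos t +i* sin t.

(* S^A(R^n); the mixed partial derivatives of a smooth function commute, so   *)
(* the derivatives partials s f are exactly those indexed by multi-indices.   *)
Definition schwartz : set ('rV[R]_n -> A) :=
  [set f | smooth f /\ forall (alpha : 'I_n -> nat) (s : seq 'I_n),
     exists M : R, forall x,
       `|(\prod_i x 0 i ^+ alpha i) *: partials s f x| <= M].

Definition schwartz_inner f g : A := integralRn (fun x => star (f x) *a g x).

Definition fourier f xi : A := dbar (fun y => cexp (- dot y xi) *c: f y).

(* f \times_J g; vectors are rows, so that J xi is written xi *m J^T.         *)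
Definition twist J f g x : A :=
  dbar (fun xi => cexp (dot x xi) *c: (fourier f xi *a g (x + xi *m J^T))).

Definition heisenberg z zeta f x : A := cexp (dot zeta x) *c: f (x - z).

Context {E : hilbertModType A} (iota : ('rV[R]_n -> A) -> E).

(* E is the completion of S^A(R^n), whose canonical map into E is the         *)
(* restriction of iota to schwartz; the values of iota elsewhere play no role.*)
Record schwartz_completion : Prop := SchwartzCompletion {
  iotaD : forall f g, schwartz f -> schwartz g ->
    iota (fun x => f x + g x) = iota f + iota g ;
  iotaZ : forall c f, schwartz f -> iota (fun x => c *c: f x) = c *c: iota f ;
  iotaM : forall f a, schwartz f -> iota (fun x => f x *a a) = ract (iota f) a ;
  iota_inner : forall f g, schwartz f -> schwartz g ->
    inner (iota f) (iota g) = schwartz_inner f g ;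
  iota_dense : dense (iota @` schwartz)
}.

(* Since iota @` schwartz is dense in E, at most one continuous W extends P;  *)
(* extension P is this W, or 0 when P has no continuous extension.            *)
Definition extends (P : ('rV[R]_n -> A) -> 'rV[R]_n -> A) (W : bop E) :=
  forall f, schwartz f -> schwartz (P f) /\ W (iota f) = iota (P f).
Definition extension P : bop E := xget 0 [set W | extends P W].

Definition Rop J g : bop E := extension (fun f => twist J f g).
Definition Eop z zeta : bop E := extension (heisenberg z zeta).

Definition adjointable (T : bop E) :=
  exists T' : bop E, forall u v, inner (T u) v = inner u (T' v).

Definition conjT (T : bop E) z zeta : bop E :=
  bcomp (binv (Eop z zeta)) (bcomp T (Eop z zeta)).

Definition heisenberg_smooth (T : bop E) :=
  smooth (fun p : 'rV[R]_(n + n) => conjT T (lsubmx p) (rsubmx p)).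

Definition translation_smooth (T : bop E) :=
  smooth (fun z : 'rV[R]_n => conjT T z 0).

End theory.

(* Main.v *)
Require Import Defs.
From HB Require Import structures.
From mathcomp Require Import all_boot all_order all_algebra.
From mathcomp Require Import all_classical all_reals all_analysis.
From mathcomp Require Import complex ring lra measurable_realfun.
Import Order.TTheory GRing.Theory Num.Theory.
Import numFieldNormedType.Exports.
Local Open Scope classical_set_scope.
Local Open Scope ring_scope.

(* Let V_zeta be the Heisenberg operator with frequency zeta and translation  *)
(* J zeta, i.e. the right twisted multiplication by exp(i zeta.x), which is   *)
(* not a Schwartz function. For the Gaussian packet                           *)
(* g_eps(x) = exp(i zeta.x) exp(-|eps x|^2 / 2) a, Fourier inversion makes    *)
(* R_(g_eps) a constant multiple of the average of V_theta(.)a over           *)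
(* theta = zeta + eps eta with Gaussian eta. Hence these operators are        *)
(* uniformly bounded, and they converge strongly to a multiple of V_zeta(.)a  *)
(* as eps tends to 0; so T commutes with V_zeta(.)a. Since an adjointable T   *)
(* is A-linear and a is arbitrary, T commutes with V_zeta. Finally E_(z,zeta) *)
(* is V_zeta composed with a translation, so T_(z,zeta) = T_(z',0) where z'   *)
(* is linear in (z,zeta), and smoothness in z carries over to (z,zeta).       *)

Set Implicit Arguments.
Unset Strict Implicit.
Unset Printing Implicit Defensive.

(** The operator [Eop iota (- (zeta *m J)) zeta] is right twisted multiplication by the plane wave
    of frequency zeta, and it is a strong limit of multiples of operators R_g, up to the coefficient
    a. An operator T commuting with every R_g therefore commutes with it ([comm_wave]). Each
    E_(z,zeta) is this operator composed with a pure translation ([Eop_factor]), so conjugating T by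
    E_(z,zeta) only sees the translation ([conjT_shift]). What is left is that smoothness survives
    composition with a linear map ([smooth_comp_mulmx]).

    The limit is taken along the packets [gpacket]. By [twist_gpacket], the twisted product of f
    with a packet is a multiple of the Gaussian average [gsum] of the plane-wave multiplications
    [rwave]: the Gaussian factor is expanded into plane waves ([gwaveE]), the integrals are
    exchanged ([integralRn_fubini]) and the transform of f is inverted ([fourier_inversion]). Every
    [rwave] preserves the norm of the completion, so pairing the average with a vector bounds it
    uniformly in eps ([inner_gsum], [norm_gsum]). Dominated convergence identifies the limit on
    Schwartz functions ([cvg_gsum]), and [strong_cvg] extends it to the completion. This gives
    [comm_ract_wave], from which [adjointable_ract] and [ract_eq0] remove the coefficient a.

    The analysis rests on Riemann sums: for continuous integrands dominated by a multiple of 1/(1 +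
    t^2) they converge to the Bochner integral ([riemann_cvg]), so that linearity, affine
    substitution and Fubini reduce to identities between finite sums and dominated convergence. The
    Gaussian integral c is kept as a symbol; its positivity allows it to be cancelled. *)

(** * Bochner integrals on the line: uniqueness, norm bounds, the weight 1/(1 + t^2) *)

Section bochner_line.
Context {R : realType} {V : completeNormedModType R}.
Local Notation mu := (@lebesgue_measure R).
Implicit Types (s : seq (set (measurableTypeR R) * V)) (f g : R -> V).

Lemma is_step_cons p s : is_step (p :: s) ->
  [/\ measurable p.1, (mu p.1 < +oo)%E & is_step s].
Proof.
move=> h; have [h1 h2] := h p (mem_head _ _); split=> // q qs.
by apply: h; rewrite in_cons qs orbT.
Qed.

(* Splitting D along the first set of the list allows induction, with v the   *)
(* sum of the vectors of the sets already processed.                          *)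
Lemma norm_step_le_on s : is_step s -> forall (D : set (measurableTypeR R)) (v : V),
  measurable D -> (mu D < +oo)%E ->
  measurable_fun D (fun t => `|v + step_fun s t|) /\
  (`|fine (mu D) *: v + \sum_(p <- s) fine (mu (p.1 `&` D)) *: p.2|%:E
    <= \int[mu]_(t in D) (`|v + step_fun s t|)%:E)%E.
Proof.
elim: s => [_ D v mD Dfin|[B a] s IH].
  have -> : (fun t => `|v + @step_fun R V [::] t|) = cst `|v|.
    by apply/funext => t; rewrite /step_fun big_nil addr0.
  split; first exact: measurable_cst.
  under eq_integral do rewrite /step_fun big_nil addr0.
  rewrite (integral_cst mu mD) big_nil addr0 normrZ ger0_norm ?fine_ge0//.
  by rewrite EFinM fineK ?ge0_fin_numE// muleC.
move=> /is_step_cons[/= mB Bfin ss] D v mD Dfin.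
have mDB : measurable (D `&` B) by exact: measurableI.
have mDB' : measurable (D `\` B) by exact: measurableD.
have fDB : (mu (D `&` B) < +oo)%E.
  by apply: le_lt_trans Dfin; apply: le_measure; rewrite ?inE//; exact: subIsetl.
have fDB' : (mu (D `\` B) < +oo)%E.
  by apply: le_lt_trans Dfin; apply: le_measure; rewrite ?inE//; exact: subDsetl.
have [m1 i1] := IH ss _ (v + a) mDB fDB.
have [m2 i2] := IH ss _ v mDB' fDB'.
have E1 : {in D `&` B, (fun t => `|v + a + step_fun s t|) =1
                       (fun t => `|v + step_fun ((B, a) :: s) t|)}.
  move=> t; rewrite inE => -[_ Bt]; rewrite /step_fun big_cons indicE mem_set//=.
  by rewrite scale1r addrA.
have E2 : {in D `\` B, (fun t => `|v + step_fun s t|) =1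
                       (fun t => `|v + step_fun ((B, a) :: s) t|)}.
  move=> t; rewrite inE => -[_ Bt]; rewrite /step_fun big_cons indicE memNset//=.
  by rewrite scale0r add0r.
have DE : (D `&` B) `|` (D `\` B) = D by rewrite setUIDK.
have mf : measurable_fun D (fun t => `|v + step_fun ((B, a) :: s) t|).
  rewrite -DE; apply/measurable_funU => //; split.
    exact: eq_measurable_fun E1 m1.
  exact: eq_measurable_fun E2 m2.
split=> //.
have -> : (\int[mu]_(t in D) `|v + step_fun ((B, a) :: s) t|%:E =
    \int[mu]_(t in D `&` B) `|v + step_fun ((B, a) :: s) t|%:E +
    \int[mu]_(t in D `\` B) `|v + step_fun ((B, a) :: s) t|%:E)%E.
  rewrite -ge0_integral_setU//=; first by rewrite DE.
  - by rewrite DE; apply/measurable_EFinP.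
  - by apply/disj_setPS => t [[_ ?] []].
have -> : (\int[mu]_(t in D `&` B) `|v + step_fun ((B, a) :: s) t|%:E =
    \int[mu]_(t in D `&` B) `|v + a + step_fun s t|%:E)%E.
  by apply: eq_integral => t /E1 ->.
have -> : (\int[mu]_(t in D `\` B) `|v + step_fun ((B, a) :: s) t|%:E =
    \int[mu]_(t in D `\` B) `|v + step_fun s t|%:E)%E.
  by apply: eq_integral => t /E2 ->.
apply: le_trans (leeD i1 i2); rewrite -EFinD lee_fin.
apply: le_trans (ler_normD _ _); rewrite le_eqVlt; apply/orP; left; apply/eqP.
congr (`|_|).
have split_fine (C : set (measurableTypeR R)) : measurable C -> (mu C < +oo)%E ->
    fine (mu C) = fine (mu (C `&` B)) + fine (mu (C `\` B)).
  move=> mC Cfin.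
  have h1 : (mu (C `&` B) < +oo)%E.
    apply: le_lt_trans Cfin; apply: le_measure; rewrite ?inE//.
    exact: measurableI.
  have h2 : (mu (C `\` B) < +oo)%E.
    apply: le_lt_trans Cfin; apply: le_measure; rewrite ?inE//.
    exact: measurableD.
  rewrite -fineD ?ge0_fin_numE//; congr fine.
  rewrite [in LHS](_ : C = (C `\` B) `|` (C `&` B)) ?measureU//=.
  - by rewrite addeC.
  - exact: measurableD.
  - exact: measurableI.
  - by apply/seteqP; split=> t // [[_ ?] []].
  - by rewrite setUC setUIDK.
rewrite big_cons /= [B `&` D]setIC (split_fine _ mD Dfin) scalerDl scalerDr.
rewrite addrACA -[RHS]addrA; congr (_ + _).
have -> : \sum_(p <- s) fine (mu (p.1 `&` D)) *: p.2 =
  \sum_(p <- s) fine (mu (p.1 `&` (D `&` B))) *: p.2 +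
  \sum_(p <- s) fine (mu (p.1 `&` (D `\` B))) *: p.2.
  rewrite -big_split/= !big_seq; apply: eq_bigr => p ps.
  have [mp fp] := ss _ ps.
  rewrite -scalerDl; congr (_ *: _); rewrite (split_fine (p.1 `&` D)).
  - by rewrite setIA setIDA.
  - exact: measurableI.
  - by apply: le_lt_trans fp; apply: le_measure; rewrite ?inE//;
      exact: measurableI.
exact: addrCA.
Qed.

(** [norm_step_le_on] applies with v = 0 on the union D of the sets of the list, since intersecting
    these sets with D does not change them; enlarging D to the whole line only increases the
    integral of h. *)
Lemma norm_step_int_le s (h : R -> R) : is_step s ->
  measurable_fun setT h -> (forall t, `|step_fun s t| <= h t) ->
  (`|step_int s|%:E <= \int[mu]_t (h t)%:E)%E.
Proof.
move=> ss mh hle; pose D : set (measurableTypeR R) := \big[setU/set0]_(p <- s) p.1.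
have sD p : p \in s -> p.1 `<=` D.
  move=> ps t pt; rewrite /D; elim: {ss hle} s @D ps => //= q s IH.
  rewrite in_cons big_cons => /predU1P[<-|/IH]; [by left|by right].
have [mD fD] : measurable D /\ (mu D < +oo)%E.
  rewrite /D; elim: s ss {hle sD D} => [_|p s IH /is_step_cons[mp fp /IH[ms fs]]].
    by rewrite big_nil measure0.
  rewrite big_cons; split; first exact: measurableU.
  by apply: le_lt_trans (measureU2 _ mp ms) _; exact: lte_add_pinfty.
have [ms] := norm_step_le_on ss 0 mD fD.
rewrite scaler0 add0r => h1.
have h0 t : 0 <= h t by exact: le_trans (hle t).
have -> : step_int s = \sum_(p <- s) fine (mu (p.1 `&` D)) *: p.2.
  rewrite /step_int !big_seq; apply: eq_bigr => p /sD ps; congr (fine (mu _) *: _).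
  by apply/esym/setIidPl.
apply: le_trans h1 _; apply: (@le_trans _ _ (\int[mu]_(t in D) (h t)%:E)%E).
  apply: ge0_le_integral => //.
  - exact/measurable_EFinP.
  - by apply/measurable_EFinP; exact: measurable_funS mh.
  - by move=> t _; rewrite lee_fin add0r.
apply: ge0_subset_integral => //; first exact/measurable_EFinP.
by move=> t _; rewrite lee_fin.
Qed.

(** A list stands for a sum, so concatenation with [step_opp s'] subtracts. *)
Definition step_opp s := [seq (p.1, - p.2) | p <- s].

Lemma step_intB s s' : step_int (s ++ step_opp s') = step_int s - step_int s'.
Proof.
rewrite /step_int big_cat big_map/=; congr (_ + _).
by rewrite -sumrN; apply: eq_bigr => p _; rewrite scalerN.
Qed.

Lemma step_funB s s' t : step_fun (s ++ step_opp s') t = step_fun s t - step_fun s' t.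
Proof.
rewrite /step_fun big_cat big_map/=; congr (_ + _).
by rewrite -sumrN; apply: eq_bigr => p _; rewrite scalerN.
Qed.

Lemma is_stepB s s' : is_step s -> is_step s' -> is_step (s ++ step_opp s').
Proof.
move=> ss ss' p; rewrite mem_cat => /orP[/ss//|/mapP[q /ss' qs ->]//].
Qed.

(** Pointwise, the two step functions differ by at most the sum of their distances to f. This one
    estimate gives both the uniqueness of the integral and the Cauchy property of Riemann sums. *)
Lemma step_int_dist_le s s' f : is_step s -> is_step s' ->
  measurable_fun [set: measurableTypeR R] (fun t => `|f t - step_fun s t|) ->
  measurable_fun [set: measurableTypeR R] (fun t => `|f t - step_fun s' t|) ->
  (`|step_int s - step_int s'|%:E <= \int[mu]_t (`|f t - step_fun s t|)%:E +
     \int[mu]_t (`|f t - step_fun s' t|)%:E)%E.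
Proof.
move=> ss ss' m m'; rewrite -step_intB -ge0_integralD//; last 2 first.
- exact/measurable_EFinP.
- exact/measurable_EFinP.
under eq_integral do rewrite -EFinD.
apply: norm_step_int_le; first exact: is_stepB.
  exact: measurable_funD.
move=> t; rewrite step_funB [leRHS]addrC.
have -> : step_fun s t - step_fun s' t =
    (f t - step_fun s' t) - (f t - step_fun s t).
  by rewrite opprB [RHS]addrC addrA subrK.
exact: ler_normB.
Qed.

Lemma is_bochner_uniq f a b : is_bochner f a -> is_bochner f b -> a = b.
Proof.
move=> [s [ss ms s0 sa]] [s' [ss' ms' s0' sb]].
apply/eqP; rewrite -subr_eq0 -normr_le0.
have cvgd : (`|step_int (s k) - step_int (s' k)|)%:E @[k --> \oo] --> (`|a - b|)%:E.
  by apply: cvg_EFin; [exact: nearW|apply: cvg_norm; exact: cvgB].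
have cvg0 : (\int[mu]_t (`|f t - step_fun (s k) t|)%:E +
     \int[mu]_t (`|f t - step_fun (s' k) t|)%:E)%E @[k --> \oo] --> 0%E.
  by rewrite -[0%E]adde0; apply: cvgeD.
rewrite -lee_fin; apply: (@lee_cvg_to _ _ _ R _ _ _ _ cvgd cvg0).
by apply: nearW => k; exact: step_int_dist_le.
Qed.

(** An approximating step function is bounded by h plus its distance to f, and the integral of that
    distance tends to 0. *)
Lemma is_bochner_norm_le f a (h : R -> R) : is_bochner f a ->
  measurable_fun [set: measurableTypeR R] h -> (forall t, `|f t| <= h t) ->
  (`|a|%:E <= \int[mu]_t (h t)%:E)%E.
Proof.
move=> [s [ss ms s0 sa]] mh fh.
have h0 t : 0 <= h t by exact: le_trans (fh t).
have cvgn : (`|step_int (s k)|)%:E @[k --> \oo] --> (`|a|)%:E.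
  by apply: cvg_EFin; [exact: nearW|exact: cvg_norm].
have cvgi : (\int[mu]_t (h t)%:E + \int[mu]_t (`|f t - step_fun (s k) t|)%:E)%E
    @[k --> \oo] --> (\int[mu]_t (h t)%:E)%E.
  rewrite -[X in _ --> X]adde0; apply: cvgeD => //; last exact: cvg_cst.
  by rewrite fin_num_adde_defl.
apply: (@lee_cvg_to _ _ _ R _ _ _ _ cvgn cvgi).
apply: nearW => k; rewrite -ge0_integralD//; last 3 first.
- by move=> t _; rewrite lee_fin.
- exact/measurable_EFinP.
- exact/measurable_EFinP.
under eq_integral do rewrite -EFinD.
apply: norm_step_int_le => //.
  exact: measurable_funD mh (ms k).
move=> t; rewrite -[X in `|X| <= _](subKr (f t)).
by apply: le_trans (ler_normB _ _) _; rewrite lerD2r.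
Qed.

Lemma measurable_norm_sub_step f s : continuous f -> is_step s ->
  measurable_fun [set: measurableTypeR R] (fun t => `|f t - step_fun s t|).
Proof.
(* For the induction the domain is cut along each set of the list, and v collects the vectors of the
   sets already met; once the list is exhausted only the continuous function |f - v| is left. *)
move=> cf; suff H : is_step s -> forall (D : set (measurableTypeR R)) v, measurable D ->
    measurable_fun D (fun t => `|f t - v - step_fun s t|).
  move=> /H/(_ setT 0 measurableT); by under eq_fun do rewrite subr0.
elim: s => [_ D v mD|[B a] s IH /is_step_cons[/= mB _ ss] D v mD].
  apply: measurable_funS (measurableT) (@subsetT _ _) _.
  apply: continuous_measurable_fun => t.
  under eq_fun do rewrite /step_fun big_nil subr0.
  by apply: cvg_norm; apply: cvgB; [exact: cf|exact: cvg_cst].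
rewrite -[D](setUIDK D B); apply/measurable_funU; [exact: measurableI|exact: measurableD|].
split.
  have := IH ss (D `&` B) (v + a) (measurableI _ _ mD mB).
  apply: eq_measurable_fun => t; rewrite inE => -[_ Bt].
  by rewrite /step_fun big_cons indicE mem_set//= scale1r !opprD !addrA.
have := IH ss (D `\` B) v (measurableD mD mB).
apply: eq_measurable_fun => t; rewrite inE => -[_ Bt].
by rewrite /step_fun big_cons indicE memNset//= scale0r add0r.
Qed.

(** The universal majorant on the line: its integral is pi, and shifts and dilations change it by
    bounded factors only. *)
Definition wt1 (t : R) : R := (1 + t ^+ 2)^-1.

Lemma wt1_gt0 t : 0 < wt1 t.
Proof. by rewrite invr_gt0 ltr_wpDr// sqr_ge0. Qed.

Lemma wt1_continuous : continuous wt1.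
Proof. exact: continuous_oneDsqrV. Qed.

Lemma integral_wt1 (c : R) : 0 <= c ->
  (\int[mu]_t (c * wt1 t)%:E = (c * pi)%:E)%E.
Proof.
move=> c0; under eq_integral do rewrite EFinM.
rewrite ge0_integralZl//; last 2 first.
- by apply/measurable_EFinP; apply: continuous_measurable_fun; exact: wt1_continuous.
- by move=> t _; rewrite lee_fin ltW// wt1_gt0.
rewrite EFinM; congr (_ * _)%E.
rewrite ge0_symfun_integralT; last 3 first.
- by move=> t; rewrite ltW// wt1_gt0.
- exact: wt1_continuous.
- by move=> t /=; rewrite /wt1 sqrrN.
rewrite (_ : [set x | 0 <= x] = `[0, +oo[%classic); last first.
  by apply/seteqP; split=> x /=; rewrite in_itv/= andbT.
rewrite integral0y_oneDsqr -EFinM; congr EFin.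
by rewrite mulrCA divff ?mulr1// pnatr_eq0.
Qed.

Lemma integrable_wt1 (c : R) : 0 <= c ->
  mu.-integrable [set: measurableTypeR R] (fun t => (c * wt1 t)%:E).
Proof.
move=> c0; have m : measurable_fun [set: measurableTypeR R] (fun t => c * wt1 t).
  apply: continuous_measurable_fun => t; apply: cvgM; first exact: cvg_cst.
  exact: wt1_continuous.
apply/integrableP; split; first exact/measurable_EFinP.
under eq_integral => t _.
  rewrite gee0_abs; last by rewrite lee_fin mulr_ge0// ltW// wt1_gt0.
  over.
by rewrite integral_wt1// ltry.
Qed.

(** This is t^2 <= 2 x^2 + 2 (t - x)^2, the square of x - (t - x) being nonnegative. *)
Lemma wt1_shift_le (l t x : R) : `|t - x| <= l -> wt1 x <= 2 * (1 + l ^+ 2) * wt1 t.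
Proof.
move=> tx; have l0 : 0 <= l by exact: le_trans tx.
have d2 : (t - x) ^+ 2 <= l ^+ 2 by rewrite -real_normK ?num_real// lerXn2r// nnegrE.
rewrite /wt1 ler_pdivlMr ?ltr_wpDr ?sqr_ge0// mulrC ler_pdivrMr ?ltr_wpDr ?sqr_ge0//.
have : 0 <= (x - (t - x)) ^+ 2 by exact: sqr_ge0.
have : 0 <= l ^+ 2 * x ^+ 2 by rewrite mulr_ge0// sqr_ge0.
nra.
Qed.

End bochner_line.

(** * Riemann sums and the rules of integration on the line *)

Lemma cvgn_eq {R : realType} {V : normedModType R} (u v : nat -> V) (a b : V) :
  (forall k, u k = v k) -> u k @[k --> \oo] --> a -> v k @[k --> \oo] --> b -> a = b.
Proof. by move=> /funext->; exact: norm_cvg_unique. Qed.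

Section riemann.
Context {R : realType} {V : completeNormedModType R}.
Local Notation mu := (@lebesgue_measure R).
Implicit Types (f g : R -> V) (l h t : R).

(* The nodes of mesh l / (k + 1) on [h - l (k + 1), h + l (k + 1)[; carrying  *)
(* l and h makes the Riemann sums of f (l t + h) and of f correspond exactly. *)
Definition node l h k (j : nat) : R :=
  l / k.+1%:R * (j%:R - (k.+1 ^ 2)%:R) + h.

Definition riemann l h k f : V :=
  \sum_(0 <= j < (k.+1 ^ 2).*2) (l / k.+1%:R) *: f (node l h k j).

Definition riemann_step l h k f : seq (set (measurableTypeR R) * V) :=
  [seq (`[node l h k j, node l h k j.+1[%classic, f (node l h k j))
     | j <- index_iota 0 (k.+1 ^ 2).*2].

Lemma nodeS l h k j : node l h k j.+1 = node l h k j + l / k.+1%:R.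
Proof. by rewrite /node -natr1; ring. Qed.

Lemma mesh_gt0 l k : 0 < l -> 0 < l / k.+1%:R.
Proof. by move=> l0; rewrite divr_gt0. Qed.

Lemma mesh_le l k : 0 < l -> l / k.+1%:R <= l.
Proof. by move=> l0; rewrite ler_pdivrMr// ler_peMr ?ler1n// ltW. Qed.

Lemma is_step_riemann l h k f : 0 < l -> is_step (riemann_step l h k f).
Proof.
move=> l0 p /mapP[j _ ->]/=; split; first exact: measurable_itv.
by rewrite lebesgue_measure_itv/=; case: ifP => _; rewrite ?ltry// -EFinB ltry.
Qed.

Lemma step_int_riemann l h k f : 0 < l ->
  step_int (riemann_step l h k f) = riemann l h k f.
Proof.
move=> l0; rewrite /step_int big_map; apply: eq_bigr => j _ /=.
rewrite lebesgue_measure_itv/= lte_fin nodeS ltrDl mesh_gt0//.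
by rewrite -EFinB/= addrC addKr.
Qed.

(** The first case is a point t inside the window covered by the nodes, where the value is taken at
    the node just below t; the second is a point outside, at distance at least l (k + 1) from the
    centre h. *)
Lemma step_fun_riemann l h k f t : 0 < l ->
  (exists2 x, `|t - x| <= l / k.+1%:R & step_fun (riemann_step l h k f) t = f x) \/
  (l * k.+1%:R <= `|t - h| /\ step_fun (riemann_step l h k f) t = 0).
Proof.
move=> l0; have d0 := mesh_gt0 k l0; have k0 : 0 < k.+1%:R :> R by [].
(* The position of t in units of the mesh, counted from the leftmost node; its integer part is the
   index of the node below t. *)
pose u := (t - h) / (l / k.+1%:R) + (k.+1 ^ 2)%:R.
have tE : t = l / k.+1%:R * (u - (k.+1 ^ 2)%:R) + h.
  by rewrite /u addrK mulrC divfK ?gt_eqF// subrK.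
have indE j : \1_(`[node l h k j, node l h k j.+1[%classic : set R) t =
    (j%:R <= u < j.+1%:R)%R%:R :> R.
  rewrite indicE; congr (nat_of_bool _)%:R; rewrite mem_setE in_itv/=.
  by rewrite /node {1 2}tE lerD2r ltrD2r ler_pM2l// ltr_pM2l// lerD2r ltrD2r.
have sE : step_fun (riemann_step l h k f) t =
    \sum_(0 <= j < (k.+1 ^ 2).*2) ((j%:R <= u < j.+1%:R)%R%:R : R) *: f (node l h k j).
  by rewrite /step_fun big_map; apply: eq_bigr => j _; rewrite indE.
have kk : l * k.+1%:R = l / k.+1%:R * (k.+1 ^ 2)%:R.
  by rewrite natrX expr2 -mulrA mulKf ?gt_eqF.
have [u0|u0] := ltP u 0.
  right; split.
    rewrite kk tE addrK normrM gtr0_norm// ler_pM2l// ler0_norm.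
      by rewrite opprB lerDl oppr_ge0 ltW.
    by rewrite subr_le0 (le_trans (ltW u0)).
  rewrite sE big1// => j _.
  by rewrite leNgt (lt_le_trans u0)//= scale0r.
have [u1|u1] := leP (k.+1 ^ 2).*2%:R u.
  right; split.
    rewrite kk tE addrK normrM gtr0_norm// ler_pM2l//.
    apply: le_trans (ler_norm _); rewrite lerBrDr; apply: le_trans u1.
    by rewrite -addnn natrD.
  rewrite sE big_nat big1// => j /andP[_ jk].
  have -> : u < j.+1%:R = false.
    by apply/negbTE; rewrite -leNgt (le_trans _ u1)// ler_nat.
  by rewrite andbF scale0r.
left; have /andP[h1 h2] := truncn_itv u0.
have uk : (Num.trunc u < (k.+1 ^ 2).*2)%N.
  by rewrite -(ltr_nat R) (le_lt_trans h1).
exists (node l h k (Num.trunc u)).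
  rewrite tE /node opprD addrACA subrr addr0 -mulrBr normrM gtr0_norm//.
  rewrite ler_piMr ?(ltW d0)// opprB addrA subrK ger0_norm ?subr_ge0//.
  by rewrite lerBlDr addrC natr1 ltW.
rewrite sE (bigD1_seq (Num.trunc u)) ?mem_index_iota ?iota_uniq//= h1 h2 scale1r.
rewrite big1 ?addr0// => j ju; rewrite -truncn_eq// eq_sym (negbTE ju).
by rewrite scale0r.
Qed.

(** A majorant that does not depend on k: sampled values come from points within l of t, where
    [wt1_shift_le] compares the weights. *)
Lemma dist_riemann_le l h k f t (C : R) : 0 < l -> (forall t, `|f t| <= C * wt1 t) ->
  `|f t - step_fun (riemann_step l h k f) t| <= C * (1 + 2 * (1 + l ^+ 2)) * wt1 t.
Proof.
move=> l0 fC; have C0 : 0 <= C.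
  by have := le_trans (normr_ge0 _) (fC 0); rewrite pmulr_lge0// wt1_gt0.
apply: le_trans (ler_normB _ _) _; rewrite mulrDr mulr1 mulrDl lerD//.
have [[x tx ->]|[_ ->]] := step_fun_riemann h k f t l0; last first.
  rewrite normr0 !mulr_ge0 ?(ltW (wt1_gt0 _))//.
  by rewrite addr_ge0 ?sqr_ge0.
apply: le_trans (fC _) _; rewrite -mulrA ler_wpM2l//.
by apply: wt1_shift_le; rewrite (le_trans tx) ?mesh_le.
Qed.

Lemma step_fun_riemann_cvg l h f t : 0 < l -> continuous f ->
  step_fun (riemann_step l h k f) t @[k --> \oo] --> f t.
Proof.
move=> l0 cf; apply/cvgrPdist_le => e e0.
have /cvgrPdist_le/(_ e e0)/nbhs_ballP[d /= d0 dP] := cf t.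
near=> k.
have [[x tx ->]|[tx _]] := step_fun_riemann h k f t l0.
  apply: dP; apply: le_lt_trans tx _.
  rewrite ltr_pdivrMr// -ltr_pdivrMl// mulrC.
  near: k; exists (Num.trunc (l / d)) => // k /= kd.
  by rewrite (lt_le_trans (truncnS_gt _))// ler_nat.
exfalso; move: tx; apply/negP; rewrite -ltNge -ltr_pdivrMl// mulrC.
near: k; exists (Num.trunc (`|t - h| / l)) => // k /= kd.
by rewrite (lt_le_trans (truncnS_gt _))// ler_nat.
Unshelve. all: by end_near. Qed.

Lemma dist_riemann_cvg0 l h f (C : R) : 0 < l -> continuous f ->
  (forall t, `|f t| <= C * wt1 t) ->
  (\int[mu]_t (`|f t - step_fun (riemann_step l h k f) t|)%:E)%E @[k --> \oo] --> 0%E.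
Proof.
move=> l0 cf fC; have C0 : 0 <= C.
  by have := le_trans (normr_ge0 _) (fC 0); rewrite pmulr_lge0// wt1_gt0.
rewrite -(@integral0 _ _ R mu setT).
apply: (@dominated_cvg _ _ R mu setT measurableT
   (fun k t => (`|f t - step_fun (riemann_step l h k f) t|)%:E) (cst 0%E)
     (fun t => (C * (1 + 2 * (1 + l ^+ 2)) * wt1 t)%:E)) => //.
- move=> k; apply/measurable_EFinP; apply: measurable_norm_sub_step => //.
  exact: is_step_riemann.
- move=> t _; apply: cvg_EFin; first exact: nearW.
  rewrite /= -(normr0 V) -(subrr (f t)).
  by apply: cvg_norm; apply: cvgB; [exact: cvg_cst|exact: step_fun_riemann_cvg].
- by apply: integrable_wt1; rewrite mulr_ge0// addr_ge0// mulr_ge0// addr_ge0// sqr_ge0.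
- by move=> k t _; rewrite gee0_abs ?lee_fin//; exact: dist_riemann_le.
Qed.

(** The Riemann step functions converge to f in mean, so by [step_int_dist_le] the Riemann sums form
    a Cauchy sequence; its limit is the Bochner integral by definition. *)
Lemma is_bochner_riemann l h f (C : R) : 0 < l -> continuous f ->
  (forall t, `|f t| <= C * wt1 t) ->
  exists a, is_bochner f a /\ riemann l h k f @[k --> \oo] --> a.
Proof.
move=> l0 cf fC.
have s0 := dist_riemann_cvg0 h l0 cf fC.
have ms k := measurable_norm_sub_step cf (@is_step_riemann l h k f l0).
suff /cauchy_cvg : cauchy (riemann l h k f @[k --> \oo]).
  move=> /cvg_ex[a ha]; exists a; split=> //.
  exists (fun k => riemann_step l h k f); split => //.
  - by move=> k; exact: is_step_riemann.
  - by under eq_fun do rewrite step_int_riemann//.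
apply/cauchy_ballP => e e0.
have e20 : 0 < e / 2 by rewrite divr_gt0.
have : \forall k \near \oo, (\int[mu]_t (`|f t - step_fun (riemann_step l h k f) t|)%:E
    < (e / 2)%:E)%E.
  have : nbhs (0%E : \bar R) [set x | (x < (e / 2)%:E)%E].
    exists (e / 2) => //= x /=; rewrite sub0r normrN => xe.
    by rewrite lte_fin; apply: le_lt_trans xe; exact: ler_norm.
  by move=> /s0.
(* Two sums in S are both within e / 2 of f in mean, hence within e of each other. *)
move=> hk; pose S := (fun k => riemann l h k f) @` [set k |
  (\int[mu]_t (`|f t - step_fun (riemann_step l h k f) t|)%:E < (e / 2)%:E)%E].
have FS : (riemann l h k f @[k --> \oo]) S by apply: filterS hk => k kk; exists k.
exists (S, S) => // -[_ _] [[k kk <-] [m mm <-]] /=.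
rewrite -ball_normE/=.
rewrite -!step_int_riemann// -lte_fin.
apply: le_lt_trans (step_int_dist_le _ _ (ms k) (ms m)) _; [exact: is_step_riemann..|].
by rewrite [e]splitr EFinD; apply: lteD.
Qed.

Lemma bochnerE f a : is_bochner f a -> bochner f = a.
Proof.
move=> fa; apply: is_bochner_uniq (fa).
by apply: (@xgetPex V 0 [set a | is_bochner f a]); exists a.
Qed.

Lemma bochnerP f (C : R) : continuous f -> (forall t, `|f t| <= C * wt1 t) ->
  is_bochner f (bochner f).
Proof.
move=> cf fC; have [a [fa _]] := is_bochner_riemann 0 ltr01 cf fC.
by rewrite (bochnerE fa).
Qed.

Lemma riemann_cvg l h f (C : R) : 0 < l -> continuous f ->
  (forall t, `|f t| <= C * wt1 t) -> riemann l h k f @[k --> \oo] --> bochner f.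
Proof.
move=> l0 cf fC; have [a [fa ra]] := is_bochner_riemann h l0 cf fC.
by rewrite (bochnerE fa).
Qed.

Lemma bochner_norm_le f (C : R) : continuous f ->
  (forall t, `|f t| <= C * wt1 t) -> `|bochner f| <= C * pi.
Proof.
move=> cf fC; have C0 : 0 <= C.
  by have := le_trans (normr_ge0 _) (fC 0); rewrite pmulr_lge0// wt1_gt0.
rewrite -lee_fin -integral_wt1//.
apply: is_bochner_norm_le (bochnerP cf fC) _ fC.
apply: continuous_measurable_fun => t; apply: cvgM; first exact: cvg_cst.
exact: wt1_continuous.
Qed.

Lemma riemannB l h k f g : riemann l h k (fun t => f t - g t) =
  riemann l h k f - riemann l h k g.
Proof. by rewrite /riemann -sumrB; apply: eq_bigr => j _; rewrite scalerBr. Qed.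

Lemma bochnerB f g (C : R) : continuous f -> continuous g ->
  (forall t, `|f t| <= C * wt1 t) -> (forall t, `|g t| <= C * wt1 t) ->
  bochner (fun t => f t - g t) = bochner f - bochner g.
Proof.
move=> cf cg fC gC.
have cfg : continuous (fun t => f t - g t).
  by move=> t; apply: cvgB; [exact: cf|exact: cg].
have fgC t : `|f t - g t| <= (C + C) * wt1 t.
  by rewrite mulrDl; apply: le_trans (ler_normB _ _) _; rewrite lerD.
have h1 := riemann_cvg 0 ltr01 cfg fgC.
apply: (cvgn_eq (fun k => riemannB 1 0 k f g) h1).
by apply: cvgB; exact: riemann_cvg ltr01 _ _.
Qed.

(** The real dominated convergence theorem is applied to the norms |f_k - f|, which then control the
    integrals of f_k - f. *)
Lemma bochner_dominated (f_ : nat -> R -> V) f (C : R) :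
  (forall k, continuous (f_ k)) -> continuous f ->
  (forall k t, `|f_ k t| <= C * wt1 t) ->
  (forall t, f_ k t @[k --> \oo] --> f t) ->
  bochner (f_ k) @[k --> \oo] --> bochner f.
Proof.
move=> cf_ cf f_C f_f.
have C0 : 0 <= C.
  by have := le_trans (normr_ge0 _) (f_C 0 0); rewrite pmulr_lge0// wt1_gt0.
have fC t : `|f t| <= C * wt1 t.
  by apply: (cvgr_to_le (cvg_norm (f_f t))); exact: nearW.
have cd k : continuous (fun t => f_ k t - f t).
  by move=> t; apply: cvgB; [exact: cf_|exact: cf].
have dC k t : `|f_ k t - f t| <= (C + C) * wt1 t.
  by rewrite mulrDl; apply: le_trans (ler_normB _ _) _; rewrite lerD.
have m k : measurable_fun [set: measurableTypeR R] (fun t => `|f_ k t - f t|).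
  apply: continuous_measurable_fun => t; apply: cvg_norm; exact: cd.
have I0 : (\int[mu]_t (`|f_ k t - f t|)%:E)%E @[k --> \oo] --> 0%E.
  rewrite -(@integral0 _ _ R mu setT).
  apply: (@dominated_cvg _ _ R mu setT measurableT
    (fun k t => (`|f_ k t - f t|)%:E) (cst 0%E) (fun t => ((C + C) * wt1 t)%:E)) => //.
  - by move=> k; apply/measurable_EFinP.
  - move=> t _; apply: cvg_EFin; first exact: nearW.
    rewrite /= -(normr0 V) -(subrr (f t)).
    by apply: cvg_norm; apply: cvgB; [exact: f_f|exact: cvg_cst].
  - by apply: integrable_wt1; rewrite addr_ge0.
  - by move=> k t _; rewrite gee0_abs ?lee_fin.
apply/cvgrPdist_le => e e0.
have : \forall k \near \oo, (\int[mu]_t (`|f_ k t - f t|)%:E < e%:E)%E.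
  have : nbhs (0%E : \bar R) [set x | (x < e%:E)%E].
    exists e => //= x /=; rewrite sub0r normrN => xe.
    by rewrite lte_fin; apply: le_lt_trans xe; exact: ler_norm.
  by move=> /I0.
apply: filterS => k /= hk; rewrite distrC.
rewrite -(bochnerB (cf_ k) cf (f_C k) fC) -lee_fin; apply: le_trans (ltW hk).
by apply: is_bochner_norm_le (bochnerP (cd k) (dC k)) (m k) _.
Qed.

Lemma wt1_affine_le l h t : 0 < l ->
  wt1 (l * t + h) <= (1 + 2 * (1 + h ^+ 2) / l ^+ 2) * wt1 t.
Proof.
move=> l0; have [s sE] : exists s, s = l * t + h by eexists.
have tE : t = (s - h) / l by rewrite sE addrK mulrC mulKf ?gt_eqF.
rewrite -sE tE /wt1 exprMn exprVn.
set m := (l ^+ 2)^-1; have m0 : 0 < m by rewrite invr_gt0 exprn_gt0.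
have p1 : 0 < 1 + (s - h) ^+ 2 * m.
  by rewrite ltr_wpDr// mulr_ge0 ?sqr_ge0 ?(ltW m0).
have p2 : 0 < 1 + s ^+ 2 by rewrite ltr_wpDr// sqr_ge0.
rewrite ler_pdivlMr// mulrC ler_pdivrMr//.
have : 0 <= (s + h) ^+ 2 * m by rewrite mulr_ge0 ?sqr_ge0 ?(ltW m0).
have : 0 <= s ^+ 2 * h ^+ 2 * m.
  by apply: mulr_ge0 (ltW m0); apply: mulr_ge0; exact: sqr_ge0.
have : 0 <= s ^+ 2 by exact: sqr_ge0.
nra.
Qed.

(** The nodes with parameters l and h are the images under t |-> l t + h of those with parameters 1
    and 0, so the formula already holds exactly for Riemann sums. *)
Lemma bochner_affine f l h (C : R) : 0 < l -> continuous f ->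
  (forall t, `|f t| <= C * wt1 t) ->
  bochner (fun t => f (l * t + h)) = l^-1 *: bochner f.
Proof.
move=> l0 cf fC; have C0 : 0 <= C.
  by have := le_trans (normr_ge0 _) (fC 0); rewrite pmulr_lge0// wt1_gt0.
have cg : continuous (fun t => f (l * t + h)).
  move=> t; apply: continuous_comp; last exact: cf.
  by apply: cvgD; [apply: cvgM; [exact: cvg_cst|exact: cvg_id]|exact: cvg_cst].
have gC t : `|f (l * t + h)| <= C * (1 + 2 * (1 + h ^+ 2) / l ^+ 2) * wt1 t.
  by apply: le_trans (fC _) _; rewrite -mulrA ler_wpM2l// wt1_affine_le.
have h1 := riemann_cvg h l0 cf fC.
have h2 := riemann_cvg 0 ltr01 cg gC.
have E k : riemann l h k f = l *: riemann 1 0 k (fun t => f (l * t + h)).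
  rewrite /riemann scaler_sumr; apply: eq_bigr => j _.
  rewrite scalerA mulrA mulr1; congr (_ *: f _).
  by rewrite /node; ring.
rewrite (cvgn_eq E h1 (cvgZl_tmp (k := l) h2)).
by rewrite scalerA mulVf ?scale1r// gt_eqF.
Qed.

End riemann.

(** A bounded real-linear map commutes with each Riemann sum, and it is continuous. *)
Lemma bochner_linear {R : realType} (V W : completeNormedModType R) (L : V -> W)
    (M : R) (f : R -> V) (C : R) :
  (forall u v, L (u + v) = L u + L v) -> (forall (r : R) v, L (r *: v) = r *: L v) ->
  (forall v, `|L v| <= M * `|v|) -> continuous f ->
  (forall t, `|f t| <= C * wt1 t) -> bochner (fun t => L (f t)) = L (bochner f).
Proof.
move=> LD LZ LM cf fC; have C0 : 0 <= C.
  by have := le_trans (normr_ge0 _) (fC 0); rewrite pmulr_lge0// wt1_gt0.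
have LB u v : L (u - v) = L u - L v by rewrite -scaleN1r LD LZ scaleN1r.
have L0 : L 0 = 0 by rewrite -(subrr 0) LB subrr.
have cL : continuous L.
  move=> u; apply/cvgrPdist_le => e e0; near=> v; rewrite -LB.
  apply: le_trans (LM _) _.
  apply: (@le_trans _ _ ((`|M| + 1) * `|u - v|)).
    by rewrite ler_wpM2r// (le_trans (ler_norm _))// lerDl.
  rewrite -ler_pdivlMl ?ltr_wpDl// mulrC.
  near: v; apply: cvgr_dist_le; first exact: cvg_id.
  by rewrite divr_gt0// ltr_wpDl.
have cLf : continuous (fun t => L (f t)).
  by move=> t; apply: continuous_comp; [exact: cf|exact: cL].
have LfC t : `|L (f t)| <= `|M| * C * wt1 t.
  apply: le_trans (LM _) _; apply: (@le_trans _ _ (`|M| * `|f t|)).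
    by rewrite ler_wpM2r// ler_norm.
  by rewrite -mulrA ler_wpM2l.
have h1 := riemann_cvg 0 ltr01 cLf LfC.
have h2 : L (riemann 1 0 k f) @[k --> \oo] --> L (bochner f).
  by apply: continuous_cvg; [exact: cL|exact: riemann_cvg ltr01 cf fC].
apply: cvgn_eq h1 h2 => k; rewrite /riemann.
by elim/big_rec2: _ => [|j u v _ ->]; rewrite ?L0// LD LZ.
Unshelve. all: by end_near. Qed.

(** * Sequential continuity *)

Section sequential_continuity.
Context {R : realType}.
Implicit Types U V W : normedModType R.

(* Limits are taken along sequences throughout, as in dominated convergence.  *)
Definition scont U V (f : U -> V) := forall (u : nat -> U) (p : U),
  u k @[k --> \oo] --> p -> f (u k) @[k --> \oo] --> f p.

Lemma harmonic_nbhs (e : R) : 0 < e -> \forall k \near \oo, k.+1%:R^-1 < e.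
Proof.
move=> e0; near=> k; rewrite invf_plt ?posrE//.
near: k; exists (Num.trunc e^-1) => // k /= kd.
by rewrite (lt_le_trans (truncnS_gt _))// ler_nat.
Unshelve. all: by end_near. Qed.

(** If f is discontinuous at p, points within 1/(k + 1) of p whose values stay at distance e from f
    p form a sequence contradicting sequential continuity. *)
Lemma scontP U V (f : U -> V) : scont f <-> continuous f.
Proof.
split=> [sf p|cf u p up]; last by apply: continuous_cvg up; exact: cf.
apply: contrapT => /cvgrPdist_lt h.
have [e [e0 he]] : exists e : R, 0 < e /\ ~ (\forall x \near p, `|f p - f x| < e).
  apply: contrapT => k; apply: h => e e0; apply: contrapT => k'.
  by apply: k; exists e.
have /choice[u uP] k : exists x, `|p - x| < k.+1%:R^-1 /\ e <= `|f p - f x|.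
  apply: contrapT => hk; apply: he; apply/nbhs_ballP; exists k.+1%:R^-1 => /=.
    by rewrite invr_gt0.
  move=> x; rewrite -ball_normE/= => px; rewrite ltNge; apply/negP => ex.
  by apply: hk; exists x.
have up : u k @[k --> \oo] --> p.
  apply/cvgrPdist_lt => d d0; have := harmonic_nbhs d0.
  by apply: filterS => k; apply: lt_trans; have [] := uP k.
have /cvgrPdist_lt/(_ e e0)[N _ /(_ N (leqnn N))] := sf _ _ up.
by rewrite /= ltNge; have [_ ->] := uP N.
Qed.

(** The sequential criterion for real-valued functions, transported to V by applying it to |l - g
    h|. *)
Lemma dnbhs_seqP V (g : R -> V) (l : V) :
  (forall u : nat -> R, (forall k, u k != 0) -> u k @[k --> \oo] --> (0 : R) ->
    g (u k) @[k --> \oo] --> l) -> g h @[h --> 0^'] --> l.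
Proof.
move=> H; apply/cvgrPdist_lt => e e0.
have : `|l - g h| @[h --> 0^'] --> (0 : R).
  apply/cvgr_dnbhsP => u [u0 uc]; rewrite -(normr0 V) -(subrr l).
  by apply: cvg_norm; apply: cvgB; [exact: cvg_cst|exact: H].
move=> /cvgrPdist_lt/(_ e e0); apply: filterS => h.
by rewrite sub0r normrN normr_id.
Qed.

Lemma cvg_bigsum T (F : set_system T) {FF : Filter F} V I (r : seq I)
    (f : I -> T -> V) (l : I -> V) : (forall i, f i x @[x --> F] --> l i) ->
  \sum_(i <- r) f i x @[x --> F] --> \sum_(i <- r) l i.
Proof.
move=> fl; elim: r => [|i r IH].
  by rewrite big_nil; under eq_fun do rewrite big_nil; exact: cvg_cst.
by rewrite big_cons; under eq_fun do rewrite big_cons; exact: cvgD.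
Qed.

Lemma scont_mulmx m n (B : 'M[R]_(m, n)) : scont (fun y : 'rV[R]_m => y *m B).
Proof.
move=> u p up; rewrite mulmx_sum_row.
under eq_fun do rewrite mulmx_sum_row.
apply: cvg_bigsum => i; apply: cvgZr_tmp.
exact: (cvg_comp _ _ up (@coord_continuous R 1 m 0 i p)).
Qed.

Lemma row_mx_affine n (t : R) (y : 'rV[R]_n) : row_mx t%:M y =
  t *: (row_mx 1%:M 0 : 'rV_(1 + n)) + y *m row_mx 0 1%:M.
Proof.
rewrite mul_mx_row mulmx0 mulmx1 scale_row_mx scaler0 add_row_mx add0r addr0.
by rewrite scalemx1.
Qed.

Lemma cvg_row_mx n (t : nat -> R) (y : nat -> 'rV[R]_n) t0 y0 :
  t k @[k --> \oo] --> t0 -> y k @[k --> \oo] --> y0 ->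
  row_mx (t k)%:M (y k) @[k --> \oo] --> (row_mx t0%:M y0 : 'rV[R]_(1 + n)).
Proof.
move=> tt yy; rewrite row_mx_affine; under eq_fun do rewrite row_mx_affine.
by apply: cvgD; [exact: cvgZr_tmp|exact: scont_mulmx].
Qed.

End sequential_continuity.

(** * Iterated integrals over R^n *)

Section integral_rV.
Context {R : realType} {V : completeNormedModType R}.

(* An integrable majorant: its integral over R^n is pi^n. *)
Definition wt n (x : 'rV[R]_n) : R := \prod_i wt1 (x 0 i).

Lemma wt_gt0 n (x : 'rV[R]_n) : 0 < wt x.
Proof. by apply: prodr_gt0 => i _; exact: wt1_gt0. Qed.

Lemma wt_row_mx n t (y : 'rV[R]_n) : wt (row_mx t%:M y : 'rV_(1 + n)) = wt1 t * wt y.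
Proof.
rewrite /wt big_split_ord big_ord1/= row_mxEl mxE eqxx mulr1n; congr (_ * _).
by apply: eq_bigr => i _; rewrite row_mxEr.
Qed.

Lemma wt0 (x : 'rV[R]_0) : wt x = 1.
Proof. by rewrite /wt big_ord0. Qed.

Lemma integralRnS n (f : 'rV[R]_(1 + n) -> V) : integralRn (f : 'rV_n.+1 -> V) =
  bochner (fun t => integralRn (fun y : 'rV_n => f (row_mx t%:M y))).
Proof. by []. Qed.

Lemma bound_ge0 n (f : 'rV[R]_n -> V) (C : R) : (forall x, `|f x| <= C * wt x) -> 0 <= C.
Proof. by move=> /(_ 0)/(le_trans (normr_ge0 _)); rewrite pmulr_lge0// wt_gt0. Qed.

Lemma scont_slice n (f : 'rV[R]_(1 + n) -> V) t : scont f ->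
  scont (fun y : 'rV_n => f (row_mx t%:M y)).
Proof. by move=> sf u p up; apply: sf; apply: cvg_row_mx => //; exact: cvg_cst. Qed.

Lemma bound_slice n (f : 'rV[R]_(1 + n) -> V) (C : R) t :
  (forall x, `|f x| <= C * wt x) ->
  forall y : 'rV_n, `|f (row_mx t%:M y)| <= C * wt1 t * wt y.
Proof. by move=> fC y; apply: le_trans (fC _) _; rewrite wt_row_mx mulrA. Qed.

Lemma wt1_le1 (t : R) : wt1 t <= 1.
Proof. by rewrite invf_le1 ?lerDl ?sqr_ge0// ltr_wpDr ?sqr_ge0. Qed.

(** The two statements must be proved by a common induction on n: for the outermost integral in
    dimension 1 + n, the slice integrals have to be continuous, which is dominated convergence in
    dimension n, and bounded by a multiple of [wt1], which is the norm bound in dimension n. *)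
Definition norm_dominated n :=
  (forall (f : 'rV[R]_n -> V) (C : R), scont f -> (forall x, `|f x| <= C * wt x) ->
    `|integralRn f| <= C * pi ^+ n) /\
  (forall (f_ : nat -> 'rV[R]_n -> V) f (C : R), (forall k, scont (f_ k)) -> scont f ->
    (forall k x, `|f_ k x| <= C * wt x) -> (forall x, f_ k x @[k --> \oo] --> f x) ->
    integralRn (f_ k) @[k --> \oo] --> integralRn f).

Lemma integral_slice_of_dominated n (f : 'rV[R]_(1 + n) -> V) (C : R) :
  norm_dominated n -> scont f -> (forall x, `|f x| <= C * wt x) ->
  continuous (fun t => integralRn (fun y : 'rV_n => f (row_mx t%:M y))) /\
  forall t, `|integralRn (fun y : 'rV_n => f (row_mx t%:M y))| <= C * pi ^+ n * wt1 t.
Proof.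
move=> [IHb IHd] sf fC; have C0 := bound_ge0 fC; split=> [|t]; last first.
  rewrite mulrAC.
  by apply: IHb; [exact: scont_slice|exact: bound_slice].
apply/scontP => u p up.
apply: (IHd (fun k y => f (row_mx (u k)%:M y)) _ C) => //.
- by move=> k; exact: scont_slice.
- exact: scont_slice.
- move=> k y; apply: le_trans (bound_slice _ fC y) _.
  by rewrite ler_wpM2r ?(ltW (wt_gt0 _))// ler_piMr// wt1_le1.
- by move=> y; apply: sf; apply: cvg_row_mx => //; exact: cvg_cst.
Qed.

Lemma integralRn_norm_dominated n : norm_dominated n.
Proof.
elim: n => [|n IH].
  split=> [f C _ /(_ 0)|f_ f C _ _ _ /(_ 0)//].
  by rewrite wt0 expr0.
split=> [f C sf fC|f_ f C sf_ sf f_C f_f].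
  have [cF Fb] := integral_slice_of_dominated IH sf fC.
  by rewrite integralRnS exprSr mulrA; exact: bochner_norm_le.
have fC x : `|f x| <= C * wt x.
  by apply: (cvgr_to_le (cvg_norm (f_f x))); exact: nearW.
have [cF Fb] := integral_slice_of_dominated IH sf fC.
rewrite integralRnS; apply: (@bochner_dominated _ _
    (fun k t => integralRn (fun y : 'rV_n => f_ k (row_mx t%:M y))) _ (C * pi ^+ n)) => //.
- by move=> k; have [] := integral_slice_of_dominated IH (sf_ k) (f_C k).
- by move=> k; have [] := integral_slice_of_dominated IH (sf_ k) (f_C k).
- move=> t; apply: (IH.2 _ _ (C * wt1 t)) => //.
  + by move=> k; exact: scont_slice.
  + exact: scont_slice.
  + by move=> k; exact: bound_slice.
Qed.

Lemma integralRn_norm_le n (f : 'rV[R]_n -> V) (C : R) : scont f ->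
  (forall x, `|f x| <= C * wt x) -> `|integralRn f| <= C * pi ^+ n.
Proof. by have [+ _] := integralRn_norm_dominated n; apply. Qed.

Lemma integralRn_dominated n (f_ : nat -> 'rV[R]_n -> V) f (C : R) :
  (forall k, scont (f_ k)) -> scont f ->
  (forall k x, `|f_ k x| <= C * wt x) -> (forall x, f_ k x @[k --> \oo] --> f x) ->
  integralRn (f_ k) @[k --> \oo] --> integralRn f.
Proof. by have [_] := integralRn_norm_dominated n; apply. Qed.

Lemma continuous_integral_slice n (f : 'rV[R]_(1 + n) -> V) (C : R) : scont f ->
  (forall x, `|f x| <= C * wt x) ->
  continuous (fun t => integralRn (fun y : 'rV_n => f (row_mx t%:M y))).
Proof.
by move=> sf fC; have [] := integral_slice_of_dominated (integralRn_norm_dominated n) sf fC.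
Qed.

Lemma bound_integral_slice n (f : 'rV[R]_(1 + n) -> V) (C : R) t : scont f ->
  (forall x, `|f x| <= C * wt x) ->
  `|integralRn (fun y : 'rV_n => f (row_mx t%:M y))| <= C * pi ^+ n * wt1 t.
Proof.
by move=> sf fC; have [] := integral_slice_of_dominated (integralRn_norm_dominated n) sf fC.
Qed.

End integral_rV.

Lemma integralRn_linear {R : realType} (V W : completeNormedModType R) (L : V -> W)
    (M : R) n (f : 'rV[R]_n -> V) (C : R) :
  (forall u v, L (u + v) = L u + L v) -> (forall (r : R) v, L (r *: v) = r *: L v) ->
  (forall v, `|L v| <= M * `|v|) -> scont f ->
  (forall x, `|f x| <= C * wt x) -> integralRn (fun x => L (f x)) = L (integralRn f).
Proof.
move=> LD LZ LM; elim: n f C => [//|n IH] f C sf fC.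
rewrite !integralRnS.
under eq_fun do rewrite (IH _ _ (scont_slice sf) (bound_slice _ fC)).
apply: (bochner_linear LD LZ LM (continuous_integral_slice sf fC)).
by move=> t; exact: bound_integral_slice sf fC.
Qed.

(** * Exchange of integrals *)

Section fubini.
Context {R : realType} {V : completeNormedModType R}.

(** Joint continuity along sequences, for integrands in two variables and for bilinear maps
    alike. *)
Definition jcont (U W X : normedModType R) (H : U -> W -> X) :=
  forall (u : nat -> U) (w : nat -> W) u0 w0,
  u k @[k --> \oo] --> u0 -> w k @[k --> \oo] --> w0 ->
  H (u k) (w k) @[k --> \oo] --> H u0 w0.

Lemma jcont_r (U W X : normedModType R) (H : U -> W -> X) u : jcont H -> scont (H u).
Proof. by move=> cH w p wp; apply: cH => //; exact: cvg_cst. Qed.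

Lemma jcont_l (U W X : normedModType R) (H : U -> W -> X) w : jcont H -> scont (H ^~ w).
Proof. by move=> cH u p up; apply: cH => //; exact: cvg_cst. Qed.

(** The factor 4 is 2 (1 + l^2) from [wt1_shift_le] at l = 1; since it does not depend on k, the
    bound can serve in dominated convergence. *)
Lemma riemann_norm_le (f : R -> V) (C : R) k : (forall t, `|f t| <= C * wt1 t) ->
  `|riemann 1 0 k f| <= C * 4 * pi.
Proof.
move=> fC; have C0 : 0 <= C.
  by have := le_trans (normr_ge0 _) (fC 0); rewrite pmulr_lge0// wt1_gt0.
rewrite -step_int_riemann// -lee_fin -integral_wt1 ?mulr_ge0//.
apply: norm_step_int_le; first exact: is_step_riemann.
  apply: continuous_measurable_fun => t; apply: cvgM; first exact: cvg_cst.
  exact: wt1_continuous.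
move=> t; have [[x tx ->]|[_ ->]] := step_fun_riemann 0 k f t ltr01; last first.
  by rewrite normr0 !mulr_ge0// ltW// wt1_gt0.
apply: le_trans (fC _) _; rewrite -mulrA ler_wpM2l//.
apply: le_trans (wt1_shift_le (le_trans tx (mesh_le k ltr01))) _.
by rewrite expr1n; lra.
Qed.

Lemma riemann_bochner (H : R -> R -> V) (C : R) k : jcont H ->
  (forall s t, `|H s t| <= C * wt1 s * wt1 t) ->
  riemann 1 0 k (fun t => bochner (H ^~ t)) = bochner (fun s => riemann 1 0 k (H s)).
Proof.
move=> cH HC; have C0 : 0 <= C.
  have := le_trans (normr_ge0 _) (HC 0 0).
  by rewrite -mulrA pmulr_lge0// mulr_gt0// wt1_gt0.
have cHl t : continuous (H ^~ t) by apply/scontP; exact: jcont_l.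
have HCl t s : `|H s t| <= C * wt1 s.
  by apply: le_trans (HC s t) _; rewrite ler_piMr ?wt1_le1// mulr_ge0// ltW// wt1_gt0.
rewrite /riemann; move: (index_iota _ _) (1 / _) => r d.
pose G (r : seq nat) := bochner (fun s => \sum_(j <- r) d *: H s (node 1 0 k j)).
suff : \sum_(j <- r) d *: bochner (H ^~ (node 1 0 k j)) = G r by [].
have cG q : continuous (fun s => \sum_(j <- q) d *: H s (node 1 0 k j)).
  by move=> s; apply: cvg_bigsum => j; apply: cvgZl_tmp; exact: cHl.
have GC q s : `|\sum_(j <- q) d *: H s (node 1 0 k j)| <=
    (size q)%:R * (`|d| * C) * wt1 s.
  elim: q => [|j q IH]; first by rewrite big_nil normr0 !mul0r.
  rewrite big_cons/= -natr1 mulrDl mul1r mulrDl [leRHS]addrC.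
  apply: le_trans (ler_normD _ _) _; rewrite lerD//.
  by rewrite normrZ -mulrA ler_wpM2l.
elim: r => [|j r IH].
  rewrite big_nil /G; under eq_fun do rewrite big_nil.
  apply/esym/normr0_eq0/eqP; rewrite eq_le normr_ge0 andbT.
  rewrite -[leRHS](mul0r pi); apply: bochner_norm_le.
    by move=> ?; exact: cvg_cst.
  by move=> t; rewrite normr0 mul0r.
rewrite big_cons IH.
have -> : d *: bochner (H^~ (node 1 0 k j)) =
    bochner (fun s => d *: H s (node 1 0 k j)).
  apply/esym; apply: (@bochner_linear _ _ _ (fun v => d *: v) `|d| _ C) => //.
  - by move=> u v; rewrite scalerDr.
  - by move=> a v; rewrite !scalerA mulrC.
  - by move=> v; rewrite normrZ.
set F := (fun s => d *: H s (node 1 0 k j)).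
have FC s : `|F s| <= `|d| * C * wt1 s by rewrite normrZ -mulrA ler_wpM2l.
have cF : continuous F by move=> s; apply: cvgZl_tmp; exact: cHl.
pose M := (size (j :: r))%:R * (`|d| * C).
have M1 : `|d| * C <= M.
  by rewrite /M -{1}[_ * C]mul1r ler_wpM2r ?mulr_ge0// ler1n.
have M2 : (size r)%:R * (`|d| * C) <= M by rewrite /M ler_wpM2r ?mulr_ge0// ler_nat.
have w0 (s : R) := ltW (wt1_gt0 s).
(* Additivity is read off from [bochnerB]: the term at j is the sum over the whole list minus the
   sum over its tail, and M bounds both sums. *)
have := bochnerB (cG (j :: r)) (cG r) (GC (j :: r))
  (fun s => le_trans (GC r s) (ler_wpM2r (w0 s) M2)).
have -> : (fun t => \sum_(j0 <- j :: r) d *: H t (node 1 0 k j0) -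
   \sum_(j0 <- r) d *: H t (node 1 0 k j0)) = F.
  by apply/funext => t; rewrite big_cons addrK.
by move=> ->; rewrite subrK.
Qed.

(** The Riemann sums in t of the inner integrals converge to the right-hand side. By
    [riemann_bochner] they are integrals in s of Riemann sums in t, which converge to the left-hand
    side by dominated convergence. *)
Lemma bochner_fubini (H : R -> R -> V) (C : R) : jcont H ->
  (forall s t, `|H s t| <= C * wt1 s * wt1 t) ->
  bochner (fun s => bochner (H s)) = bochner (fun t => bochner (H ^~ t)).
Proof.
move=> cH HC; have C0 : 0 <= C.
  have := le_trans (normr_ge0 _) (HC 0 0).
  by rewrite -mulrA pmulr_lge0// mulr_gt0// wt1_gt0.
have w0 (s : R) := ltW (wt1_gt0 s).
have HCl t s : `|H s t| <= C * wt1 s.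
  by apply: le_trans (HC s t) _; rewrite ler_piMr ?wt1_le1// mulr_ge0.
have HCr s t : `|H s t| <= C * wt1 t.
  by apply: le_trans (HC s t) _; rewrite mulrAC ler_piMr ?wt1_le1// mulr_ge0.
have cont (G : R -> R -> V) : jcont G -> (forall s t, `|G s t| <= C * wt1 t) ->
    continuous (fun s => bochner (G s)).
  move=> cG GC; apply/scontP => u p up; apply: (bochner_dominated (C := C)) => //.
  - by move=> k; apply/scontP; exact: jcont_r.
  - by apply/scontP; exact: jcont_r.
  - by move=> t; exact: jcont_l.
have cHC : jcont (fun t s => H s t) by move=> u w u0 w0' hu hw; exact: cH.
have bl t : `|bochner (H ^~ t)| <= C * pi * wt1 t.
  rewrite mulrAC; apply: bochner_norm_le; last by move=> s; rewrite mulrAC.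
  by apply/scontP; exact: jcont_l.
have br s : `|bochner (H s)| <= C * pi * wt1 s.
  by rewrite mulrAC; apply: bochner_norm_le => //; apply/scontP; exact: jcont_r.
have h1 := riemann_cvg 0 ltr01 (cont _ cHC HCl) bl.
apply: esym; apply: cvgn_eq h1 _; first by move=> k; exact: (riemann_bochner k cH HC).
apply: (bochner_dominated (C := C * 4 * pi)).
- move=> k s; apply: cvg_bigsum => j; apply: cvgZl_tmp.
  by apply: (iffLR (scontP (H ^~ _))); exact: jcont_l.
- exact: cont.
- move=> k s; rewrite (_ : C * 4 * pi * wt1 s = C * wt1 s * 4 * pi); last by ring.
  exact: riemann_norm_le.
- move=> s; apply: (@riemann_cvg _ _ 1 0 (H s) C) => //.
  by apply/scontP; exact: jcont_r.
Qed.

Lemma bochner_integralRn_fubini m (H : R -> 'rV[R]_m -> V) (C : R) : jcont H ->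
  (forall s y, `|H s y| <= C * wt1 s * wt y) ->
  bochner (fun s => integralRn (H s)) = integralRn (fun y => bochner (H ^~ y)).
Proof.
elim: m H C => [//|m IH] H C cH HC.
have w0 (s : R) : 0 <= wt1 s by rewrite ltW// wt1_gt0.
have W0 k (y : 'rV[R]_k) : 0 <= wt y by rewrite ltW// wt_gt0.
have C0 : 0 <= C.
  have := le_trans (normr_ge0 _) (HC 0 0).
  by rewrite -mulrA pmulr_lge0// mulr_gt0 ?wt1_gt0// wt_gt0.
have HC' s t (y : 'rV_m) : `|H s (row_mx t%:M y : 'rV_(1 + m))| <=
    C * wt1 s * wt1 t * wt y.
  by apply: le_trans (HC _ _) _; rewrite wt_row_mx mulrA.
rewrite integralRnS.
have -> : (fun t => integralRn (fun y : 'rV_m =>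
      bochner (H^~ (row_mx t%:M y : 'rV_(1 + m))))) =
    (fun t => bochner (fun s => integralRn (fun y : 'rV_m =>
      H s (row_mx t%:M y : 'rV_(1 + m))))).
  apply/funext => t; apply/esym; apply: (IH _ (C * wt1 t)).
    move=> u w u0 w0' hu hw; apply: cH => //.
    by apply: cvg_row_mx => //; exact: cvg_cst.
  by move=> s y; apply: le_trans (HC' _ _ _) _; rewrite (mulrAC C).
apply: (@bochner_fubini (fun s t => integralRn (fun y : 'rV_m =>
      H s (row_mx t%:M y : 'rV_(1 + m)))) (C * pi ^+ m)).
  move=> u t u0 t0 hu ht; apply: (integralRn_dominated (C := C)).
  - by move=> k; apply: scont_slice; exact: jcont_r.
  - by apply: scont_slice; exact: jcont_r.
  - move=> k y; apply: le_trans (HC' _ _ _) _; rewrite ler_wpM2r// -mulrA ler_piMr//.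
    by rewrite mulr_ile1 ?w0 ?wt1_le1.
  - by move=> y; apply: cH => //; apply: cvg_row_mx => //; exact: cvg_cst.
move=> s t; rewrite -mulrA mulrAC mulrA.
by apply: integralRn_norm_le => //; apply: scont_slice; exact: jcont_r.
Qed.

(** The first coordinate of x is split off: the induction hypothesis moves the y integral past the
    other coordinates, and [bochner_integralRn_fubini] past the first. *)
Lemma integralRn_fubini n m (H : 'rV[R]_n -> 'rV[R]_m -> V) (C : R) : jcont H ->
  (forall x y, `|H x y| <= C * wt x * wt y) ->
  integralRn (fun x => integralRn (H x)) = integralRn (fun y => integralRn (H ^~ y)).
Proof.
elim: n H C => [//|n IH] H C cH HC.
have w0 (s : R) : 0 <= wt1 s by rewrite ltW// wt1_gt0.
have W0 k (y : 'rV[R]_k) : 0 <= wt y by rewrite ltW// wt_gt0.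
have C0 : 0 <= C.
  have := le_trans (normr_ge0 _) (HC 0 0).
  by rewrite -mulrA pmulr_lge0// mulr_gt0 ?wt_gt0.
have HC' t (x : 'rV_n) y : `|H (row_mx t%:M x : 'rV_(1 + n)) y| <=
    C * wt1 t * wt x * wt y.
  by apply: le_trans (HC _ _) _; rewrite wt_row_mx mulrA.
rewrite integralRnS.
have -> : (fun t => integralRn (fun x : 'rV_n =>
      integralRn (H (row_mx t%:M x : 'rV_(1 + n))))) =
    (fun t => integralRn (fun y => integralRn (fun x : 'rV_n =>
      H (row_mx t%:M x : 'rV_(1 + n)) y))).
  apply/funext => t; apply: (IH _ (C * wt1 t)) => //.
  move=> u w u0 w0' hu hw; apply: cH => //.
  by apply: cvg_row_mx => //; exact: cvg_cst.
apply: (@bochner_integralRn_fubini _ (fun t y => integralRn (fun x : 'rV_n =>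
      H (row_mx t%:M x : 'rV_(1 + n)) y)) (C * pi ^+ n)).
  move=> t y t0 y0 ht hy; apply: (integralRn_dominated (C := C)).
  - by move=> k; apply: (@scont_slice _ _ _ (H^~ _)); exact: jcont_l.
  - by apply: (@scont_slice _ _ _ (H^~ _)); exact: jcont_l.
  - move=> k x; apply: le_trans (HC' _ _ _) _; rewrite -!mulrA ler_wpM2l//.
    rewrite mulrCA ler_piMr// mulr_ile1 ?w0 ?W0 ?wt1_le1//.
    by apply: prodr_ile1 => i _; rewrite w0 wt1_le1.
  - by move=> x; apply: cH => //; apply: cvg_row_mx => //; exact: cvg_cst.
move=> t y; rewrite -mulrA mulrAC mulrA mulrAC -mulrA.
apply: le_trans (integralRn_norm_le (C := C * wt1 t * wt y) _ _) _.
- by apply: (@scont_slice _ _ _ (H^~ _)); exact: jcont_l.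
- by move=> x; apply: le_trans (HC' _ _ _) _; rewrite mulrAC.
- by rewrite le_eqVlt; apply/orP; left; apply/eqP; ring.
Qed.

End fubini.

(** * Dilations and translations of R^n *)

Section affine.
Context {R : realType} {V : completeNormedModType R}.

Lemma integralRn_affine n (f : 'rV[R]_n -> V) l (h : 'rV[R]_n) (C : R) : 0 < l ->
  scont f -> (forall x, `|f x| <= C * wt x) ->
  integralRn (fun x => f (l *: x + h)) = l ^- n *: integralRn f.
Proof.
move=> l0; elim: n f h C => [|n IH] f h C sf fC.
  by rewrite expr0 invr1 scale1r /=; congr f; apply/rowP => -[].
pose h1 : R := h 0 0; pose h2 : 'rV_n := rsubmx (h : 'rV_(1 + n)).
have hE : h = row_mx h1%:M h2 :> 'rV_(1 + n).
  rewrite -[LHS](hsubmxK (h : 'rV_(1 + n))); congr row_mx.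
  by apply/rowP => i; rewrite !ord1 !mxE/= mulr1n; congr (h _ _); exact: val_inj.
have E t (y : 'rV_n) : l *: (row_mx t%:M y : 'rV_(1 + n)) + h =
    row_mx (l * t + h1)%:M (l *: y + h2).
  by rewrite hE scale_row_mx add_row_mx scale_scalar_mx raddfD.
rewrite !integralRnS; under eq_fun do under eq_fun do rewrite E.
under eq_fun do rewrite (IH _ _ _ (scont_slice sf) (bound_slice _ fC)).
have cF := continuous_integral_slice sf fC.
have bF t := bound_integral_slice t sf fC.
rewrite (@bochner_linear _ _ _ (fun v => l ^- n *: v) `|l ^- n|
   (fun t => integralRn (fun y : 'rV_n => f (row_mx (l * t + h1)%:M y)))
   (C * pi ^+ n * (1 + 2 * (1 + h1 ^+ 2) / l ^+ 2))).
- by rewrite (bochner_affine h1 l0 cF bF) scalerA exprSr invfM.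
- by move=> u v; rewrite scalerDr.
- by move=> a v; rewrite !scalerA mulrC.
- by move=> v; rewrite normrZ.
- apply/scontP => u p up; apply: ((scontP _).2 cF (fun k => l * u k + h1)).
  by apply: cvgD; [exact: cvgMl_tmp|exact: cvg_cst].
- move=> t; apply: le_trans (bF _) _; rewrite -[leRHS]mulrA ler_wpM2l ?wt1_affine_le//.
  by rewrite mulr_ge0 ?exprn_ge0 ?pi_ge0// (bound_ge0 fC).
Qed.

End affine.

(** * Directional derivatives and the mean value inequality *)

Section sequential_derivative.
Context {R : realType}.
Implicit Types U V W X : normedModType R.

(** Existence and value of the directional derivative in one relation, so that derivatives are
    computed as limits of sequences; [sderivP] returns to the derivative used in [partials]. *)
Definition sderiv U V (f : U -> V) (x v : U) (d : V) := forall u : nat -> R,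
  (forall k, u k != 0) -> u k @[k --> \oo] --> (0 : R) ->
  (u k)^-1 *: (f (u k *: v + x) - f x) @[k --> \oo] --> d.

Lemma cvgn_ext V (u v : nat -> V) (l : V) : (forall k, v k = u k) ->
  u k @[k --> \oo] --> l -> v k @[k --> \oo] --> l.
Proof. by move=> /funext->. Qed.

Lemma dnbhs_seq V (g : R -> V) (l : V) : g h @[h --> 0^'] --> l ->
  forall u : nat -> R, (forall k, u k != 0) -> u k @[k --> \oo] --> (0 : R) ->
    g (u k) @[k --> \oo] --> l.
Proof.
move=> gl u u0 uc; apply/cvgrPdist_lt => e e0.
have /cvgrPdist_lt/(_ e e0)/nbhs_ballP[d /= d0 dP] := gl.
have /cvgrPdist_lt/(_ d d0) := uc; apply: filterS => k kd.
by apply: dP => //; rewrite -ball_normE.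
Qed.

Lemma sderivP U V (f : U -> V) (x v : U) (d : V) :
  sderiv f x v d <-> derivable f x v /\ 'D_v f x = d.
Proof.
split=> [fd|[/[swap] <- fd]].
  have h : h^-1 *: ((f \o shift x) (h *: v) - f x) @[h --> 0^'] --> d.
    exact: dnbhs_seqP.
  by split; [apply/cvg_ex; exists d|exact/cvg_lim].
exact: dnbhs_seq fd.
Qed.

Lemma sderiv_unique U V (f : U -> V) x v d d' :
  sderiv f x v d -> sderiv f x v d' -> d = d'.
Proof. by move=> /sderivP[_ <-] /sderivP[_ <-]. Qed.

Lemma sderiv_cvg U V (f : U -> V) x v d (u : nat -> R) : sderiv f x v d ->
  (forall k, u k != 0) -> u k @[k --> \oo] --> (0 : R) ->
  f (u k *: v + x) @[k --> \oo] --> f x.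
Proof.
move=> fd u0 uc; have h := fd u u0 uc.
have : u k *: ((u k)^-1 *: (f (u k *: v + x) - f x)) + f x @[k --> \oo] -->
   (0 : R) *: d + f x by apply: cvgD; [exact: cvgZ|exact: cvg_cst].
rewrite scale0r add0r; apply: cvgn_ext => k.
by rewrite scalerA divff// scale1r subrK.
Qed.

Lemma sderiv_cst U V (c : V) (x v : U) : sderiv (fun=> c) x v 0.
Proof.
by move=> u _ _; under eq_fun do rewrite subrr scaler0; exact: cvg_cst.
Qed.

Lemma sderivD U V (f g : U -> V) x v d e : sderiv f x v d -> sderiv g x v e ->
  sderiv (fun x => f x + g x) x v (d + e).
Proof.
move=> fd ge u u0 uc; apply: (cvgn_ext _ (cvgD (fd u u0 uc) (ge u u0 uc))) => k /=.
by rewrite -scalerDr opprD addrACA.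
Qed.

(** The difference quotient splits as B(quotient of f, g at the moved point) + B(f x, quotient of
    g), and g at the moved point tends to g x. *)
Lemma sderiv_bilinear U V W X (B : V -> W -> X) (f : U -> V) (g : U -> W) x v d e :
  (forall a b c, B (a + b) c = B a c + B b c) ->
  (forall a b c, B a (b + c) = B a b + B a c) ->
  (forall (r : R) a b, B (r *: a) b = r *: B a b) ->
  (forall (r : R) a b, B a (r *: b) = r *: B a b) ->
  jcont B -> sderiv f x v d -> sderiv g x v e ->
  sderiv (fun x => B (f x) (g x)) x v (B d (g x) + B (f x) e).
Proof.
move=> BDl BDr BZl BZr cB fd ge u u0 uc.
have gc := sderiv_cvg ge u0 uc.
have c1 : B ((u k)^-1 *: (f (u k *: v + x) - f x)) (g (u k *: v + x))
   @[k --> \oo] --> B d (g x) by apply: cB => //; exact: fd.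
have c2 : B (f x) ((u k)^-1 *: (g (u k *: v + x) - g x)) @[k --> \oo] --> B (f x) e.
  by apply: cB; [exact: cvg_cst|exact: ge].
apply: (cvgn_ext _ (cvgD c1 c2)) => k /=.
have BBl a b c : B (a - b) c = B a c - B b c by rewrite BDl -scaleN1r BZl scaleN1r.
have BBr a b c : B a (b - c) = B a b - B a c by rewrite BDr -scaleN1r BZr scaleN1r.
by rewrite BZl BZr -scalerDr BBl BBr addrA subrK.
Qed.

Lemma sderiv_linear U V W (L : V -> W) (f : U -> V) x v d :
  (forall a b, L (a + b) = L a + L b) -> (forall (r : R) a, L (r *: a) = r *: L a) ->
  scont L -> sderiv f x v d -> sderiv (fun x => L (f x)) x v (L d).
Proof.
move=> LD LZ cL fd u u0 uc; apply: (cvgn_ext _ (cL _ _ (fd u u0 uc))) => k /=.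
by rewrite LZ LD -[- f x]scaleN1r LZ scaleN1r.
Qed.

Lemma sderivZ U V (r : U -> R) (f : U -> V) x v (s : R) d :
  sderiv r x v s -> sderiv f x v d ->
  sderiv (fun x => r x *: f x) x v (s *: f x + r x *: d).
Proof.
apply: (@sderiv_bilinear U R V V (fun a b => a *: b)).
- by move=> a b c; rewrite scalerDl.
- by move=> a b c; rewrite scalerDr.
- by move=> t a b; rewrite scalerA.
- by move=> t a b; rewrite !scalerA mulrC.
- by move=> u w u0 w0 hu hw; exact: cvgZ.
Qed.

Lemma sderiv_scale_dir U V (f : U -> V) x v d (c : R) :
  sderiv f x v d -> sderiv f x (c *: v) (c *: d).
Proof.
move=> fd u u0 uc; have [->|c0] := eqVneq c 0.
  rewrite !scale0r; under eq_fun do rewrite scaler0 add0r subrr scaler0.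
  exact: cvg_cst.
have h : (u k * c)^-1 *: (f ((u k * c) *: v + x) - f x) @[k --> \oo] --> d.
  apply: fd; first by move=> k; rewrite mulf_neq0.
  by rewrite -(mul0r c); exact: cvgMr_tmp.
apply: (cvgn_ext _ (cvgZl_tmp (k := c) h)) => k /=.
by rewrite !scalerA invfM mulrCA divff// mulr1.
Qed.

Lemma sderiv_line U V (f : U -> V) x v (t : R) d : sderiv f (t *: v + x) v d ->
  sderiv (fun t : R => f (t *: v + x)) t 1 d.
Proof.
move=> fd u u0 uc; apply: (cvgn_ext _ (fd u u0 uc)) => k /=.
by rewrite [u k *: (1 : R)]mulr1 scalerDl addrA.
Qed.

Lemma sderiv_of_line U V (f : U -> V) x v d :
  sderiv (fun t : R => f (t *: v + x)) 0 1 d -> sderiv f x v d.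
Proof.
move=> fd u u0 uc; apply: (cvgn_ext _ (fd u u0 uc)) => k /=.
by rewrite [u k *: (1 : R)]mulr1 addr0 scale0r add0r.
Qed.

(* The points where the increment of f is at most (M + e) times that of the   *)
(* argument form a closed set, whose supremum cannot be smaller than b.       *)
Lemma mean_value_le V (f f' : R -> V) (a b M : R) : a <= b ->
  (forall t, a <= t <= b -> sderiv f t 1 (f' t)) ->
  (forall t, a <= t <= b -> `|f' t| <= M) -> `|f b - f a| <= M * (b - a).
Proof.
move=> ab fd fM; apply/ler_addgt0Pr => e0' e0'0.
pose e := e0' / (b - a + 1).
have ba1 : 0 < b - a + 1 by rewrite ltr_wpDl// subr_ge0.
have e0 : 0 < e by rewrite divr_gt0.
suff : `|f b - f a| <= (M + e) * (b - a).
  move=> /le_trans; apply; rewrite mulrDl lerD2l /e mulrAC ler_pdivrMr//.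
  by rewrite ler_wpM2l ?(ltW e0'0)// lerDl.
pose g t := `|f t - f a| - (M + e) * (t - a).
suff : g b <= 0 by rewrite subr_le0.
rewrite leNgt; apply/negP => gb.
have slope t : a <= t <= b -> \forall h \near 0^', `|f (h + t) - f t| <= (M + e) * `|h|.
  move=> tab.
  have h : h^-1 *: (f (h *: (1 : R) + t) - f t) @[h --> 0^'] --> f' t.
    by apply: dnbhs_seqP => u u0 uc; exact: (fd t tab u).
  have hM : `|f' t| < M + e by rewrite (le_lt_trans (fM t tab))// ltrDl.
  have hn : \forall s \near 0^', `|s^-1 *: (f (s *: (1 : R) + t) - f t)| < M + e.
    exact: cvgr_lt (cvg_norm h) _ hM.
  near=> s; have s0 : s != 0 by near: s; exact: nbhs_dnbhs_neq.
  have : `|s^-1 *: (f (s *: (1 : R) + t) - f t)| < M + e by near: s.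
  rewrite normrZ normfV mulrC ltr_pdivrMr ?normr_gt0// => /ltW.
  by rewrite [s *: (1 : R)]mulr1.
pose S := [set t | a <= t <= b /\ g t <= 0].
have Sa : S a by split; rewrite ?lexx// /g !subrr normr0 mulr0 subrr.
have hsS : has_sup S by split; [exists a|exists b => t [/andP[]]].
pose c := sup S.
have ac : a <= c by apply: ub_le_sup Sa; exact: hsS.2.
have cb : c <= b by apply: ge_sup; [exact: hsS.1|move=> t [/andP[]]].
have cab : a <= c <= b by rewrite ac.
have [d /= d0 dP] := slope c cab.
have Sc : S c.
  split=> //; have [s [sab gs] sc] := sup_adherent d0 hsS.
  have sc' : s <= c by apply: ub_le_sup (conj sab gs); exact: hsS.2.
  have [<-//|s'c] := eqVneq s c.
  have : `|f (s - c + c) - f c| <= (M + e) * `|s - c|.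
    apply: dP; last by rewrite subr_eq0.
    by rewrite /= sub0r normrN distrC ger0_norm ?subr_ge0// ltrBlDr addrC -ltrBlDr.
  rewrite subrK [`|s - c|]distrC [`|c - s|]ger0_norm ?subr_ge0// => h.
  have := ler_normD (f s - f a) (f c - f s); rewrite addrC addrA subrK.
  move: gs h; rewrite /g [`|f s - f c|]distrC; nra.
have cb' : c < b.
  rewrite lt_neqAle cb andbT; apply/eqP => cE.
  by have := Sc.2; rewrite cE leNgt gb.
pose h := Num.min (d / 2) (b - c).
have h0 : 0 < h by rewrite lt_min divr_gt0//= subr_gt0.
have hd : h < d.
  by rewrite gt_min ltr_pdivrMr// mulr_natr mulr2n ltrDl d0.
have hb : h <= b - c by rewrite ge_min lexx orbT.
have Sch : S (h + c).
  have a1 : a <= h + c by rewrite (le_trans ac)// lerDr ltW.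
  have b1 : h + c <= b by rewrite -lerBrDr.
  split; first by rewrite a1.
  have : `|f (h + c) - f c| <= (M + e) * `|h|.
    by apply: dP; rewrite ?gt_eqF//= sub0r normrN gtr0_norm.
  rewrite [`|h|]gtr0_norm// => hh.
  have := ler_normD (f c - f a) (f (h + c) - f c); rewrite addrC addrA subrK.
  move: Sc.2 hh; rewrite /g; nra.
have : h + c <= c by apply: ub_le_sup Sch; exact: hsS.2.
by rewrite leNgt ltrDr h0.
Unshelve. all: by end_near. Qed.

Lemma mean_value_line U V (f : U -> V) (f' : R -> V) x v (M : R) :
  (forall t, 0 <= t <= 1 -> sderiv f (t *: v + x) v (f' t)) ->
  (forall t, 0 <= t <= 1 -> `|f' t| <= M) -> `|f (v + x) - f x| <= M.
Proof.
move=> fd fM; have := @mean_value_le _ (fun t : R => f (t *: v + x)) f' 0 1 M ler01.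
rewrite scale1r scale0r add0r subr0 mulr1; apply=> // t t01.
by apply: sderiv_line; exact: fd.
Qed.

End sequential_derivative.

(** * Smooth functions and linear substitutions *)

Section smoothness.
Context {R : realType} {V : normedModType R}.

Local Notation e_ i := (delta_mx 0 i).

Lemma sderiv_partial m (f : 'rV[R]_m -> V) x i :
  derivable f x (e_ i) -> sderiv f x (e_ i) ('D_(e_ i) f x).
Proof. by move=> h; apply/sderivP. Qed.

Lemma smooth_scont m (f : 'rV[R]_m -> V) s : smooth f -> scont (partials s f).
Proof. by move=> sf; apply/scontP; have [] := sf s. Qed.

Lemma smooth_sderiv m (f : 'rV[R]_m -> V) s x i : smooth f ->
  sderiv (partials s f) x (e_ i) (partials (i :: s) f x).
Proof. by move=> sf; apply: sderiv_partial; have [_] := sf s; apply. Qed.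

(** A coinduction principle: a class of continuous functions that contains the partial derivatives
    of its members consists of smooth functions. Smoothness proofs then come down to finding a class
    closed under differentiation. *)
Lemma smooth_coind m (Q : ('rV[R]_m -> V) -> Prop) :
  (forall f, Q f -> scont f /\
     forall i, exists2 g, Q g & forall x, sderiv f x (e_ i) (g x)) ->
  forall f, Q f -> smooth f /\ forall s, Q (partials s f).
Proof.
move=> HQ f Qf; have Qs s : Q (partials s f).
  elim: s => //= i s /HQ[_ /(_ i)[g Qg gd]].
  by rewrite (_ : (fun x => _) = g)//; apply/funext => x; have /sderivP[] := gd x.
split=> // s; have [/scontP ? H] := HQ _ (Qs s); split=> // x i.
by have [g _ /(_ x)/sderivP[]] := H i.
Qed.

Lemma partials_cat m (f : 'rV[R]_m -> V) s1 s2 :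
  partials (s1 ++ s2) f = partials s1 (partials s2 f).
Proof. by elim: s1 => //= i s ->. Qed.

Lemma smooth_partials m (f : 'rV[R]_m -> V) s : smooth f -> smooth (partials s f).
Proof. by move=> sf s'; rewrite -partials_cat. Qed.

(** Difference quotients based at moving points y k tending to x still converge, because the partial
    derivative g is continuous at x. *)
Lemma partial_step_cvg m (f g : 'rV[R]_m -> V) i (c : R) (h : nat -> R)
    (y : nat -> 'rV[R]_m) x :
  (forall x, sderiv f x (e_ i) (g x)) -> scont g ->
  (forall k, h k != 0) -> h k @[k --> \oo] --> (0 : R) -> y k @[k --> \oo] --> x ->
  (h k)^-1 *: (f (h k *: (c *: e_ i) + y k) - f (y k)) @[k --> \oo] --> c *: g x.
Proof.
move=> fg sg h0 hc yc; apply/cvgrPdist_le => e e0.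
pose e1 := e / (`|c| + 1); have c1 : 0 < `|c| + 1 by rewrite ltr_wpDl.
have e10 : 0 < e1 by rewrite divr_gt0.
have /scontP/(_ x)/cvgrPdist_le/(_ _ e10)/nbhs_ballP[d /= d0 dP] := sg.
have d20 : 0 < d / 2 by rewrite divr_gt0.
have hc0 : h k *: (c *: e_ i : 'rV[R]_m) @[k --> \oo] --> (0 : 'rV[R]_m).
  by rewrite -(scale0r (c *: e_ i)); exact: cvgZr_tmp.
near=> k.
have hk : `|h k *: (c *: e_ i : 'rV[R]_m)| < d / 2.
  by near: k; move/cvgrPdist_lt/(_ _ d20): hc0; apply: filterS => k; rewrite sub0r normrN.
have yk : `|x - y k| < d / 2 by near: k; move/cvgrPdist_lt: yc; apply.
set w := h k *: (c *: e_ i : 'rV[R]_m).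
(* Subtracting the expected linear increment leaves a function whose derivative is at most |h k * c|
   e1 on the segment, which the mean value inequality integrates. *)
pose F t := f (t *: w + y k) - t *: ((h k * c) *: g x).
have Fd t : sderiv F t 1 ((h k * c) *: g (t *: w + y k) - (h k * c) *: g x).
  apply: sderivD.
    by apply: sderiv_line; rewrite /w scalerA; exact: sderiv_scale_dir.
  move=> u u0 uc; have : (- ((h k * c) *: g x)) @[_ --> \oo] --> - ((h k * c) *: g x).
    exact: cvg_cst.
  apply: cvgn_ext => j /=; rewrite [X in (X + t)](_ : _ = u j) ?[LHS]mulr1//.
  by rewrite scalerDl opprD opprK subrK scalerN; congr (- _); rewrite [LHS]scalerA mulVf// scale1r.
have := @mean_value_le _ _ F _ 0 1 (`|h k * c| * e1) ler01 (fun t _ => Fd t).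
rewrite /F scale1r !scale0r scale1r subr0 add0r subr0 mulr1 => H.
have {}H : `|f (w + y k) - (h k * c) *: g x - f (y k)| <= `|h k * c| * e1.
  apply: H => t /andP[t0 t1]; rewrite -scalerBr normrZ ler_wpM2l// distrC.
  apply: dP; rewrite -ball_normE/= opprD addrCA addrC.
  rewrite [d]splitr; apply: le_lt_trans (ler_normB _ _) _; apply: ltrD => //.
  by rewrite normrZ ger0_norm//; apply: le_lt_trans hk; rewrite ler_piMl.
rewrite distrC.
have -> : (h k)^-1 *: (f (w + y k) - f (y k)) - c *: g x =
    (h k)^-1 *: (f (w + y k) - (h k * c) *: g x - f (y k)).
  by rewrite addrAC [RHS]scalerBr scalerA mulKf.
rewrite normrZ normfV ler_pdivrMl ?normr_gt0//; apply: le_trans H _.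
rewrite normrM -mulrA ler_wpM2l// /e1 mulrA ler_pdivrMr// mulrC.
by rewrite ler_wpM2l ?(ltW e0)// lerDl.
Unshelve. all: by end_near. Qed.

Lemma cvg_coord_step m i (c : R) (h : nat -> R) (y : nat -> 'rV[R]_m)
    (x : 'rV[R]_m) :
  h k @[k --> \oo] --> (0 : R) -> y k @[k --> \oo] --> x ->
  h k *: (c *: e_ i) + y k @[k --> \oo] --> x.
Proof.
move=> hc yc; rewrite -[x]add0r -(scale0r (c *: (e_ i : 'rV[R]_m))).
by apply: cvgD => //; exact: cvgZr_tmp.
Qed.

(** Continuous partial derivatives give all directional ones: the displacement along v is made one
    coordinate at a time. *)
Lemma sderiv_dir m (f : 'rV[R]_m -> V) (g : 'I_m -> 'rV[R]_m -> V) (x v : 'rV[R]_m) :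
  (forall i x, sderiv f x (e_ i) (g i x)) -> (forall i, scont (g i)) ->
  sderiv f x v (\sum_i v 0 i *: g i x).
Proof.
move=> fg sg h h0 hc.
(* After a first coordinate step the base point depends on k, so the induction runs over arbitrary
   base points converging to x. *)
suff H (r : seq 'I_m) (y : nat -> 'rV[R]_m) : y k @[k --> \oo] --> x ->
    (h k)^-1 *: (f (h k *: (\sum_(i <- r) v 0 i *: e_ i) + y k) - f (y k))
    @[k --> \oo] --> \sum_(i <- r) v 0 i *: g i x.
  apply: (cvgn_ext _ (H (index_enum _) (fun=> x) (cvg_cst _))) => k.
  by rewrite {1}[v]row_sum_delta.
elim: r y => [|i r IH] y yc.
  rewrite !big_nil; under eq_fun do rewrite scaler0 add0r subrr scaler0.
  exact: cvg_cst.
rewrite !big_cons.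
have yc' := cvg_coord_step i (v 0 i) hc yc.
have c1 := IH _ yc'.
have c2 := partial_step_cvg (c := v 0 i) (fg i) (sg i) h0 hc yc.
apply: (cvgn_ext _ (cvgD c2 c1)) => k /=.
rewrite -scalerDr; congr (_ *: _); rewrite [RHS]addrC addrA subrK; congr (f _ - _).
by rewrite scalerDr addrAC addrC addrA.
Qed.

(** By the chain rule, the finite linear combinations of partial derivatives of f evaluated at x *m
    B are closed under differentiation; [smooth_coind] is applied to this class. *)
Lemma smooth_comp_mulmx n m (f : 'rV[R]_m -> V) (B : 'M[R]_(n, m)) : smooth f ->
  smooth (fun x : 'rV[R]_n => f (x *m B)).
Proof.
move=> sf; pose Q (F : 'rV[R]_n -> V) :=
  exists (r : seq (R * seq 'I_m)), F = fun x => \sum_(p <- r) p.1 *: partials p.2 f (x *m B).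
suff : smooth (fun x : 'rV[R]_n => f (x *m B)) /\
    forall s, Q (partials s (fun x : 'rV[R]_n => f (x *m B))) by case.
apply: (@smooth_coind n Q); last first.
  exists [:: (1, [::])]; apply/funext => x.
  by rewrite big_cons big_nil addr0 scale1r.
move=> _ [r ->]; split=> [u p up|i].
  apply: cvg_bigsum => q; apply: cvgZl_tmp.
  exact: (smooth_scont sf (scont_mulmx up)).
exists (fun x => \sum_(p <- r) \sum_j (p.1 * B i j) *: partials (j :: p.2) f (x *m B)).
  exists (flatten [seq [seq (p.1 * B i j, j :: p.2) | j <- index_enum 'I_m] | p <- r]).
  apply/funext => x; rewrite big_flatten big_map; apply: eq_bigr => p _.
  by rewrite big_map.
move=> x; elim: r => [|p r IH].
  rewrite big_nil (_ : (fun _ => _) = fun=> 0); first exact: sderiv_cst.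
  by apply/funext => y; rewrite big_nil.
rewrite big_cons (_ : (fun _ => _) = fun y => p.1 *: partials p.2 f (y *m B) +
  \sum_(p <- r) p.1 *: partials p.2 f (y *m B)); last first.
  by apply/funext => y; rewrite big_cons.
apply: sderivD => //.
have H : sderiv (partials p.2 f) (x *m B) ((e_ i : 'rV_n) *m B)
    (\sum_j ((e_ i : 'rV_n) *m B) 0 j *: partials (j :: p.2) f (x *m B)).
  by apply: (sderiv_dir (g := fun j => partials (j :: p.2) f)) => [j y|j];
    [exact: smooth_sderiv|exact: smooth_scont].
have -> : \sum_j (p.1 * B i j) *: partials (j :: p.2) f (x *m B) =
    p.1 *: \sum_j ((e_ i : 'rV_n) *m B) 0 j *: partials (j :: p.2) f (x *m B).
  by rewrite scaler_sumr; apply: eq_bigr => j _; rewrite scalerA -rowE mxE.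
move=> u u0 uc; apply: (cvgn_ext _ (cvgZl_tmp (k := p.1) (H u u0 uc))) => k.
by rewrite mulmxDl -scalemxAl -scalerBr !scalerA mulrC.
Qed.

End smoothness.

(** * Complex scalars and the exponential exp(i t) *)

Local Open Scope complex_scope.

Lemma bounded_scont {R : realType} (U V : normedModType R) (L : U -> V) (M : R) :
  (forall u v, L (u - v) = L u - L v) -> (forall u, `|L u| <= M * `|u|) -> scont L.
Proof.
move=> LB LM; apply/scontP => p; apply/cvgrPdist_le => e e0.
have M1 : 0 < `|M| + 1 by rewrite ltr_wpDl.
near=> x; rewrite -LB; apply: le_trans (LM _) _.
apply: (@le_trans _ _ ((`|M| + 1) * `|p - x|)).
  by rewrite ler_wpM2r// (le_trans (ler_norm _))// lerDl.
rewrite -ler_pdivlMl// mulrC.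
by near: x; apply: cvgr_dist_le; [exact: cvg_id|rewrite divr_gt0].
Unshelve. all: by end_near. Qed.

Section complex_exponential.
Context {R : realType}.
Implicit Types s t : R.

Lemma cexp0 : cexp (0 : R) = 1.
Proof. by rewrite /cexp cos0 sin0. Qed.

Lemma cexpD s t : cexp (s + t) = cexp s * cexp t.
Proof.
by rewrite /cexp cosD sinD; apply/eqP; rewrite eq_complex/= eqxx/= addrC.
Qed.

Lemma conjc_cexp t : conjc (cexp t) = cexp (- t).
Proof. by rewrite /cexp cosN sinN. Qed.

Lemma normc_cexp t : Normc.normc (cexp t) = 1.
Proof. by rewrite /= cos2Dsin2 sqrtr1. Qed.

Context {V : complexBanachType R}.
Implicit Types (v w : V).

Lemma cscale1 v : 1 *c: v = v.
Proof. by rewrite (_ : 1 = 1%:C) // cscale_real scale1r. Qed.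

Lemma cscaler0 (z : R[i]) : z *c: (0 : V) = 0.
Proof.
have : z *c: (0 : V) + z *c: 0 = z *c: 0 by rewrite -cscaleDr addr0.
by move/(congr1 (fun x => x - z *c: 0)); rewrite addrK subrr.
Qed.

Lemma cscalerN (z : R[i]) v : z *c: (- v) = - (z *c: v).
Proof. by apply/eqP; rewrite -addr_eq0 -cscaleDr addNr cscaler0. Qed.

Lemma cscalerB (z : R[i]) v w : z *c: (v - w) = z *c: v - z *c: w.
Proof. by rewrite cscaleDr cscalerN. Qed.

Lemma cscalerZ (z : R[i]) (r : R) v : z *c: (r *: v) = r *: (z *c: v).
Proof. by rewrite -!cscale_real !cscaleA mulrC. Qed.

(** Writing the phase with real scalars makes the real product rule and real limits available. *)
Lemma cexp_scaleE t v : cexp t *c: v = cos t *: v + sin t *: ((0 +i* 1) *c: v).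
Proof.
rewrite -!cscale_real cscaleA -cscaleDl; congr (_ *c: _).
by apply/eqP; rewrite eq_complex/=; apply/andP; split; apply/eqP; ring.
Qed.

Lemma norm_cexp_scale t v : `|cexp t *c: v| = `|v|.
Proof. by rewrite norm_cscale normc_cexp mul1r. Qed.

Lemma scont_cscale (z : R[i]) : scont (fun v : V => z *c: v).
Proof.
apply: (@bounded_scont _ _ _ _ (Normc.normc z)) => [u v|u]; first exact: cscalerB.
by rewrite norm_cscale.
Qed.

Lemma jcont_cexp : jcont (fun (t : R) (v : V) => cexp t *c: v).
Proof.
move=> t v t0 v0 ht hv; rewrite cexp_scaleE; under eq_fun do rewrite cexp_scaleE.
apply: cvgD; apply: cvgZ => //; last exact: scont_cscale.
  by apply: continuous_cvg ht; exact: continuous_cos.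
by apply: continuous_cvg ht; exact: continuous_sin.
Qed.

Lemma sderiv_line_comp (U : normedModType R) (phi : U -> R) (F : R -> R) (F' : R)
    (x v : U) (a : R) : (forall h : R, phi (h *: v + x) = phi x + h * a) ->
  is_derive (phi x) (1 : R) F F' -> sderiv (fun x => F (phi x)) x v (F' * a).
Proof.
move=> phiE dF; have dF' : sderiv F (phi x) 1 F'.
  by apply/sderivP; case: dF.
move=> u u0 uc; have := sderiv_scale_dir (c := a) dF' u0 uc.
rewrite [a *: F']mulrC; apply: cvgn_ext => k; rewrite phiE [phi x + _]addrC.
by rewrite [a *: (1 : R)]mulr1.
Qed.

Lemma cscale_ii v : (0 +i* 1) *c: ((0 +i* 1) *c: v) = - v.
Proof.
rewrite cscaleA (_ : _ * _ = (- 1)%:C) ?cscale_real ?scaleN1r//.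
by apply/eqP; rewrite eq_complex/=; apply/andP; split; apply/eqP; ring.
Qed.

(** The hypothesis on phi says that the phase is affine with slope a along the line through x in
    direction v, so differentiating the exponential produces the factor i a. *)
Lemma sderiv_cexp (U : normedModType R) (phi : U -> R) (f : U -> V) (x v : U) (a : R) d :
  (forall h : R, phi (h *: v + x) = phi x + h * a) -> sderiv f x v d ->
  sderiv (fun x => cexp (phi x) *c: f x) x v
    (cexp (phi x) *c: (a *: ((0 +i* 1) *c: f x) + d)).
Proof.
move=> phiE fd.
rewrite (_ : (fun x => _) = fun x =>
  cos (phi x) *: f x + sin (phi x) *: ((0 +i* 1) *c: f x)); last first.
  by apply/funext => y; rewrite cexp_scaleE.
have Ld : sderiv (fun x => (0 +i* 1) *c: f x) x v ((0 +i* 1) *c: d).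
  apply: sderiv_linear fd => [a' b|r b|]; first exact: cscaleDr.
    exact: cscalerZ.
  exact: scont_cscale.
have dc := sderiv_line_comp phiE (is_derive_cos (phi x)).
have ds := sderiv_line_comp phiE (is_derive_sin (phi x)).
have H := sderivD (sderivZ dc fd) (sderivZ ds Ld).
suff <- : - sin (phi x) * a *: f x + cos (phi x) *: d +
    (cos (phi x) * a *: ((0 +i* 1) *c: f x) + sin (phi x) *: ((0 +i* 1) *c: d)) =
    cexp (phi x) *c: (a *: ((0 +i* 1) *c: f x) + d) by exact: H.
rewrite (cexp_scaleE (phi x) (_ + _)) cscaleDr cscalerZ cscale_ii !scalerDr !scalerA.
rewrite scalerN -scaleNr -mulNr.
rewrite addrCA -[RHS]addrA; congr (_ + _).
by rewrite [RHS]addrA [X in _ = X + _]addrC.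
Qed.

End complex_exponential.

(** * Estimates in C*-algebras and Hilbert modules *)

Section cstar_algebra.
Context {R : realType} {A : cstarAlgType R}.
Implicit Types a b c : A.

Lemma amul_realZl (r : R) a b : (r *: a) *a b = r *: (a *a b).
Proof. by rewrite -!cscale_real cscaleAl. Qed.

Lemma amul_realZr (r : R) a b : a *a (r *: b) = r *: (a *a b).
Proof. by rewrite -!cscale_real cscaleAr. Qed.

Lemma amulBl a b c : (a - b) *a c = a *a c - b *a c.
Proof. by rewrite amulDl -scaleN1r amul_realZl scaleN1r. Qed.

Lemma amulBr a b c : a *a (b - c) = a *a b - a *a c.
Proof. by rewrite amulDr -scaleN1r amul_realZr scaleN1r. Qed.

Lemma jcont_amul : jcont (fun a b : A => a *a b).
Proof.
move=> u w u0 w0 hu hw.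
have -> : (fun k => u k *a w k) = (fun k => u0 *a w k + (u k - u0) *a w k).
  by apply/funext => k; rewrite amulBl addrC subrK.
rewrite -[u0 *a w0]addr0; apply: cvgD.
  have : scont (fun b => u0 *a b).
    apply: (@bounded_scont _ _ _ _ `|u0|) => [b c|b]; first exact: amulBr.
    exact: norm_amul.
  exact.
apply/norm_cvg0P.
have h0 : `|u k - u0| * `|w k| @[k --> \oo] --> (0 : R) * `|w0|.
  apply: cvgM; last exact: cvg_norm.
  by rewrite -(normr0 A) -(subrr u0); apply: cvg_norm; apply: cvgB => //; exact: cvg_cst.
rewrite mul0r in h0.
apply: squeeze_cvgr (cvg_cst 0) h0; apply: nearW => k.
by rewrite normr_ge0 norm_amul.
Qed.

(** From |b|^2 = |b^* b| <= |b^*| |b|, applied to a and to its adjoint. *)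
Lemma norm_star a : `|star a| = `|a|.
Proof.
have le b : `|b| <= `|star b|.
  have [->|b0] := eqVneq b 0; first by rewrite normr0.
  have : `|b| ^+ 2 <= `|star b| * `|b| by rewrite -norm_starM; exact: norm_amul.
  by rewrite expr2 ler_pM2r// normr_gt0.
by apply/eqP; rewrite eq_le le andbT -{2}(starK a) le.
Qed.

Lemma star_realZ (r : R) a : star (r *: a) = r *: star a.
Proof.
rewrite -!cscale_real starZ; congr (_ *c: _).
by apply/eqP; rewrite eq_complex/= oppr0 !eqxx.
Qed.

Lemma starB a b : star (a - b) = star a - star b.
Proof. by rewrite starD -scaleN1r star_realZ scaleN1r. Qed.

Lemma scont_star : scont (@star R A).
Proof.
apply: (@bounded_scont _ _ _ _ 1) => [u v|u]; first exact: starB.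
by rewrite norm_star mul1r.
Qed.

End cstar_algebra.

Section hilbert_module.
Context {R : realType} {A : cstarAlgType R} {E : hilbertModType A}.
Implicit Types u v w : E.

Lemma innerDl u v w : inner (u + v) w = inner u w + inner v w.
Proof. by rewrite -star_inner innerDr starD !star_inner. Qed.

Lemma innerZl (z : R[i]) u v : inner (z *c: u) v = conjc z *c: inner u v.
Proof. by rewrite -star_inner innerZr starZ star_inner. Qed.

Lemma inner_realZl (r : R) u v : inner (r *: u) v = r *: inner u v.
Proof.
rewrite -!cscale_real innerZl; congr (_ *c: _).
by apply/eqP; rewrite eq_complex/= oppr0 !eqxx.
Qed.

Lemma inner_realZr (r : R) u v : inner u (r *: v) = r *: inner u v.
Proof. by rewrite -!cscale_real innerZr. Qed.

Lemma innerNl u v : inner (- u) v = - inner u v.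
Proof. by rewrite -scaleN1r inner_realZl scaleN1r. Qed.

Lemma innerNr u v : inner u (- v) = - inner u v.
Proof. by rewrite -scaleN1r inner_realZr scaleN1r. Qed.

Lemma inner0l v : inner (0 : E) v = 0.
Proof. by have := inner_realZl 0 0 v; rewrite !scale0r. Qed.

Lemma inner0r u : inner u (0 : E) = 0.
Proof. by have := inner_realZr 0 u 0; rewrite !scale0r. Qed.

Lemma inner_self_eq0 u : inner u u = 0 -> u = 0.
Proof.
by move=> u0; apply/normr0_eq0/eqP; rewrite -sqrf_eq0 norm_inner u0 normr0.
Qed.

(* Polarization gives the constant 4, but needs no positivity in A. *)
Lemma norm_inner_le u v : `|inner u v| <= 4 * (`|u| * `|v|).
Proof.
pose i := (0 +i* 1 : R[i]).
have nii w : `|i *c: w| = `|w| by rewrite norm_cscale/= expr0n/= expr1n add0r sqrtr1 mul1r.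
have sq w w' : `|w| <= 1 -> `|w'| <= 1 -> `|inner (w + w') (w + w')| <= 4.
  move=> h h'; rewrite -norm_inner.
  have : `|w + w'| <= 2 by apply: le_trans (ler_normD _ _) _; lra.
  move=> h2; rewrite (_ : 4 = 2 ^+ 2); last by rewrite -natrX.
  by rewrite lerXn2r// nnegrE.
have polar w w' : inner (w + w') (w + w') - inner (w - w') (w - w') =
    2 *: (inner w w' + inner w' w).
  rewrite !innerDr !innerDl !innerNr !innerNl !opprD !opprK.
  rewrite addrACA [X in X + _ = _]addrACA [X in _ + X = _]addrACA !subrr add0r addr0.
  by rewrite scaler_nat mulr2n [RHS]addrACA addrC.
have S w w' : `|w| <= 1 -> `|w'| <= 1 -> `|inner w w' + inner w' w| <= 4.
  move=> h h'; have := ler_normB (inner (w + w') (w + w')) (inner (w - w') (w - w')).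
  rewrite polar normrZ ger0_norm//.
  have := sq w w' h h'; have := sq w (- w') h; rewrite normrN => /(_ h').
  lra.
have H w w' : `|w| <= 1 -> `|w'| <= 1 -> `|inner w w'| <= 4.
  move=> h h'; have S1 := S w w' h h'; have := S w (i *c: w') h; rewrite nii => /(_ h') S2.
  have E2 : 2 *: inner w w' = (inner w w' + inner w' w) -
      i *c: (inner w (i *c: w') + inner (i *c: w') w).
    rewrite innerZr innerZl cscaleDr cscale_ii cscaleA (_ : i * conjc i = 1); last first.
      by apply/eqP; rewrite eq_complex/=; apply/andP; split; apply/eqP; ring.
    by rewrite cscale1 opprD opprK addrACA subrr addr0 scaler_nat mulr2n.
  have : `|2 *: inner w w'| <= 4 + 4.
    rewrite E2; apply: le_trans (ler_normB _ _) _; apply: lerD => //.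
    by rewrite norm_cscale/= expr0n/= expr1n add0r sqrtr1 mul1r.
  rewrite normrZ ger0_norm//; lra.
have [->|u0] := eqVneq u 0.
  by rewrite inner0l !normr0 mul0r mulr0.
have [->|v0] := eqVneq v 0.
  by rewrite inner0r !normr0 !mulr0.
have := H (`|u|^-1 *: u) (`|v|^-1 *: v).
rewrite !normrZ !normfV !normr_id !mulVf ?normr_eq0// => /(_ (lexx _) (lexx _)).
rewrite inner_realZl inner_realZr !normrZ !normfV !normr_id.
rewrite ler_pdivrMl ?normr_gt0// ler_pdivrMl ?normr_gt0//.
by rewrite mulrCA mulrA mulrC.
Qed.

Lemma ractBl u v (a : A) : ract (u - v) a = ract u a - ract v a.
Proof.
rewrite ractDl; congr (_ + _).
by rewrite -[- v]scaleN1r -cscale_real ractZl cscale_real scaleN1r.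
Qed.

(** The inner square of u a is a^* <u, u> a. *)
Lemma norm_ract u (a : A) : `|ract u a| <= `|u| * `|a|.
Proof.
rewrite -(@ler_pXn2r _ 2)// ?nnegrE ?mulr_ge0// norm_inner.
rewrite innerMr -star_inner innerMr starM star_inner.
apply: le_trans (norm_amul _ _) _.
apply: le_trans (ler_wpM2r (normr_ge0 _) (norm_amul _ _)) _.
by rewrite norm_star -norm_inner [leLHS]mulrC mulrA exprMn mulrC [`|a| ^+ 2]expr2.
Qed.

End hilbert_module.

(** * Rapid decay in the sup norm of R^n *)

Section rapid_decay.
Context {R : realType}.

Lemma coord_norm_le n (x : 'rV[R]_n) i : `|x 0 i| <= `|x|.
Proof.
rewrite (_ : `|x| = mx_norm x)// mx_normrE.
exact: (le_bigmax 0 (fun ij : 'I_1 * 'I_n => `|x ij.1 ij.2|) (0, i)).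
Qed.

Lemma norm_attained n (x : 'rV[R]_n) : x != 0 -> exists i, `|x| = `|x 0 i|.
Proof.
move=> x0; have : mx_norm x != 0 by apply: contraNneq x0 => /mx_norm_eq0 ->.
by move=> /mx_norm_neq0[[k i] xE]; exists i; rewrite (_ : `|x| = mx_norm x)// xE /= ord1.
Qed.

Lemma mulmx_norm_le m n (B : 'M[R]_(m, n)) :
  exists2 K, 0 <= K & forall x : 'rV[R]_m, `|x *m B| <= K * `|x|.
Proof.
exists (\sum_i `|row i B|); first exact: sumr_ge0.
move=> x; rewrite mulmx_sum_row; apply: le_trans (ler_norm_sum _ _ _) _.
rewrite mulr_suml; apply: ler_sum => i _.
by rewrite normrZ mulrC ler_wpM2l// coord_norm_le.
Qed.

Lemma nrm_ge1 n (x : 'rV[R]_n) : 1 <= 1 + `|x|.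
Proof. by rewrite lerDl. Qed.

Lemma nrmX_gt0 n (x : 'rV[R]_n) N : 0 < (1 + `|x|) ^+ N.
Proof. by rewrite exprn_gt0// ltr_wpDr. Qed.

(** A form of Peetre's inequality: a shift by y costs at most a factor 1 + |y| in polynomial
    weights. *)
Lemma peetre n (x y : 'rV[R]_n) : 1 + `|x + y| <= (1 + `|x|) * (1 + `|y|).
Proof.
have := ler_normD x y; have := mulr_ge0 (normr_ge0 x) (normr_ge0 y); nra.
Qed.

(** Each of the n factors 1 + x_i^2 is at most (1 + |x|)^2. Hence decay of order 2 n gives
    domination by [wt]. *)
Lemma wt_nrm_ge1 n (x : 'rV[R]_n) : 1 <= wt x * (1 + `|x|) ^+ (2 * n).
Proof.
have -> : wt x = (\prod_(i < n) (1 + x 0 i ^+ 2))^-1.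
  by apply/esym; apply: (big_morph (fun y : R => y^-1)) => [y z|]; rewrite ?invr1 ?invfM.
rewrite exprM mulrC.
have w0 : 0 < \prod_(i < n) (1 + x 0 i ^+ 2).
  by apply: prodr_gt0 => i _; rewrite ltr_wpDr ?sqr_ge0.
rewrite ler_pdivlMr// mul1r.
have -> : (1 + `|x|) ^+ 2 ^+ n = \prod_(i < n) (1 + `|x|) ^+ 2.
  by rewrite prodr_const card_ord.
apply: ler_prod => i _; rewrite ltW ?ltr_wpDr ?sqr_ge0//=.
rewrite sqrrD expr1n mul1r -real_normK ?num_real// lerD//.
  by rewrite lerDl mulrn_wge0.
by rewrite lerXn2r ?nnegrE// coord_norm_le.
Qed.

Context {V : normedModType R}.

Definition rapid n (f : 'rV[R]_n -> V) :=
  forall N, exists M, forall x, (1 + `|x|) ^+ N * `|f x| <= M.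

Lemma rapid_wt n (f : 'rV[R]_n -> V) : rapid f -> exists C, forall x, `|f x| <= C * wt x.
Proof.
move=> /(_ (2 * n)%N)[M fM]; exists M => x.
apply: (@le_trans _ _ ((1 + `|x|) ^+ (2 * n) * `|f x| * wt x)); last first.
  by rewrite ler_wpM2r// ltW// wt_gt0.
by rewrite mulrAC mulrC ler_peMr// mulrC wt_nrm_ge1.
Qed.

Lemma rapid_bounded n (f : 'rV[R]_n -> V) : rapid f -> exists C, forall x, `|f x| <= C.
Proof. by move=> /(_ 0%N)[M fM]; exists M => x; have := fM x; rewrite mul1r. Qed.

(** Conversely, where |x| <= 1 the weight is at most 2^N and the exponent 0 suffices; elsewhere 1 +
    |x| <= 2 |x_i| for a coordinate attaining the norm, and the monomials x_i^N suffice. *)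
Lemma rapidP n (f : 'rV[R]_n -> V) : rapid f <-> forall alpha : 'I_n -> nat,
  exists M : R, forall x : 'rV[R]_n, `|(\prod_i x 0 i ^+ alpha i) *: f x| <= M.
Proof.
split=> [rf alpha|H N].
  have [M fM] := rf (\sum_i alpha i)%N; exists M => x.
  rewrite normrZ; apply: le_trans (fM x); rewrite ler_wpM2r// normr_prod.
  rewrite expr_sum; apply: ler_prod => i _; rewrite normr_ge0 normrX/=.
  rewrite lerXn2r// ?nnegrE ?addr_ge0//.
  by rewrite (le_trans (coord_norm_le x i))// lerDr.
have [M0 fM0] := H (fun=> 0%N).
have {}fM0 x : `|f x| <= M0.
  by have := fM0 x; rewrite big1 ?scale1r.
have /choice[M fM] (i : 'I_n) : exists M : R, forall x : 'rV[R]_n, `|x 0 i| ^+ N * `|f x| <= M.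
  have [M fM] := H (fun j => if j == i then N else 0%N); exists M => x.
  have := fM x; rewrite (bigD1 i)//= eqxx big1 ?mulr1; first by rewrite normrZ normrX.
  by move=> j /negbTE ->.
have M0_ge0 : 0 <= M0 by exact: le_trans (fM0 0).
have M_ge0 i : 0 <= M i.
  by apply: le_trans (fM i 0); rewrite mulr_ge0// exprn_ge0.
exists (2 ^+ N * (M0 + \sum_i M i)) => x.
have [x1|x1] := leP `|x| 1.
  apply: (@le_trans _ _ (2 ^+ N * M0)).
    apply: ler_pM => //.
    by rewrite lerXn2r// ?nnegrE ?addr_ge0// (_ : 2 = 1 + 1)// lerD2l.
  by rewrite ler_wpM2l ?exprn_ge0// lerDl sumr_ge0.
have [i xi] : exists i, `|x| = `|x 0 i|.
  by apply: norm_attained; rewrite -normr_gt0 (lt_trans ltr01).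
apply: (@le_trans _ _ ((2 * `|x|) ^+ N * `|f x|)).
  rewrite ler_wpM2r// lerXn2r// ?nnegrE ?addr_ge0 ?mulr_ge0//; lra.
rewrite exprMn -mulrA ler_wpM2l ?exprn_ge0// {1}xi; apply: le_trans (fM i x) _.
rewrite (bigD1 i)//= addrCA lerDl addr_ge0// sumr_ge0// => j _; exact: M_ge0.
Qed.

Lemma rapidD n (f g : 'rV[R]_n -> V) : rapid f -> rapid g -> rapid (fun x => f x + g x).
Proof.
move=> rf rg N; have [M fM] := rf N; have [M' gM] := rg N.
exists (M + M') => x; apply: (@le_trans _ _ ((1 + `|x|) ^+ N * (`|f x| + `|g x|))).
  by rewrite ler_wpM2l ?(ltW (nrmX_gt0 _ _))// ler_normD.
by rewrite mulrDr lerD.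
Qed.

Lemma rapid_le n (f : 'rV[R]_n -> V) (W : normedModType R) (g : 'rV[R]_n -> W) (C : R) :
  (forall x, `|g x| <= C * `|f x|) -> rapid f -> forall N, exists M, forall x,
    (1 + `|x|) ^+ N * `|g x| <= M.
Proof.
move=> gf rf N; have [M fM] := rf N; exists (`|C| * M) => x.
apply: (@le_trans _ _ ((1 + `|x|) ^+ N * (`|C| * `|f x|))).
  rewrite ler_wpM2l ?(ltW (nrmX_gt0 _ _))//; apply: le_trans (gf x) _.
  by rewrite ler_wpM2r// ler_norm.
by rewrite mulrCA ler_wpM2l.
Qed.

End rapid_decay.

(** * Stability properties of the Schwartz space *)

Section schwartz_space.
Context {R : realType} {n : nat} {A : cstarAlgType R}.
Implicit Types f g : 'rV[R]_n -> A.
Local Notation e_ i := (delta_mx 0 i).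

Lemma schwartzP f : schwartz f <-> smooth f /\ forall s, rapid (partials s f).
Proof.
split=> [[sf H]|[sf H]]; split=> // s; first by apply/rapidP => alpha; exact: H.
by move=> s'; have /rapidP := H s'; apply.
Qed.

Lemma schwartz_scont f : schwartz f -> scont f.
Proof. by case=> /(_ [::])[/scontP]. Qed.

Lemma schwartz_rapid f : schwartz f -> rapid f.
Proof. by move=> /schwartzP[_ /(_ [::])]. Qed.

Lemma schwartz_partials f s : schwartz f -> schwartz (partials s f).
Proof.
move=> /schwartzP[sf H]; apply/schwartzP; split; first exact: smooth_partials.
by move=> s'; rewrite -partials_cat.
Qed.

Lemma schwartz_sderiv f i x : schwartz f -> sderiv f x (e_ i) (partials [:: i] f x).
Proof. by case=> sf _; exact: (@smooth_sderiv _ _ _ f [::] x i sf). Qed.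

(** The coinduction principle [smooth_coind] with rapid decay added to the invariant. *)
Lemma schwartz_coind (Q : ('rV[R]_n -> A) -> Prop) :
  (forall f, Q f -> [/\ scont f, rapid f &
     forall i, exists2 g, Q g & forall x, sderiv f x (e_ i) (g x)]) ->
  forall f, Q f -> schwartz f.
Proof.
move=> HQ f Qf; have [sf Qs] : smooth f /\ forall s, Q (partials s f).
  by apply: smooth_coind Qf => g /HQ[].
by apply/schwartzP; split=> // s; have [] := HQ _ (Qs s).
Qed.

Lemma schwartzD f g : schwartz f -> schwartz g -> schwartz (fun x => f x + g x).
Proof.
move=> sf sg.
apply: (@schwartz_coind (fun F => exists f g, [/\ schwartz f, schwartz g &
  F = fun x => f x + g x])); last by exists f, g.
move=> _ [{sf}f [{sg}g [sf sg ->]]]; split.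
- by move=> u p up; apply: cvgD; [exact: schwartz_scont sf _ _ up|exact: schwartz_scont sg _ _ up].
- by apply: rapidD; exact: schwartz_rapid.
- move=> i; exists (fun x => partials [:: i] f x + partials [:: i] g x).
    by exists (partials [:: i] f), (partials [:: i] g); split=> //; exact: schwartz_partials.
  by move=> x; apply: sderivD; exact: schwartz_sderiv.
Qed.

Lemma schwartz_linear (L : A -> A) (M : R) f : (forall a b, L (a + b) = L a + L b) ->
  (forall (r : R) a, L (r *: a) = r *: L a) -> (forall a, `|L a| <= M * `|a|) ->
  schwartz f -> schwartz (fun x => L (f x)).
Proof.
move=> LD LZ LM sf.
have sL : scont L.
  by apply: bounded_scont LM => u v; rewrite LD -scaleN1r LZ scaleN1r.
apply: (@schwartz_coind (fun F => exists2 f, schwartz f & F = fun x => L (f x))); last by exists f.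
move=> _ [{sf}f sf ->]; split.
- by move=> u p up; apply: sL; exact: schwartz_scont sf _ _ up.
- by apply: (rapid_le (f := f) (C := M)) => //; exact: schwartz_rapid.
- move=> i; exists (fun x => L (partials [:: i] f x)).
    by exists (partials [:: i] f) => //; exact: schwartz_partials.
  by move=> x; apply: sderiv_linear => //; exact: schwartz_sderiv.
Qed.

Lemma schwartz_cscale (z : R[i]) f : schwartz f -> schwartz (fun x => z *c: f x).
Proof.
apply: (@schwartz_linear (fun a => z *c: a) (Normc.normc z)) => [a b|r a|a].
- exact: cscaleDr.
- exact: cscalerZ.
- by rewrite norm_cscale.
Qed.

Lemma schwartz_scale (r : R) f : schwartz f -> schwartz (fun x => r *: f x).
Proof.
move=> /(schwartz_cscale r%:C); congr schwartz; apply/funext => x.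
exact: cscale_real.
Qed.

Lemma schwartz_amulr (a : A) f : schwartz f -> schwartz (fun x => f x *a a).
Proof.
apply: (@schwartz_linear (fun b => b *a a) `|a|) => [b c|r b|b].
- exact: amulDl.
- exact: amul_realZl.
- by rewrite mulrC norm_amul.
Qed.

Lemma schwartzB f g : schwartz f -> schwartz g -> schwartz (fun x => f x - g x).
Proof.
move=> sf /(schwartz_scale (-1))/(schwartzD sf); congr schwartz.
by apply/funext => x; rewrite scaleN1r.
Qed.

Lemma dotC (x y : 'rV[R]_n) : dot x y = dot y x.
Proof. by apply: eq_bigr => i _; rewrite mulrC. Qed.

Lemma dotDl (x y z : 'rV[R]_n) : dot (x + y) z = dot x z + dot y z.
Proof. by rewrite /dot -big_split/=; apply: eq_bigr => i _; rewrite mxE mulrDl. Qed.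

Lemma dotDr (x y z : 'rV[R]_n) : dot x (y + z) = dot x y + dot x z.
Proof. by rewrite dotC dotDl !(dotC x). Qed.

Lemma dotZl (r : R) (x y : 'rV[R]_n) : dot (r *: x) y = r * dot x y.
Proof. by rewrite /dot mulr_sumr; apply: eq_bigr => i _; rewrite mxE mulrA. Qed.

Lemma dotZr (r : R) (x y : 'rV[R]_n) : dot x (r *: y) = r * dot x y.
Proof. by rewrite dotC dotZl dotC. Qed.

Lemma dotNl (x y : 'rV[R]_n) : dot (- x) y = - dot x y.
Proof. by rewrite -scaleN1r dotZl mulN1r. Qed.

Lemma dot0l (x : 'rV[R]_n) : dot 0 x = 0.
Proof. by rewrite -(scale0r 0) dotZl mul0r. Qed.

Lemma dot_delta (x : 'rV[R]_n) i : dot x (e_ i) = x 0 i.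
Proof.
rewrite /dot (bigD1 i)//= mxE !eqxx mulr1 big1 ?addr0// => j ji.
by rewrite mxE eqxx (negbTE ji) mulr0.
Qed.

Lemma dot_mulmx (x y : 'rV[R]_n) (B : 'M[R]_n) : dot x (y *m B^T) = dot (x *m B) y.
Proof.
have dotE (u v : 'rV[R]_n) : dot u v = (u *m v^T) 0 0.
  by rewrite mxE; apply: eq_bigr => i _; rewrite mxE.
by rewrite !dotE trmx_mul trmxK mulmxA.
Qed.

Lemma jcont_dot : jcont (fun x y : 'rV[R]_n => dot x y).
Proof.
move=> u w u0 w0 hu hw; apply: cvg_bigsum => i; apply: cvgM.
  exact: (cvg_comp _ _ hu (@coord_continuous R 1 n 0 i u0)).
exact: (cvg_comp _ _ hw (@coord_continuous R 1 n 0 i w0)).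
Qed.

(** For fixed z and zeta the images of Schwartz functions are closed under differentiation: the
    derivative along i of the image of f is the image of i zeta_i f plus the derivative of f. Decay
    follows from [peetre]. *)
Lemma schwartz_heisenberg z zeta f : schwartz f -> schwartz (heisenberg z zeta f).
Proof.
move=> sf.
apply: (@schwartz_coind (fun F => exists2 f, schwartz f & F = heisenberg z zeta f));
  last by exists f.
move=> _ [{sf}f sf ->]; split.
- move=> u p up; rewrite /heisenberg; apply: jcont_cexp.
    by apply: jcont_dot => //; exact: cvg_cst.
  apply: (schwartz_scont sf (u := fun k => u k - z)).
  by apply: cvgB => //; exact: cvg_cst.
- move=> N; have [M fM] := schwartz_rapid sf N.
  exists ((1 + `|z|) ^+ N * M) => x; rewrite /heisenberg norm_cexp_scale.
  have h : (1 + `|x|) ^+ N <= (1 + `|z|) ^+ N * (1 + `|x - z|) ^+ N.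
    rewrite -exprMn lerXn2r// ?nnegrE ?mulr_ge0 ?addr_ge0//.
    by have := peetre z (x - z); rewrite [z + _]addrC subrK.
  apply: le_trans (ler_wpM2r (normr_ge0 _) h) _.
  by rewrite -mulrA ler_wpM2l// exprn_ge0// addr_ge0.
- move=> i; exists (heisenberg z zeta
     (fun x => zeta 0 i *: ((0 +i* 1) *c: f x) + partials [:: i] f x)).
    eexists; last reflexivity.
    by apply: schwartzD; [apply: schwartz_scale; exact: schwartz_cscale|exact: schwartz_partials].
  move=> x; apply: (@sderiv_cexp _ _ _ (fun x => dot zeta x) (fun x => f (x - z))).
    by move=> h; rewrite dotDr dotZr dot_delta addrC.
  move=> u u0 uc; have := @schwartz_sderiv f i (x - z) sf u u0 uc.
  by apply: cvgn_ext => k; rewrite addrA.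
Qed.

End schwartz_space.

(** * Polynomials and Gaussians *)

Section gaussian.
Context {R : realType}.
Local Notation e_ i := (delta_mx 0 i).

Lemma sderiv_comp (U : normedModType R) (phi : U -> R) (F : R -> R) (F' : R)
    (x v : U) (a : R) : sderiv phi x v a ->
  is_derive (phi x) (1 : R) F F' -> sderiv (fun x => F (phi x)) x v (F' * a).
Proof.
move=> dphi dF; apply: sderiv_of_line; apply/sderivP.
have [d1 d2] : is_derive (0 : R) (1 : R) (fun t : R => phi (t *: v + x)) a.
  have /sderivP[? <-] : sderiv (fun t : R => phi (t *: v + x)) 0 1 a.
    by apply: sderiv_line; rewrite scale0r add0r.
  exact: derivableP.
have dF0 : is_derive ((fun t : R => phi (t *: v + x)) 0) (1 : R) F F'.
  by rewrite scale0r add0r.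
have [? ?] : is_derive (0 : R) (1 : R) (F \o (fun t : R => phi (t *: v + x))) (F' * a).
  have H := @is_derive1_comp R F (fun t : R => phi (t *: v + x)) 0 _ _ dF0 (DeriveDef d1 d2).
  exact: H.
by [].
Qed.

(** Polynomial functions: differentiating a Gaussian brings down polynomial factors, so the
    coinductive arguments need a class of coefficients closed under sums, products and
    derivatives. *)
Inductive polyfun n : ('rV[R]_n -> R) -> Prop :=
| polyfun_cst c : polyfun (fun=> c)
| polyfun_coord i : polyfun (fun x => x 0 i)
| polyfunD p q : polyfun p -> polyfun q -> polyfun (fun x => p x + q x)
| polyfunM p q : polyfun p -> polyfun q -> polyfun (fun x => p x * q x).

Lemma polyfun_scont n (p : 'rV[R]_n -> R) : polyfun p -> scont p.
Proof.
elim=> [c|i|{}p q _ sp _ sq|{}p q _ sp _ sq] u u0 hu; first exact: cvg_cst.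
- exact: (cvg_comp _ _ hu (@coord_continuous R 1 n 0 i u0)).
- by apply: cvgD; [exact: sp|exact: sq].
- by apply: cvgM; [exact: sp|exact: sq].
Qed.

Lemma polyfun_growth n (p : 'rV[R]_n -> R) : polyfun p ->
  exists C N, forall x, `|p x| <= C * (1 + `|x|) ^+ N.
Proof.
have ge1 N (x : 'rV[R]_n) : 1 <= (1 + `|x|) ^+ N by rewrite exprn_ege1// lerDl.
elim=> [c|i|{}p q _ [C [N pC]] _ [C' [N' qC]]|{}p q _ [C [N pC]] _ [C' [N' qC]]].
- by exists `|c|, 0%N => x; rewrite mulr1.
- exists 1, 1%N => x; rewrite mul1r expr1 (le_trans (coord_norm_le x i))//.
  by rewrite lerDr.
- have C0 : 0 <= C by have := le_trans (normr_ge0 _) (pC 0); rewrite normr0 addr0 expr1n mulr1.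
  have C'0 : 0 <= C' by have := le_trans (normr_ge0 _) (qC 0); rewrite normr0 addr0 expr1n mulr1.
  exists (C + C'), (N + N')%N => x; apply: le_trans (ler_normD _ _) _.
  rewrite mulrDl lerD//; [apply: le_trans (pC x) _|apply: le_trans (qC x) _].
    by rewrite ler_wpM2l// exprD ler_peMr// ltW// nrmX_gt0.
  by rewrite ler_wpM2l// exprD ler_peMl// ltW// nrmX_gt0.
- exists (C * C'), (N + N')%N => x; rewrite normrM exprD mulrACA.
  by apply: ler_pM.
Qed.

Lemma polyfun_sderiv n (p : 'rV[R]_n -> R) : polyfun p -> forall i,
  exists2 q, polyfun q & forall x, sderiv p x (e_ i) (q x).
Proof.
elim=> [c|j|{}p q _ IHp _ IHq|{}p q pp IHp pq IHq] i.
- by exists (fun=> 0); [exact: polyfun_cst|move=> x; exact: sderiv_cst].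
- exists (fun=> (e_ i : 'rV[R]_n) 0 j); first exact: polyfun_cst.
  move=> x u u0 uc.
  have : (e_ i : 'rV[R]_n) 0 j @[_ --> \oo] --> (e_ i : 'rV[R]_n) 0 j by exact: cvg_cst.
  by apply: cvgn_ext => k; rewrite !mxE addrK [LHS]mulrA mulVf// mul1r.
- have [p' pp' dp] := IHp i; have [q' pq' dq] := IHq i.
  exists (fun x => p' x + q' x); first exact: polyfunD.
  by move=> x; exact: sderivD.
- have [p' pp' dp] := IHp i; have [q' pq' dq] := IHq i.
  exists (fun x => p' x * q x + p x * q' x); first by apply: polyfunD; exact: polyfunM.
  by move=> x; exact: (sderivZ (dp x) (dq x)).
Qed.

Lemma polyfun_sum n I (r : seq I) (p : I -> 'rV[R]_n -> R) : (forall i, polyfun (p i)) ->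
  polyfun (fun x => \sum_(i <- r) p i x).
Proof.
move=> pp; elim: r => [|i r IH].
  rewrite (_ : (fun _ => _) = fun=> 0); first exact: polyfun_cst.
  by apply/funext => x; rewrite big_nil.
rewrite (_ : (fun _ => _) = fun x => p i x + \sum_(i <- r) p i x); first exact: polyfunD.
by apply/funext => x; rewrite big_cons.
Qed.

Definition gauss n (x : 'rV[R]_n) : R := expR (- dot x x / 2).

Lemma gauss_gt0 n (x : 'rV[R]_n) : 0 < gauss x.
Proof. exact: expR_gt0. Qed.

Lemma dot_ge0 n (x : 'rV[R]_n) : 0 <= dot x x.
Proof. by apply: sumr_ge0 => i _; rewrite -expr2 sqr_ge0. Qed.

Lemma gauss_le1 n (x : 'rV[R]_n) : gauss x <= 1.
Proof. by rewrite -expR0 ler_expR mulNr oppr_le0 divr_ge0// dot_ge0. Qed.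

Lemma gauss0 n : gauss (0 : 'rV[R]_n) = 1.
Proof. by rewrite /gauss dot0l oppr0 mul0r expR0. Qed.

Lemma gaussN n (x : 'rV[R]_n) : gauss (- x) = gauss x.
Proof. by rewrite /gauss dotNl dotC dotNl opprK. Qed.

Lemma scont_gauss n : scont (@gauss n).
Proof.
move=> u p up; have h : - dot (u k) (u k) / 2 @[k --> \oo] --> - dot p p / 2.
  by apply: cvgMr_tmp; apply: cvgN; exact: jcont_dot.
exact: (cvg_comp _ _ h (@continuous_expR R _)).
Qed.

Lemma norm_sqr_le_dot n (x : 'rV[R]_n) : `|x| ^+ 2 <= dot x x.
Proof.
have [->|/norm_attained[i ->]] := eqVneq x 0; first by rewrite normr0 expr0n dot_ge0.
rewrite real_normK ?num_real// /dot (bigD1 i)//= expr2 lerDl.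
by apply: sumr_ge0 => j _; rewrite -expr2 sqr_ge0.
Qed.

(** The constant c satisfies c (N + 1) = eps^2 / 2, so exp(eps^2 x.x / 2) >= (1 + c |x|^2)^(N + 1),
    while 1 + |x| <= (2 + 1/c) (1 + c |x|^2). *)
Lemma nrmX_gauss_bounded n (eps : R) N : 0 < eps ->
  exists M, forall x : 'rV[R]_n, (1 + `|x|) ^+ N * gauss (eps *: x) <= M.
Proof.
move=> e0; pose c := eps ^+ 2 / 2 / N.+1%:R.
have c0 : 0 < c by rewrite !divr_gt0// exprn_gt0.
exists ((2 + c^-1) ^+ N.+1) => x.
have h1 : 1 + `|x| <= (2 + c^-1) * (1 + c * `|x| ^+ 2).
  rewrite mulrDr mulr1 mulrDl [c^-1 * _]mulrA mulVf ?gt_eqF// mul1r.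
  have : 0 < c^-1 by rewrite invr_gt0.
  have : 0 <= c * `|x| ^+ 2 by rewrite mulr_ge0 ?sqr_ge0 ?ltW.
  have := sqr_ge0 (`|x| - 1); nra.
have h2 : (1 + c * `|x| ^+ 2) ^+ N.+1 <= expR (eps ^+ 2 * dot x x / 2).
  have -> : eps ^+ 2 * dot x x / 2 = N.+1%:R * (c * dot x x).
    by rewrite mulrA [N.+1%:R * c]mulrC /c divfK ?pnatr_eq0// mulrAC.
  rewrite expRM_natl lerXn2r// ?nnegrE ?expR_ge0//.
    by rewrite addr_ge0// mulr_ge0 ?sqr_ge0 ?ltW.
  apply: le_trans (expR_ge1Dx _); rewrite lerD2l ler_wpM2l ?(ltW c0)//.
  exact: norm_sqr_le_dot.
have -> : gauss (eps *: x) = (expR (eps ^+ 2 * dot x x / 2))^-1.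
  by rewrite /gauss dotZl dotZr -expRN; congr expR; rewrite expr2; ring.
rewrite ler_pdivrMr ?expR_gt0//.
apply: (@le_trans _ _ ((1 + `|x|) ^+ N.+1)).
  by rewrite exprS ler_peMl ?nrm_ge1// ltW// nrmX_gt0.
apply: le_trans (_ : ((2 + c^-1) * (1 + c * `|x| ^+ 2)) ^+ N.+1 <= _).
  rewrite lerXn2r// ?nnegrE ?addr_ge0//.
  exact: le_trans h1.
by rewrite exprMn ler_wpM2l// exprn_ge0// addr_ge0// invr_ge0 ltW.
Qed.

(** The class closed under differentiation consists of the products of a polynomial with the
    Gaussian exp(q) and the coefficient a. *)
Lemma schwartz_gauss n (A : cstarAlgType R) (eps : R) (a : A) : 0 < eps ->
  schwartz (fun x : 'rV[R]_n => gauss (eps *: x) *: a).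
Proof.
move=> e0; pose q (x : 'rV[R]_n) := \sum_i (- eps ^+ 2 / 2) * (x 0 i * x 0 i).
have pq : polyfun q.
  apply: polyfun_sum => i; apply: polyfunM; first exact: polyfun_cst.
  by apply: polyfunM; exact: polyfun_coord.
have gE x : gauss (eps *: x) = expR (q x).
  rewrite /gauss dotZl dotZr /q -mulr_sumr; congr expR.
  by rewrite -/(dot x x); ring.
have sg : scont (fun x => expR (q x)).
  by move=> u p up; exact: (cvg_comp _ _ (polyfun_scont pq up) (@continuous_expR R _)).
apply: (@schwartz_coind _ _ _ (fun F => exists2 p, polyfun p & F = fun x => (p x * expR (q x)) *: a));
  last first.
  exists (fun=> 1); first exact: polyfun_cst.
  by apply/funext => x; rewrite mul1r gE.
move=> _ [p pp ->]; split.
- move=> u u0 hu; apply: cvgZr_tmp; apply: cvgM; [exact: polyfun_scont pp _ _ hu|exact: sg].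
- move=> N; have [C [N' pC]] := polyfun_growth pp.
  have [M gM] := @nrmX_gauss_bounded n eps (N + N') e0.
  exists (C * M * `|a|) => x; rewrite normrZ mulrA ler_wpM2r//.
  have C0 : 0 <= C by have := le_trans (normr_ge0 _) (pC 0); rewrite normr0 addr0 expr1n mulr1.
  rewrite -(gE x) normrM (gtr0_norm (gauss_gt0 _)).
  apply: le_trans (_ : C * ((1 + `|x|) ^+ (N + N') * gauss (eps *: x)) <= _); last first.
    exact: ler_wpM2l.
  rewrite exprD !mulrA ler_wpM2r ?(ltW (gauss_gt0 _))// [C * _]mulrC -mulrA.
  by rewrite ler_wpM2l// ltW// nrmX_gt0.
- move=> i; have [p' pp' dp] := polyfun_sderiv pp i; have [q' pq' dq] := polyfun_sderiv pq i.
  exists (fun x => ((p' x + p x * q' x) * expR (q x)) *: a).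
    exists (fun x => p' x + p x * q' x) => //.
    by apply: polyfunD => //; exact: polyfunM.
  move=> x; have dg := sderiv_comp (dq x) (is_derive_expR (q x)).
  have H := sderivZ (sderivZ (dp x) dg) (@sderiv_cst _ _ _ a x (e_ i)).
  rewrite (_ : _ *: a = (p' x *: expR (q x) + p x *: (expR (q x) * q' x)) *: a +
    (p x *: expR (q x)) *: 0); first exact: H.
  rewrite scaler0 addr0; congr (_ *: _).
  by rewrite -[_ *: _]/(_ * _) -[p x *: _]/(_ * _); ring.
Qed.

End gaussian.

(** * Integrable functions and calculus under the integral sign *)

Lemma integralRnB {R : realType} {V : completeNormedModType R} n (C : R)
    (f g : 'rV[R]_n -> V) : scont f -> scont g ->
  (forall x, `|f x| <= C * wt x) -> (forall x, `|g x| <= C * wt x) ->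
  integralRn (fun x => f x - g x) = integralRn f - integralRn g.
Proof.
elim: n C f g => [//|n IH] C f g sf sg fC gC; rewrite !integralRnS.
under eq_fun do rewrite (IH _ _ _ (scont_slice sf) (scont_slice sg) (bound_slice _ fC) (bound_slice _ gC)).
apply: (@bochnerB _ _ _ _ (C * pi ^+ n)).
- exact: continuous_integral_slice sf fC.
- exact: continuous_integral_slice sg gC.
- by move=> t; exact: bound_integral_slice.
- by move=> t; exact: bound_integral_slice.
Qed.

Section nice_functions.
Context {R : realType} {V : completeNormedModType R} {n : nat}.
Implicit Types f g : 'rV[R]_n -> V.

(** The integrands to which all integration rules here apply. *)
Definition nice f := scont f /\ exists C, forall x, `|f x| <= C * wt x.

Lemma nice_le f g (C : R) : scont g -> nice f -> (forall x, `|g x| <= C * `|f x|) -> nice g.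
Proof.
move=> sg [sf [M fM]] gf; split=> //; exists (`|C| * M) => x.
apply: le_trans (gf x) _; rewrite -mulrA.
apply: (@le_trans _ _ (`|C| * `|f x|)); first by rewrite ler_wpM2r// ler_norm.
by rewrite ler_wpM2l.
Qed.

Lemma niceD f g : nice f -> nice g -> nice (fun x => f x + g x).
Proof.
move=> [sf [C fC]] [sg [D gD]]; split.
  by move=> u p up; apply: cvgD; [exact: sf up|exact: sg up].
exists (C + D) => x; rewrite mulrDl; apply: le_trans (ler_normD _ _) _.
exact: lerD.
Qed.

Lemma integral_linear (W : completeNormedModType R) (L : V -> W) (M : R) f :
  (forall u v, L (u + v) = L u + L v) -> (forall (r : R) v, L (r *: v) = r *: L v) ->
  (forall v, `|L v| <= M * `|v|) -> nice f ->
  integralRn (fun x => L (f x)) = L (integralRn f).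
Proof. by move=> LD LZ LM [sf [C fC]]; exact: integralRn_linear LM sf fC. Qed.

Lemma integralZ (r : R) f : nice f -> integralRn (fun x => r *: f x) = r *: integralRn f.
Proof.
apply: (@integral_linear _ (fun v => r *: v) `|r|) => [u v|s v|v].
- by rewrite scalerDr.
- by rewrite !scalerA mulrC.
- by rewrite normrZ.
Qed.

Lemma niceN f : nice f -> nice (fun x => - f x).
Proof.
move=> nf; apply: (nice_le (f := f) (C := 1)) => //.
  by move=> u p up; apply: cvgN; exact: nf.1 up.
by move=> x; rewrite normrN mul1r.
Qed.

Lemma integralB f g : nice f -> nice g ->
  integralRn (fun x => f x - g x) = integralRn f - integralRn g.
Proof.
move=> [sf [C fC]] [sg [D gD]].
have C0 := bound_ge0 fC; have D0 := bound_ge0 gD.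
apply: (integralRnB (C := C + D)) => // x.
  by apply: le_trans (fC x) _; rewrite ler_wpM2r ?lerDl// ltW// wt_gt0.
by apply: le_trans (gD x) _; rewrite ler_wpM2r ?lerDr// ltW// wt_gt0.
Qed.

Lemma integralD f g : nice f -> nice g ->
  integralRn (fun x => f x + g x) = integralRn f + integralRn g.
Proof.
move=> nf ng; have nN := niceN ng.
have := integralB nf nN; under eq_fun do rewrite opprK.
move=> ->; congr (_ + _); have := integralZ (-1) ng.
under eq_fun do rewrite scaleN1r; move=> ->.
by rewrite scaleN1r opprK.
Qed.

End nice_functions.

Section integral_calculus.
Context {R : realType}.
Local Notation e_ i := (delta_mx 0 i).

Lemma wt_ge0 n (x : 'rV[R]_n) : 0 <= wt x.
Proof. by rewrite ltW// wt_gt0. Qed.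

Lemma wt_le1 n (x : 'rV[R]_n) : wt x <= 1.
Proof. by apply: prodr_ile1 => i _; rewrite wt1_le1 andbT ltW// wt1_gt0. Qed.

Lemma mean_value_dir (U V : normedModType R) (f : U -> V) (g : U -> V) x v (s M : R) :
  (forall y, sderiv f y v (g y)) -> (forall t, `|t| <= `|s| -> `|g (t *: v + x)| <= M) ->
  `|f (s *: v + x) - f x| <= `|s| * M.
Proof.
move=> fg gM.
apply: (@mean_value_line _ _ _ _ (fun t => s *: g (t *: (s *: v) + x))) => t /andP[t0 t1].
  exact: sderiv_scale_dir.
rewrite normrZ ler_wpM2l// scalerA; apply: gM.
by rewrite normrM ger0_norm// ler_piMl.
Qed.

(** The mean value inequality turns the bound on DH, uniform in x, into a majorant for the
    difference quotients of H. *)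
Lemma sderiv_integral n m (V : completeNormedModType R)
    (H DH : 'rV[R]_n -> 'rV[R]_m -> V) (C : R) (x v : 'rV[R]_n) :
  (forall x y, sderiv (H ^~ y) x v (DH x y)) ->
  (forall x, scont (H x)) -> (forall x, scont (DH x)) ->
  (forall x y, `|H x y| <= C * wt y) -> (forall x y, `|DH x y| <= C * wt y) ->
  sderiv (fun x => integralRn (H x)) x v (integralRn (DH x)).
Proof.
move=> dH sH sDH HC DHC u u0 uc.
have C0 : 0 <= C := bound_ge0 (HC 0).
have E k : (u k)^-1 *: (integralRn (H (u k *: v + x)) - integralRn (H x)) =
    integralRn (fun y => (u k)^-1 *: (H (u k *: v + x) y - H x y)).
  have nH z : nice (H z) by split; [exact: sH|exists C].
  rewrite -(integralB (nH _) (nH _)) integralZ//.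
  by apply: niceD; [exact: nH|exact: niceN].
apply: (cvgn_ext E); apply: (integralRn_dominated (C := C)) => //.
- move=> k p p0 hp; apply: cvgZl_tmp; apply: cvgB; exact: sH hp.
- move=> k y; rewrite normrZ normfV ler_pdivrMl ?normr_gt0//.
  by apply: (@mean_value_dir _ _ (H ^~ y) (DH ^~ y)) => [z|t _]; [exact: dH|exact: DHC].
- by move=> y; exact: dH.
Qed.

Lemma wt_coord_shift n (x : 'rV[R]_n) i (s : R) : `|s| <= 1 ->
  wt (s *: e_ i + x) <= 4 * wt x.
Proof.
move=> s1; rewrite /wt (bigD1 i)//= [X in _ <= _ * X](bigD1 i)//= mulrA.
have P0 : 0 <= \prod_(j < n | j != i) wt1 (x 0 j).
  by apply: prodr_ge0 => j _; rewrite ltW// wt1_gt0.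
rewrite (eq_bigr (fun j => wt1 (x 0 j))); last first.
  by move=> j ji; rewrite !mxE eqxx (negbTE ji) mulr0 add0r.
rewrite ler_wpM2r// !mxE !eqxx mulr1.
have -> : 4 = 2 * (1 + 1 ^+ 2) :> R by rewrite expr1n; lra.
by apply: wt1_shift_le; rewrite opprD addrCA subrr addr0 normrN.
Qed.

(** By translation invariance every difference quotient of f integrates to 0, and the integrals of
    these quotients tend to that of g. The factor 4 of [wt_coord_shift] accounts for shifts of
    length at most 1. *)
Lemma integral_sderiv0 n (V : completeNormedModType R) (f g : 'rV[R]_n -> V) (C : R) i :
  (forall x, sderiv f x (e_ i) (g x)) -> scont f -> scont g ->
  (forall x, `|f x| <= C * wt x) -> (forall x, `|g x| <= C * wt x) ->
  integralRn g = 0.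
Proof.
move=> fg sf sg fC gC.
have C0 : 0 <= C := bound_ge0 fC.
pose u (k : nat) : R := k.+1%:R^-1.
have u0 k : u k != 0 by rewrite invr_eq0.
have uc : u k @[k --> \oo] --> (0 : R).
  apply/cvgrPdist_lt => e e0; have := harmonic_nbhs e0; apply: filterS => k.
  by rewrite sub0r normrN gtr0_norm// /u invr_gt0.
have sfu k : scont (fun x => f (u k *: e_ i + x)).
  by move=> y y0 hy; apply: sf; apply: cvgD => //; exact: cvg_cst.
have fuC k x : `|f (u k *: e_ i + x)| <= C * 4 * wt x.
  apply: le_trans (fC _) _; rewrite -mulrA ler_wpM2l// wt_coord_shift//.
  by rewrite ger0_norm ?invr_ge0// /u invf_le1 ?ler1n.
have E k : integralRn (fun x => (u k)^-1 *: (f (u k *: e_ i + x) - f x)) = 0.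
  have nf : nice f by split=> //; exists C.
  have nfu : nice (fun x => f (u k *: e_ i + x)) by split; [exact: sfu|exists (C * 4)].
  rewrite integralZ; last by apply: niceD => //; exact: niceN.
  rewrite integralB//; have := integralRn_affine (u k *: e_ i) ltr01 sf fC.
  rewrite expr1n invr1 scale1r; under eq_fun do rewrite scale1r addrC.
  by move=> ->; rewrite subrr scaler0.
have H : integralRn (fun x => (u k)^-1 *: (f (u k *: e_ i + x) - f x)) @[k --> \oo] -->
    integralRn g.
  apply: (integralRn_dominated (C := C * 4)) => //.
  - by move=> k p p0 hp; apply: cvgZl_tmp; apply: cvgB; [exact: sfu hp|exact: sf hp].
  - move=> k x; rewrite normrZ normfV ler_pdivrMl ?normr_gt0//.
    apply: mean_value_dir => [y|t tu]; first exact: fg.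
    apply: le_trans (gC _) _; rewrite -mulrA ler_wpM2l// wt_coord_shift//.
    apply: le_trans tu _.
    by rewrite ger0_norm ?invr_ge0// /u invf_le1 ?ler1n.
  - by move=> x; exact: fg.
exact: (cvgn_eq E H (cvg_cst _)).
Qed.

End integral_calculus.

(** * The Fourier transform of Schwartz functions *)

Section fourier_transform.
Context {R : realType} {n : nat} {A : cstarAlgType R}.
Implicit Types (f g : 'rV[R]_n -> A) (x y xi : 'rV[R]_n).

Lemma nice_schwartz f : schwartz f -> nice f.
Proof.
by move=> sf; split; [exact: schwartz_scont|apply: rapid_wt; exact: schwartz_rapid].
Qed.

Lemma scont_cexp (U : normedModType R) (phi : U -> R) (f : U -> A) :
  scont phi -> scont f -> scont (fun p : U => cexp (phi p) *c: f p).
Proof. by move=> sphi sf u p up; apply: jcont_cexp; [exact: sphi up|exact: sf up]. Qed.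

Lemma nice_cexp (phi : 'rV[R]_n -> R) f : scont phi -> nice f ->
  nice (fun x => cexp (phi x) *c: f x).
Proof.
move=> sphi nf; apply: (nice_le (f := f) (C := 1)) => //.
  by apply: scont_cexp => //; exact: nf.1.
by move=> x; rewrite norm_cexp_scale mul1r.
Qed.

Lemma scont_dotl y : scont (fun x => dot x y).
Proof. by move=> u p up; apply: jcont_dot => //; exact: cvg_cst. Qed.

Lemma scont_dotr y : scont (fun x => dot y x).
Proof. by move=> u p up; apply: jcont_dot => //; exact: cvg_cst. Qed.

Lemma integral_cscale (z : R[i]) f : nice f ->
  integralRn (fun x => z *c: f x) = z *c: integralRn f.
Proof.
apply: (@integral_linear _ _ _ _ (fun v => z *c: v) (Normc.normc z)) => [u v|r v|v].
- exact: cscaleDr.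
- exact: cscalerZ.
- by rewrite norm_cscale.
Qed.

Lemma integral_amulr (a : A) f : nice f ->
  integralRn (fun x => f x *a a) = integralRn f *a a.
Proof.
apply: (@integral_linear _ _ _ _ (fun b => b *a a) `|a|) => [u v|r v|v].
- exact: amulDl.
- exact: amul_realZl.
- by rewrite mulrC norm_amul.
Qed.

Lemma integral_amull (a : A) f : nice f ->
  integralRn (fun x => a *a f x) = a *a integralRn f.
Proof.
apply: (@integral_linear _ _ _ _ (fun b => a *a b) `|a|) => [u v|r v|v].
- exact: amulDr.
- exact: amul_realZr.
- exact: norm_amul.
Qed.

(** The Fourier transform before normalization, which keeps powers of 2 pi out of the
    computations. *)
Definition wave f xi : A := integralRn (fun y => cexp (- dot y xi) *c: f y).

Lemma fourierE f xi : fourier f xi = (Num.sqrt (2 * pi) ^- n) *: wave f xi.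
Proof. by []. Qed.

Lemma nice_wave f xi : nice f -> nice (fun y => cexp (- dot y xi) *c: f y).
Proof. by apply: nice_cexp => u p up; apply: cvgN; exact: scont_dotl up. Qed.

Lemma waveB f g xi : nice f -> nice g ->
  wave (fun y => f y - g y) xi = wave f xi - wave g xi.
Proof.
move=> nf ng; rewrite /wave -(integralB (nice_wave xi nf) (nice_wave xi ng)).
by congr integralRn; apply/funext => y; rewrite cscalerB.
Qed.

Lemma scont_wave f : nice f -> scont (wave f).
Proof.
move=> [sf [C fC]] u p up; apply: (integralRn_dominated (C := C)).
- by move=> k; exact: (nice_wave (u k) (conj sf (ex_intro _ C fC))).1.
- exact: (nice_wave p (conj sf (ex_intro _ C fC))).1.
- by move=> k x; rewrite norm_cexp_scale.
- move=> x; apply: jcont_cexp; last exact: cvg_cst.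
  by apply: cvgN; exact: scont_dotr up.
Qed.

(** Integration by parts: the derivative along i of exp(- i y.xi) f(y) has integral 0 by
    [integral_sderiv0]. *)
Lemma wave_partial f i xi : schwartz f ->
  wave (partials [:: i] f) xi = xi 0 i *: ((0 +i* 1) *c: wave f xi).
Proof.
move=> sf; pose ph y := - dot y xi.
have sph : scont ph by move=> u p up; apply: cvgN; exact: scont_dotl up.
have nf := nice_schwartz sf; have ndf := nice_schwartz (schwartz_partials [:: i] sf).
have nif : nice (fun y => (- xi 0 i) *: ((0 +i* 1) *c: f y)).
  by apply: nice_schwartz; apply: schwartz_scale; exact: schwartz_cscale.
have ng : nice (fun y => (- xi 0 i) *: ((0 +i* 1) *c: f y) + partials [:: i] f y).
  exact: niceD.
have [sF [C FC]] := nice_cexp sph nf.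
have [sG [D GD]] := nice_cexp sph ng.
have C0 := bound_ge0 FC; have D0 := bound_ge0 GD.
have H : integralRn (fun y => cexp (ph y) *c:
    ((- xi 0 i) *: ((0 +i* 1) *c: f y) + partials [:: i] f y)) = 0.
  apply: (@integral_sderiv0 _ _ _ (fun y => cexp (ph y) *c: f y) _ (C + D) i) => //.
  - move=> y; apply: sderiv_cexp; last exact: schwartz_sderiv.
    by move=> h; rewrite /ph dotDl dotZl dotC dot_delta opprD addrC mulrN.
  - by move=> y; apply: le_trans (FC y) _; rewrite ler_wpM2r ?lerDl ?wt_ge0.
  - by move=> y; apply: le_trans (GD y) _; rewrite ler_wpM2r ?lerDr ?wt_ge0.
have : wave (fun y => partials [:: i] f y - xi 0 i *: ((0 +i* 1) *c: f y)) xi = 0.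
  rewrite -[RHS]H; congr integralRn; apply/funext => y; congr (_ *c: _).
  by rewrite scaleNr addrC.
rewrite waveB//; last first.
  by apply: nice_schwartz; apply: schwartz_scale; exact: schwartz_cscale.
move/eqP; rewrite subr_eq0 => /eqP ->.
have E : (fun y => cexp (- dot y xi) *c: (xi 0 i *: ((0 +i* 1) *c: f y))) =
    (fun y => xi 0 i *: ((0 +i* 1) *c: (cexp (- dot y xi) *c: f y))).
  by apply/funext => y; rewrite cscalerZ !cscaleA mulrC.
rewrite /wave E integralZ; first by rewrite integral_cscale//; exact: nice_wave.
apply: (nice_le (C := Normc.normc (0 +i* 1))) (nice_wave xi nf) _.
  by move=> u p up; apply: scont_cscale; exact: (nice_wave xi nf).1 up.
by move=> x; rewrite norm_cscale.
Qed.

(** Multiplying the transform by 1 + xi_i^2 amounts to replacing f by f minus its second derivative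
    along i. *)
Lemma wave_weight f i : schwartz f -> exists2 g, schwartz g &
  forall xi, (1 + xi 0 i ^+ 2) *: wave f xi = wave g xi.
Proof.
move=> sf; have sdf := schwartz_partials [:: i] sf.
have sddf := schwartz_partials [:: i] sdf.
exists (fun y => f y - partials [:: i] (partials [:: i] f) y); first exact: schwartzB.
move=> xi; rewrite waveB; [|exact: nice_schwartz..].
rewrite !wave_partial// cscalerZ cscale_ii !scalerN opprK scalerA.
by rewrite scalerDl scale1r -expr2.
Qed.

Lemma wave_weights f (r : seq 'I_n) : schwartz f -> exists2 g, schwartz g &
  forall xi, (\prod_(i <- r) (1 + xi 0 i ^+ 2)) *: wave f xi = wave g xi.
Proof.
elim: r f => [|i r IH] f sf.
  by exists f => // xi; rewrite big_nil scale1r.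
have [g sg gE] := wave_weight i sf; have [h sh hE] := IH g sg.
by exists h => // xi; rewrite big_cons mulrC -scalerA gE hE.
Qed.

(** Taking the factors 1 + xi_i^2 for all coordinates gives exactly the inverse of [wt xi], and the
    transform of the resulting Schwartz function is bounded. *)
Lemma wave_bound f : schwartz f -> exists C, forall xi, `|wave f xi| <= C * wt xi.
Proof.
move=> sf; have [g sg gE] := wave_weights (index_enum 'I_n) sf.
have [_ [C gC]] := nice_schwartz sg.
exists (C * pi ^+ n) => xi.
have p0 : 0 < \prod_(i <- index_enum 'I_n) (1 + xi 0 i ^+ 2).
  by apply: prodr_gt0 => i _; rewrite ltr_wpDr ?sqr_ge0.
have -> : wave f xi = wt xi *: wave g xi.
  rewrite -gE scalerA (_ : wt xi = (\prod_(i <- index_enum 'I_n) (1 + xi 0 i ^+ 2))^-1).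
    by rewrite mulVf ?scale1r// gt_eqF.
  by apply/esym; apply: (big_morph (fun y : R => y^-1)) => [y z|]; rewrite ?invr1 ?invfM.
rewrite normrZ ger0_norm ?wt_ge0// mulrC ler_wpM2r ?wt_ge0//.
apply: integralRn_norm_le; first by have [] := nice_wave xi (nice_schwartz sg).
by move=> y; rewrite norm_cexp_scale.
Qed.

Lemma nice_waveT f : schwartz f -> nice (wave f).
Proof.
by move=> sf; split; [apply: scont_wave; exact: nice_schwartz|exact: wave_bound].
Qed.

End fourier_transform.

(** * The Fourier transform of the Gaussian *)

Section gauss_transform.
Context {R : realType} {n : nat} {A : cstarAlgType R}.
Implicit Types (x y s t : 'rV[R]_n) (a : A).
Local Notation e_ i := (delta_mx 0 i).
Local Notation ii := (0 +i* 1).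

Lemma schwartz_gauss1 a : schwartz (fun t : 'rV[R]_n => gauss t *: a).
Proof.
have := @schwartz_gauss R n A 1 a ltr01; congr schwartz; apply/funext => t.
by rewrite scale1r.
Qed.

Lemma sderiv_gauss i t : sderiv (@gauss R n) t (e_ i) (- t 0 i * gauss t).
Proof.
have d0 : sderiv (fun t : 'rV[R]_n => t) t (e_ i) (e_ i).
  move=> u u0 uc; have : (e_ i : 'rV[R]_n) @[_ --> \oo] --> (e_ i : 'rV[R]_n) by exact: cvg_cst.
  by apply: cvgn_ext => k; rewrite addrK scalerA mulVf// scale1r.
have d1 : sderiv (fun t : 'rV[R]_n => dot t t) t (e_ i) (dot (e_ i) t + dot t (e_ i)).
  apply: (sderiv_bilinear _ _ _ _ jcont_dot d0 d0).
  - by move=> *; exact: dotDl.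
  - by move=> *; exact: dotDr.
  - by move=> *; exact: dotZl.
  - by move=> *; exact: dotZr.
have d2 : sderiv (fun t : 'rV[R]_n => - dot t t / 2) t (e_ i) (- t 0 i).
  have -> : - t 0 i = - (dot (e_ i) t + dot t (e_ i)) / 2.
    by rewrite dotC !dot_delta; field.
  apply: (@sderiv_linear R _ _ _ (fun r : R => - r / 2) _ _ _ _ _ _ _ d1).
  - by move=> a b; rewrite opprD mulrDl.
  - by move=> r b; rewrite -[r *: b]/(r * b) -[RHS]/(r * _); ring.
  - by move=> u p up; apply: cvgMr_tmp; exact: cvgN.
have := sderiv_comp d2 (is_derive_expR (- dot t t / 2)).
by rewrite mulrC.
Qed.

Definition gwave a s : A := integralRn (fun t => cexp (dot s t) *c: (gauss t *: a)).

Lemma nice_gwave a s : nice (fun t => cexp (dot s t) *c: (gauss t *: a)).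
Proof. by apply: nice_cexp; [exact: scont_dotr|apply: nice_schwartz; exact: schwartz_gauss1]. Qed.

(** Up to sign this is a partial derivative of the Schwartz function gauss(t) a. *)
Lemma nice_coord_gauss a i : nice (fun t : 'rV[R]_n => t 0 i *: (gauss t *: a)).
Proof.
have sg := schwartz_gauss1 a.
have /nice_schwartz[s1 [C h]] := schwartz_partials [:: i] sg.
have E : partials [:: i] (fun t => gauss t *: a) = fun t => - (t 0 i *: (gauss t *: a)).
  apply/funext => t.
  have := sderivZ (@sderiv_gauss i t) (@sderiv_cst _ _ _ a t (e_ i)).
  rewrite scaler0 addr0 => /(sderiv_unique (@schwartz_sderiv _ _ _ _ i t sg)) ->.
  by rewrite -scalerA scaleNr.
have := niceN (conj s1 (ex_intro _ C h)); rewrite E.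
by under eq_fun do rewrite opprK.
Qed.

(** The transform satisfies the same differential equation as the Gaussian: differentiating under
    the integral brings down i t_i, and integration by parts trades t_i for i s_i. *)
Lemma sderiv_gwave a s i : sderiv (gwave a) s (e_ i) (- s 0 i *: gwave a s).
Proof.
have ng s' := nice_gwave a s'; have nc := nice_coord_gauss a i.
have sg := schwartz_gauss1 a.
have ncx s' : nice (fun t => cexp (dot s' t) *c: (t 0 i *: (gauss t *: a))).
  by apply: nice_cexp nc; exact: scont_dotr.
have nicx s' : nice (fun t => cexp (dot s' t) *c: (t 0 i *: (ii *c: (gauss t *: a)))).
  apply: (nice_le (C := 1)) (ncx s') _ => [|t]; last first.
    by rewrite !norm_cexp_scale mul1r !normrZ norm_cscale/= expr0n expr1n/= add0r
      sqrtr1 mul1r normrZ.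
  move=> u p up; apply: jcont_cexp; first exact: scont_dotr up.
  apply: cvgZ; first exact: (cvg_comp _ _ up (@coord_continuous R 1 n 0 i p)).
  by apply: scont_cscale; exact: (nice_schwartz sg).1 up.
have [_ [C gC]] := nice_schwartz sg; have [_ [D cD]] := nc.
have C0 := bound_ge0 gC; have D0 := bound_ge0 cD.
have H : sderiv (gwave a) s (e_ i)
    (integralRn (fun t => cexp (dot s t) *c: (t 0 i *: (ii *c: (gauss t *: a))))).
  apply: (@sderiv_integral _ _ _ _ _
    (fun s t => cexp (dot s t) *c: (t 0 i *: (ii *c: (gauss t *: a)))) (C + D)).
  - move=> s' t.
    have := @sderiv_cexp _ _ _ (fun s => dot s t) (fun=> gauss t *: a) s' (e_ i) (t 0 i) 0.
    rewrite addr0; apply; last exact: sderiv_cst.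
    by move=> h; rewrite dotDl dotZl [dot (e_ i) t]dotC dot_delta addrC.
  - by move=> s'; have [] := ng s'.
  - by move=> s'; have [] := nicx s'.
  - move=> s' t; rewrite norm_cexp_scale; apply: le_trans (gC t) _.
    by rewrite ler_wpM2r ?lerDl ?wt_ge0.
  - move=> s' t; rewrite norm_cexp_scale.
    rewrite normrZ norm_cscale/= expr0n expr1n/= add0r sqrtr1 mul1r -normrZ.
    by apply: le_trans (cD t) _; rewrite ler_wpM2r ?lerDr ?wt_ge0.
suff <- : integralRn (fun t => cexp (dot s t) *c: (t 0 i *: (ii *c: (gauss t *: a)))) =
   - s 0 i *: gwave a s by [].
have nis : nice (fun t => s 0 i *: (ii *c: (gauss t *: a)) - t 0 i *: (gauss t *: a)).
  apply: niceD; last exact: niceN.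
  by apply: nice_schwartz; apply: schwartz_scale; exact: schwartz_cscale.
have [nF [C1 FC]] := ng s.
have [nG [C2 GC]] := nice_cexp (@scont_dotr R n s) nis.
have C10 := bound_ge0 FC; have C20 := bound_ge0 GC.
have Z : integralRn (fun t => cexp (dot s t) *c:
    (s 0 i *: (ii *c: (gauss t *: a)) - t 0 i *: (gauss t *: a))) = 0.
  apply: (@integral_sderiv0 _ _ _ (fun t => cexp (dot s t) *c: (gauss t *: a)) _ (C1 + C2) i) => //.
  - move=> t; apply: sderiv_cexp.
      by move=> h; rewrite dotDr dotZr dot_delta addrC.
    have := sderivZ (@sderiv_gauss i t) (@sderiv_cst _ _ _ a t (e_ i)).
    by rewrite scaler0 addr0 -scalerA scaleNr.
  - by move=> t; apply: le_trans (FC t) _; rewrite ler_wpM2r ?lerDl ?wt_ge0.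
  - by move=> t; apply: le_trans (GC t) _; rewrite ler_wpM2r ?lerDr ?wt_ge0.
(* [Z] is the vanishing integral of the derivative in t_i; splitting it gives the trade of t_i for i
   s_i. *)
have Z1 : integralRn (fun t => cexp (dot s t) *c: (t 0 i *: (gauss t *: a))) =
    s 0 i *: (ii *c: gwave a s).
  apply/eqP; rewrite eq_sym -subr_eq0; apply/eqP; rewrite -[RHS]Z.
  have nis1 : nice (fun t => ii *c: (cexp (dot s t) *c: (gauss t *: a))).
    apply: (nice_le (C := Normc.normc ii)) (ng s) _ => [u p up|t].
      by apply: scont_cscale; exact: (ng s).1 up.
    by rewrite norm_cscale.
  rewrite /gwave -integral_cscale// -integralZ// -integralB//; last first.
    apply: (nice_le (C := `|s 0 i|)) (nis1) _ => [u p up|t]; last by rewrite normrZ.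
    by apply: cvgZl_tmp; exact: nis1.1 up.
  congr integralRn; apply/funext => t; rewrite cscalerB !cscalerZ !cscaleA.
  by rewrite [ii * _]mulrC.
have -> : (fun t => cexp (dot s t) *c: (t 0 i *: (ii *c: (gauss t *: a)))) =
    fun t => ii *c: (cexp (dot s t) *c: (t 0 i *: (gauss t *: a))).
  by apply/funext => t; rewrite !cscalerZ !cscaleA [ii * _]mulrC.
by rewrite integral_cscale// Z1 cscalerZ cscale_ii scalerN scaleNr.
Qed.

Lemma scont_gwave a : scont (gwave a).
Proof.
have [sg [C gC]] := nice_schwartz (schwartz_gauss1 a).
move=> u p up; apply: (integralRn_dominated (C := C)).
- by move=> k; have [] := nice_gwave a (u k).
- by have [] := nice_gwave a p.
- by move=> k t; rewrite norm_cexp_scale.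
- by move=> t; apply: jcont_cexp; [exact: scont_dotl up|exact: cvg_cst].
Qed.

(** Along the ray r |-> r s, the product of exp(r^2 s.s / 2) with the transform has derivative 0, so
    its values at r = 1 and r = 0 agree. *)
Lemma gwaveE a s : gwave a s = gauss s *: integralRn (fun t => gauss t *: a).
Proof.
pose D := dot s s.
pose E (r : R) := expR (r * r / 2 * D).
have dE r : sderiv E r 1 (E r * (r * D)).
  have d0 : sderiv (fun r : R => r) r 1 (1 : R).
    by apply/sderivP; split; [exact: derivable_id|exact: derive_id].
  have d1 : sderiv (fun r : R => r * r) r 1 (1 *: r + r *: 1) := sderivZ d0 d0.
  have d2 : sderiv (fun r : R => r * r / 2 * D) r 1 (r * D).
    have := @sderiv_linear R _ _ _ (fun q : R => q / 2 * D) _ _ _ _ _ _ _ d1.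
    have -> : (1 *: r + r *: 1) / 2 * D = r * D.
      by rewrite -[1 *: r]/(1 * r) -[r *: 1]/(r * 1); field.
    apply.
    - by move=> x y; ring.
    - by move=> x y; rewrite -[x *: y]/(x * y) -[RHS]/(x * _); ring.
    - by move=> u p up; apply: cvgMr_tmp; exact: cvgMr_tmp.
  exact: (sderiv_comp d2 (is_derive_expR _)).
have dG r : sderiv (fun r : R => gwave a (r *: s)) r 1 (- (r * D) *: gwave a (r *: s)).
  have H : sderiv (gwave a) (r *: s) s (\sum_i s 0 i *: (- (r *: s) 0 i *: gwave a (r *: s))).
    apply: (sderiv_dir (g := fun i s => - s 0 i *: gwave a s)) => [i t|i u p up].
      exact: sderiv_gwave.
    apply: cvgZ; last exact: scont_gwave up.
    by apply: cvgN; exact: (cvg_comp _ _ up (@coord_continuous R 1 n 0 i p)).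
  have -> : - (r * D) *: gwave a (r *: s) = \sum_i s 0 i *: (- (r *: s) 0 i *: gwave a (r *: s)).
    rewrite /D /dot mulr_sumr -sumrN scaler_suml; apply: eq_bigr => i _.
    by rewrite scalerA mxE; congr (_ *: _); ring.
  have := @sderiv_line _ _ _ (gwave a) 0 s r _ _; rewrite addr0 => /(_ _ H).
  by under eq_fun do rewrite addr0.
pose Phi r := E r *: gwave a (r *: s).
have dPhi r : sderiv Phi r 1 0.
  have := sderivZ (dE r) (dG r); rewrite scalerA -scalerDl.
  by rewrite mulrN subrr scale0r.
have := @mean_value_le _ _ Phi (fun=> 0) 0 1 0 ler01 (fun r _ => dPhi r).
rewrite normr0 mul0r => /(_ (fun _ _ => lexx _)); rewrite normr_le0 subr_eq0.
rewrite /Phi /E scale1r scale0r !mul0r expR0 scale1r !mul1r => /eqP H.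
have -> : integralRn (fun t => gauss t *: a) = gwave a 0.
  by congr integralRn; apply/funext => t; rewrite dot0l cexp0 cscale1.
rewrite -H scalerA (_ : gauss s * _ = 1) ?scale1r//.
by rewrite /gauss -expRD -/D -[RHS]expR0; congr expR; field.
Qed.

End gauss_transform.

(** * Positivity of the Gaussian integral *)

Section gauss_integral.
Context {R : realType}.

Lemma gauss_row_mx n (t : R) (y : 'rV[R]_n) :
  gauss (row_mx t%:M y : 'rV_(1 + n)) = expR (- (t * t) / 2) * gauss y.
Proof.
rewrite /gauss -expRD; congr expR.
have -> : dot (row_mx t%:M y : 'rV_(1 + n)) (row_mx t%:M y) = t * t + dot y y.
  rewrite /dot big_split_ord big_ord1/= row_mxEl mxE eqxx mulr1n; congr (_ + _).
  by apply: eq_bigr => i _; rewrite !row_mxEr.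
by ring.
Qed.

Definition gauss1 (t : R) : R := expR (- (t * t) / 2).

Lemma continuous_gauss1 : continuous gauss1.
Proof.
apply/scontP => u p up.
have h : - (u k * u k) / 2 @[k --> \oo] --> - (p * p) / 2.
  by apply: cvgMr_tmp; apply: cvgN; exact: cvgM.
exact: (cvg_comp _ _ h (@continuous_expR R _)).
Qed.

Lemma gauss1_bound t : `|gauss1 t| <= 2 * wt1 t.
Proof.
rewrite gtr0_norm ?expR_gt0// /gauss1 /wt1 mulNr expRN.
have h := expR_ge1Dx (t * t / 2); have p : 0 < 1 + t ^+ 2 by rewrite ltr_wpDr ?sqr_ge0.
rewrite ler_pdivlMr// mulrC ler_pdivrMr ?expR_gt0// expr2; lra.
Qed.

(** Every Riemann sum is at least exp(- 1/2): k + 1 of its nodes lie in [0, 1[, where the Gaussian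
    is at least exp(- 1/2), and the other terms are nonnegative. *)
Lemma bochner_gauss1_gt0 : 0 < bochner (gauss1 : R -> R).
Proof.
have h := riemann_cvg 0 ltr01 continuous_gauss1 gauss1_bound.
apply: (@lt_le_trans _ _ (expR (- 1 / 2))); first exact: expR_gt0.
apply: (cvgr_to_ge h); apply: nearW => k.
have g0 t : 0 <= gauss1 t by exact: expR_ge0.
have d0 : 0 <= 1 / k.+1%:R :> R by rewrite divr_ge0.
(* The node of index (k + 1)^2 is 0, so the nodes in [0, 1[ have the indices from (k + 1)^2 to (k +
   1)^2 + k. *)
rewrite /riemann (@big_cat_nat _ _ _ (k.+1 ^ 2)%N)//=; last by rewrite -addnn leq_addr.
rewrite -[leLHS]add0r lerD//.
  by apply: sumr_ge0 => j _; exact: mulr_ge0.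
have kM : (k.+1 <= k.+1 ^ 2)%N by rewrite -[X in (X <= _)%N]expn1 leq_pexp2l.
rewrite (@big_cat_nat _ _ _ (k.+1 ^ 2 + k.+1)%N)//=; [|exact: leq_addr|by rewrite -addnn leq_add2l].
rewrite -[leLHS]addr0 lerD//; last by apply: sumr_ge0 => j _; exact: mulr_ge0.
rewrite -[X in \sum_(X <= _ < _) _]add0n big_addn addKn.
rewrite (_ : expR (- 1 / 2) = \sum_(0 <= i < k.+1) (1 / k.+1%:R) *: (expR (-1 / 2) : R));
  last first.
  rewrite big_const_nat subn0 iter_addr_0 -[RHS]mulr_natl.
  by rewrite -[(1 / _) *: _]/(1 / _ * _) mulrA mul1r divff ?mul1r// pnatr_eq0.
rewrite !big_nat; apply: ler_sum => j /andP[_ jk].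
rewrite ler_wpM2l// ler_expR ler_wpM2r// lerN2.
rewrite /node natrD addrK addr0 mul1r.
have j1 : k.+1%:R^-1 * j%:R <= 1 :> R.
  by rewrite mulrC ler_pdivrMr// mul1r ler_nat ltnW.
by rewrite mulr_ile1// mulr_ge0// invr_ge0.
Qed.

Lemma nice_gauss n : nice (@gauss R n).
Proof.
split; first exact: scont_gauss.
have [M gM] := @nrmX_gauss_bounded R n 1 (2 * n) ltr01.
have rg : forall x : 'rV[R]_n, gauss x <= M * wt x.
  move=> x; have := gM x; rewrite scale1r => h.
  apply: (@le_trans _ _ ((1 + `|x|) ^+ (2 * n) * gauss x * wt x)).
    by rewrite mulrAC mulrC ler_peMr ?(ltW (gauss_gt0 _))// mulrC wt_nrm_ge1.
  by rewrite ler_wpM2r// wt_ge0.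
by exists M => x; rewrite gtr0_norm ?gauss_gt0.
Qed.

Lemma integral_gauss_gt0 n : 0 < integralRn (@gauss R n).
Proof.
elim: n => [|n IH]; first exact: gauss_gt0.
rewrite integralRnS.
have -> : (fun t => integralRn (fun y : 'rV_n => gauss (row_mx t%:M y : 'rV_(1 + n)))) =
    fun t => integralRn (@gauss R n) *: gauss1 t.
  apply/funext => t; under eq_fun do rewrite gauss_row_mx.
  rewrite -[RHS]/(_ * _) [RHS]mulrC; exact: (integralZ (gauss1 t) (nice_gauss n)).
rewrite (@bochner_linear _ _ _ (fun r : R => integralRn (@gauss R n) *: r)
  `|integralRn (@gauss R n)| _ 2).
- by rewrite mulr_gt0// bochner_gauss1_gt0.
- by move=> u v; rewrite scalerDr.
- by move=> r v; rewrite !scalerA mulrC.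
- by move=> v; rewrite normrM.
- exact: continuous_gauss1.
- exact: gauss1_bound.
Qed.

Lemma integral_gaussZ n (A : cstarAlgType R) (a : A) :
  integralRn (fun t : 'rV[R]_n => gauss t *: a) = integralRn (@gauss R n) *: a.
Proof.
apply: (@integral_linear _ _ _ _ (fun r : R => r *: a) `|a|).
- by move=> u v; rewrite scalerDl.
- by move=> r v; rewrite scalerA.
- by move=> v; rewrite normrZ mulrC.
- exact: nice_gauss.
Qed.

End gauss_integral.

(** * Fourier inversion by Gaussian regularization *)

Section inversion.
Context {R : realType} {n : nat} {A : cstarAlgType R}.
Implicit Types (f : 'rV[R]_n -> A) (x y xi eta : 'rV[R]_n).

Local Notation c := (integralRn (@gauss R n)).

Lemma wt_affine_le (l : R) (h : 'rV[R]_n) : 0 < l ->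
  exists2 K, 0 <= K & forall y, wt (l *: y + h) <= K * wt y.
Proof.
move=> l0; exists (\prod_i (1 + 2 * (1 + h 0 i ^+ 2) / l ^+ 2)).
  apply: prodr_ge0 => i _; rewrite addr_ge0// divr_ge0 ?sqr_ge0//.
  by rewrite mulr_ge0// addr_ge0// sqr_ge0.
move=> y; rewrite -big_split/=; apply: ler_prod => i _.
by rewrite ltW ?wt1_gt0//= !mxE wt1_affine_le.
Qed.

Lemma nice_affine f (l : R) (h : 'rV[R]_n) : 0 < l -> nice f ->
  nice (fun y => f (l *: y + h)).
Proof.
move=> l0 [sf [C fC]]; split.
  by move=> u p up; apply: sf; apply: cvgD; [exact: cvgZl_tmp|exact: cvg_cst].
have [K K0 hK] := wt_affine_le h l0; exists (C * K) => y.
apply: le_trans (fC _) _; rewrite -mulrA ler_wpM2l//.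
exact: bound_ge0 fC.
Qed.

Lemma gauss_bound : exists2 M, 0 <= M & forall t : 'rV[R]_n, gauss t <= M * wt t.
Proof.
have [_ [M gM]] := @nice_gauss R n; exists M; first exact: bound_ge0 gM.
by move=> t; rewrite (le_trans (ler_norm _)).
Qed.

Lemma wave_norm_le f (C : R) xi : nice f -> (forall x, `|f x| <= C * wt x) ->
  `|wave f xi| <= C * pi ^+ n.
Proof.
move=> nf fC; apply: integralRn_norm_le; first by have [] := nice_wave xi nf.
by move=> y; rewrite norm_cexp_scale.
Qed.

Lemma nice_gauss_wave f : nice f -> nice (fun eta => gauss eta *: wave f eta).
Proof.
move=> nf; have [_ [C fC]] := nf; have [M M0 gM] := gauss_bound; split.
  by move=> u p up; apply: cvgZ; [exact: scont_gauss up|exact: (scont_wave nf) up].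
exists (M * (C * pi ^+ n)) => eta; rewrite normrZ gtr0_norm ?gauss_gt0// mulrAC.
by apply: ler_pM => //; [exact/ltW/gauss_gt0|exact: wave_norm_le].
Qed.

(** Fubini moves the transform from f onto the Gaussian, which [gwaveE] reproduces up to the factor
    c. *)
Lemma integral_gauss_wave f : nice f ->
  integralRn (fun eta => gauss eta *: wave f eta) =
  integralRn (fun y => gauss y *: (c *: f y)).
Proof.
move=> nf; have [sf [C fC]] := nf; have [M M0 gM] := gauss_bound.
have C0 := bound_ge0 fC.
have E1 : (fun eta => gauss eta *: wave f eta) = (fun eta => integralRn
    (fun y => gauss eta *: (cexp (- dot y eta) *c: f y))).
  by apply/funext => eta; rewrite -integralZ//; exact: nice_wave.
rewrite E1 (@integralRn_fubini _ _ _ _ _ (M * C)).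
- congr integralRn; apply/funext => y.
  rewrite -[y in gauss y]opprK gaussN -integral_gaussZ -gwaveE.
  congr integralRn; apply/funext => eta; rewrite cscalerZ dotNl.
  by [].
- move=> u w u0 w0 hu hw; apply: cvgZ; first exact: scont_gauss hu.
  by apply: jcont_cexp; [apply: cvgN; exact: jcont_dot|exact: sf hw].
- move=> eta y; rewrite normrZ norm_cexp_scale gtr0_norm ?gauss_gt0// mulrAC -mulrA mulrACA.
  apply: le_trans (ler_pM (ltW (gauss_gt0 _)) (normr_ge0 _) (gM eta) (fC y)) _.
  by rewrite le_eqVlt; apply/orP; left; apply/eqP; ring.
Qed.

Lemma regularized_inversion f x (l : R) : 0 < l -> schwartz f ->
  integralRn (fun xi => cexp (dot x xi) *c: (gauss (l *: xi) *: wave f xi)) =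
  integralRn (fun y => gauss y *: (c *: f (l *: y + x))).
Proof.
move=> l0 sf; have nf := nice_schwartz sf.
have nh := nice_affine x l0 nf.
have nPhi := nice_gauss_wave nh.
rewrite -(integral_gauss_wave nh).
(* The transform of y |-> f(l y + x) at l xi is l^(-n) exp(i x.xi) times the transform of f at xi;
   this reduces the claim to [integral_gauss_wave]. *)
have E xi : cexp (dot x xi) *c: (gauss (l *: xi) *: wave f xi) =
    l ^+ n *: (gauss (l *: xi) *: wave (fun y => f (l *: y + x)) (l *: xi)).
  have [sF [C FC]] := nice_wave xi nf.
  have WE : l ^+ n *: integralRn (fun y => cexp (- dot (l *: y + x) xi) *c: f (l *: y + x)) =
      wave f xi.
    rewrite (integralRn_affine x l0 sF FC) scalerA divff ?scale1r//.
    by rewrite expf_neq0// gt_eqF.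
  rewrite -WE cscalerZ [RHS]scalerA mulrC -scalerA; congr (_ *: _).
  rewrite cscalerZ; congr (_ *: _).
  have nF := nice_affine x l0 (nice_wave xi nf).
  rewrite -integral_cscale//; congr integralRn; apply/funext => y.
  rewrite cscaleA -cexpD; congr (cexp _ *c: _).
  by rewrite dotDl dotZl dotZr opprD addrCA subrr addr0.
rewrite (_ : (fun xi => _) = fun xi => l ^+ n *: (gauss (l *: xi + 0) *:
    wave (fun y => f (l *: y + x)) (l *: xi + 0))); last first.
  by apply/funext => xi; rewrite E addr0.
have [sP [D PD]] := nPhi.
rewrite integralZ; last exact: (nice_affine 0 l0 nPhi).
rewrite (integralRn_affine 0 l0 sP PD) scalerA divff ?scale1r//.
by rewrite expf_neq0// gt_eqF.
Qed.

(** Let l tend to 0 in [regularized_inversion]: the Gaussian on the left tends to 1, under the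
    majorant of [wave_bound], and f(l y + x) on the right tends to f(x). One factor c is already
    there, the other is the integral of the remaining Gaussian. *)
Lemma fourier_inversion f x : schwartz f ->
  integralRn (fun xi => cexp (dot x xi) *c: wave f xi) = c ^+ 2 *: f x.
Proof.
move=> sf; pose u (k : nat) : R := k.+1%:R^-1.
have u0 k : 0 < u k by rewrite invr_gt0.
have uc : u k @[k --> \oo] --> (0 : R).
  apply/cvgrPdist_lt => e e0; have := harmonic_nbhs e0; apply: filterS => k.
  by rewrite sub0r normrN gtr0_norm.
have [sw [C wC]] := nice_waveT sf.
have sx : scont (fun xi => dot x xi) by exact: scont_dotr.
have sg l : scont (fun xi : 'rV[R]_n => gauss (l *: xi)).
  by move=> v p vp; apply: scont_gauss; exact: cvgZl_tmp.
have lim1 : integralRn (fun xi => cexp (dot x xi) *c: (gauss (u k *: xi) *: wave f xi))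
    @[k --> \oo] --> integralRn (fun xi => cexp (dot x xi) *c: wave f xi).
  apply: (integralRn_dominated (C := C)).
  - move=> k; apply: scont_cexp => // v p vp.
    by apply: cvgZ; [exact: sg vp|exact: sw vp].
  - by apply: scont_cexp.
  - move=> k xi; rewrite norm_cexp_scale normrZ gtr0_norm ?gauss_gt0//.
    by apply: le_trans (wC xi); rewrite ler_piMl// gauss_le1.
  - move=> xi; apply: jcont_cexp; first exact: cvg_cst.
    rewrite -[X in _ --> X]scale1r -(gauss0 n) -(scale0r xi).
    by apply: cvgZr_tmp; apply: scont_gauss; exact: cvgZr_tmp.
have [B fB] := rapid_bounded (schwartz_rapid sf).
have B0 : 0 <= B by exact: le_trans (fB 0).
have [M M0 gM] := gauss_bound.
have lim2 : integralRn (fun y => gauss y *: (c *: f (u k *: y + x)))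
    @[k --> \oo] --> integralRn (fun y => gauss y *: (c *: f x)).
  have c0 : 0 <= c by rewrite ltW// integral_gauss_gt0.
  apply: (integralRn_dominated (C := M * (c * B))).
  - move=> k v p vp; apply: cvgZ; first exact: scont_gauss vp.
    apply: cvgZl_tmp; apply: (schwartz_scont sf (u := fun j => u k *: v j + x)).
    by apply: cvgD; [exact: cvgZl_tmp|exact: cvg_cst].
  - by move=> v p vp; apply: cvgZr_tmp; exact: scont_gauss vp.
  - move=> k y; rewrite !normrZ gtr0_norm ?gauss_gt0// [M * _]mulrC -mulrA mulrC.
    apply: ler_pM => //; first exact/ltW/gauss_gt0.
    by rewrite ger0_norm// ler_wpM2l.
  - move=> y; apply: cvgZl_tmp; apply: cvgZl_tmp.
    apply: (schwartz_scont sf (u := fun j => u j *: y + x)).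
    by rewrite -[X in _ --> X]add0r -(scale0r y); apply: cvgD; [exact: cvgZr_tmp|exact: cvg_cst].
have E k := regularized_inversion x (u0 k) sf.
by rewrite (cvgn_eq E lim1 lim2) integral_gaussZ scalerA expr2.
Qed.

End inversion.

(** * Gaussian averages of plane-wave multiplications *)

Section plane_waves.
Context {R : realType} {n : nat} {A : cstarAlgType R}.
Variable J : 'M[R]_n.
Implicit Types (f : 'rV[R]_n -> A) (x xi eta theta : 'rV[R]_n).
Local Notation e_ i := (delta_mx 0 i).

(* Right twisted multiplication by the plane wave exp(i theta.x). *)
Definition rwave theta f : 'rV[R]_n -> A := heisenberg (- (theta *m J)) theta f.

Lemma rwaveE theta f x : rwave theta f x = cexp (dot theta x) *c: f (x + theta *m J).
Proof. by rewrite /rwave /heisenberg opprK. Qed.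

Lemma norm_rwave theta f x : `|rwave theta f x| = `|f (x + theta *m J)|.
Proof. by rewrite rwaveE norm_cexp_scale. Qed.

Lemma jcont_rwave f : scont f -> jcont (fun theta x => rwave theta f x).
Proof.
move=> sf u w u0 w0 hu hw; rewrite rwaveE; under eq_fun do rewrite rwaveE.
apply: jcont_cexp; first exact: jcont_dot.
apply: (sf (fun k => w k + u k *m J)).
by apply: cvgD => //; exact: scont_mulmx hu.
Qed.

Variables (zeta : 'rV[R]_n) (a : A).

Definition freq (eps : R) eta := zeta + eps *: eta.

(* The case of interest is p = 1; allowing any polynomial p makes the class   *)
(* of sums of functions gsum closed under partial derivatives.                *)
Definition gterm eps (p : 'rV[R]_n -> R) f x eta : A :=
  (p eta * gauss eta) *: (rwave (freq eps eta) f x *a a).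

Definition gsum eps p f x : A := integralRn (gterm eps p f x).

Lemma cvg_freq (eps : nat -> R) (eta : nat -> 'rV[R]_n) e0 eta0 :
  eps k @[k --> \oo] --> e0 -> eta k @[k --> \oo] --> eta0 ->
  freq (eps k) (eta k) @[k --> \oo] --> freq e0 eta0.
Proof. by move=> he ht; apply: cvgD; [exact: cvg_cst|exact: cvgZ]. Qed.

Lemma jcont_gterm eps p f : polyfun p -> scont f ->
  jcont (fun x eta => gterm eps p f x eta).
Proof.
move=> pp sf u w u0 w0 hu hw; apply: cvgZ.
  by apply: cvgM; [exact: polyfun_scont pp _ _ hw|exact: scont_gauss hw].
apply: jcont_amul; last exact: cvg_cst.
by apply: (jcont_rwave sf) => //; apply: cvg_freq => //; exact: cvg_cst.
Qed.

Lemma polyfun_gauss_bound p N : polyfun p -> exists2 M, 0 <= M &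
  forall eta : 'rV[R]_n, `|p eta * gauss eta| * (1 + `|eta|) ^+ N <= M * wt eta.
Proof.
move=> pp; have [C [N' pC]] := polyfun_growth pp.
have C0 : 0 <= C by have := le_trans (normr_ge0 _) (pC 0); rewrite normr0 addr0 expr1n mulr1.
have [M gM] := @nrmX_gauss_bounded R n 1 (N' + N + 2 * n) ltr01.
have M0 : 0 <= M by apply: le_trans (gM 0);
  rewrite mulr_ge0 ?(ltW (nrmX_gt0 _ _))// ltW// gauss_gt0.
exists (C * M); first exact: mulr_ge0.
move=> eta; have := gM eta; rewrite scale1r => h.
have g0 := gauss_gt0 eta; have X0 k := nrmX_gt0 eta k.
rewrite normrM (gtr0_norm g0).
apply: (@le_trans _ _ (C * (1 + `|eta|) ^+ N' * gauss eta * (1 + `|eta|) ^+ N)).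
  by rewrite ler_wpM2r ?(ltW (X0 _))// ler_wpM2r ?(ltW g0).
apply: (@le_trans _ _ (C * ((1 + `|eta|) ^+ (N' + N + 2 * n) * gauss eta * wt eta))); last first.
  by rewrite -[leRHS]mulrA ler_wpM2l// ler_wpM2r// wt_ge0.
rewrite -!mulrA ler_wpM2l// 2!exprD -!mulrA.
have := wt_nrm_ge1 eta.
have q0 : 0 <= (1 + `|eta|) ^+ N' * ((1 + `|eta|) ^+ N * gauss eta).
  by rewrite !mulr_ge0// ltW.
move=> /(ler_wpM2l q0); rewrite mulr1 => /le_trans h'.
apply: le_trans (_ : _ <= (1 + `|eta|) ^+ N' * ((1 + `|eta|) ^+ N * gauss eta)) _.
  by rewrite [gauss eta * _]mulrC.
apply: h'; rewrite le_eqVlt; apply/orP; left; apply/eqP; ring.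
Qed.

(** Decay in x survives the shift of f by [freq eps eta *m J] at the price of a power of 1 + |eta|,
    by [peetre]; the Gaussian in eta absorbs that power. The constant is uniform for eps in
    [0, 1]. *)
Lemma gterm_bound p f N : polyfun p -> schwartz f -> exists2 C, 0 <= C &
  forall eps x eta, 0 <= eps <= 1 ->
    (1 + `|x|) ^+ N * `|gterm eps p f x eta| <= C * wt eta.
Proof.
move=> pp sf; have [M fM] := schwartz_rapid sf N.
have M0 : 0 <= M by apply: le_trans (fM 0); rewrite mulr_ge0// ltW// nrmX_gt0.
have [K K0 JK] := mulmx_norm_le J.
have [D D0 pD] := polyfun_gauss_bound N pp.
pose B := (1 + `|zeta *m J|) * (1 + K).
have B0 : 0 <= B by rewrite mulr_ge0// addr_ge0.
exists (M * B ^+ N * `|a| * D); first by rewrite !mulr_ge0// exprn_ge0.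
move=> eps x eta /andP[e0 e1].
have h1 : 1 + `|freq eps eta *m J| <= B * (1 + `|eta|).
  rewrite /freq mulmxDl -scalemxAl; apply: le_trans (peetre _ _) _.
  rewrite /B -mulrA ler_wpM2l ?addr_ge0// normrZ ger0_norm//.
  apply: (@le_trans _ _ (1 + `|eta *m J|)).
    by rewrite lerD2l ler_piMl.
  by have := JK eta; have := normr_ge0 eta; nra.
have h2 : 1 + `|x| <= (1 + `|x + freq eps eta *m J|) * (1 + `|freq eps eta *m J|).
  by have := peetre (x + freq eps eta *m J) (- (freq eps eta *m J)); rewrite addrK normrN.
have h3 : (1 + `|x|) ^+ N * `|f (x + freq eps eta *m J)| <= M * (B * (1 + `|eta|)) ^+ N.
  apply: (@le_trans _ _ (((1 + `|x + freq eps eta *m J|) ^+ N * `|f (x + freq eps eta *m J)|) *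
    (1 + `|freq eps eta *m J|) ^+ N)).
    rewrite mulrAC -exprMn ler_wpM2r// lerXn2r// ?nnegrE ?addr_ge0//.
  apply: ler_pM => //.
  by rewrite lerXn2r// ?nnegrE ?addr_ge0// mulr_ge0// addr_ge0.
rewrite normrZ.
apply: (@le_trans _ _ (`|p eta * gauss eta| *
  (((1 + `|x|) ^+ N * `|f (x + freq eps eta *m J)|) * `|a|))).
  rewrite mulrCA ler_wpM2l// -mulrA ler_wpM2l ?(ltW (nrmX_gt0 _ _))//.
  by apply: le_trans (norm_amul _ _) _; rewrite norm_rwave.
apply: (@le_trans _ _ (`|p eta * gauss eta| * (M * (B * (1 + `|eta|)) ^+ N * `|a|))).
  by rewrite ler_wpM2l// ler_wpM2r.
rewrite exprMn; have := ler_wpM2l (_ : 0 <= M * B ^+ N * `|a|) (pD eta).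
have -> : 0 <= M * B ^+ N * `|a| by rewrite !mulr_ge0// exprn_ge0.
move=> /(_ isT) h; rewrite (_ : _ * (_ * _) = M * B ^+ N * `|a| *
  (`|p eta * gauss eta| * (1 + `|eta|) ^+ N)); last by ring.
by rewrite -[leRHS]mulrA.
Qed.

Lemma nice_gterm eps p f x : 0 <= eps <= 1 -> polyfun p -> schwartz f ->
  nice (gterm eps p f x).
Proof.
move=> e01 pp sf; split.
  by apply: jcont_r; apply: jcont_gterm => //; exact: schwartz_scont.
have [C C0 gC] := gterm_bound 0 pp sf; exists C => eta.
by have := gC eps x eta e01; rewrite expr0 mul1r.
Qed.

Lemma gsum_bound p f N : polyfun p -> schwartz f -> exists2 C, 0 <= C &
  forall eps x, 0 <= eps <= 1 -> (1 + `|x|) ^+ N * `|gsum eps p f x| <= C.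
Proof.
move=> pp sf; have [C C0 gC] := gterm_bound N pp sf.
exists (C * pi ^+ n); first by rewrite mulr_ge0// exprn_ge0// pi_ge0.
move=> eps x e01; have X0 := nrmX_gt0 x N.
rewrite -[X in X * _](gtr0_norm X0) -normrZ -integralZ; last exact: nice_gterm.
apply: integralRn_norm_le.
  by move=> u p0 up; apply: cvgZl_tmp; exact: (nice_gterm x e01 pp sf).1 up.
by move=> eta; rewrite normrZ gtr0_norm// gC.
Qed.

Lemma scont_gsum eps p f : 0 <= eps <= 1 -> polyfun p -> schwartz f ->
  scont (gsum eps p f).
Proof.
move=> e01 pp sf; have [C C0 gC] := gterm_bound 0 pp sf.
move=> u x up; apply: (integralRn_dominated (C := C)).
- by move=> k; have [] := nice_gterm (u k) e01 pp sf.
- by have [] := nice_gterm x e01 pp sf.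
- by move=> k eta; have := gC eps (u k) eta e01; rewrite expr0 mul1r.
- by move=> eta; apply: (@jcont_gterm eps p f pp (schwartz_scont sf)) => //; exact: cvg_cst.
Qed.

Lemma polyfun_freq eps i : polyfun (fun eta => freq eps eta 0 i).
Proof.
rewrite (_ : (fun _ => _) = fun eta => zeta 0 i + eps * eta 0 i).
  apply: polyfunD; first exact: polyfun_cst.
  by apply: polyfunM; [exact: polyfun_cst|exact: polyfun_coord].
by apply/funext => eta; rewrite !mxE.
Qed.

(** Differentiating exp(i theta.x) under the integral brings down i theta_i; theta_i is affine in
    eta and joins the polynomial p. *)
Lemma sderiv_gsum eps p f x i : 0 <= eps <= 1 -> polyfun p -> schwartz f ->
  sderiv (gsum eps p f) x (e_ i)
    (gsum eps (fun eta => p eta * freq eps eta 0 i) (fun y => (0 +i* 1) *c: f y) x +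
     gsum eps p (partials [:: i] f) x).
Proof.
move=> e01 pp sf.
have pq : polyfun (fun eta => p eta * freq eps eta 0 i).
  by apply: polyfunM => //; exact: polyfun_freq.
have sif := schwartz_cscale (0 +i* 1) sf; have sdf := schwartz_partials [:: i] sf.
rewrite -integralD; [|exact: nice_gterm..].
have [C C0 gC] := gterm_bound 0 pp sf.
have [D D0 gD] := gterm_bound 0 pq sif.
have [F F0 gF] := gterm_bound 0 pp sdf.
have W := @wt_ge0 R n.
apply: (@sderiv_integral _ _ _ _ (gterm eps p f) (fun x eta =>
    gterm eps (fun eta => p eta * freq eps eta 0 i) (fun y => (0 +i* 1) *c: f y) x eta +
    gterm eps p (partials [:: i] f) x eta) (C + (D + F))).
- move=> y eta; set th := freq eps eta.
  have sr : sderiv (fun y => rwave th f y) y (e_ i)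
     (th 0 i *: rwave th (fun y => (0 +i* 1) *c: f y) y + rwave th (partials [:: i] f) y).
    rewrite !rwaveE -cscalerZ -cscaleDr.
    rewrite (_ : (fun y => _) = fun y => cexp (dot th y) *c: f (y + th *m J)); last first.
      by apply/funext => z; rewrite rwaveE.
    apply: (@sderiv_cexp _ _ _ (dot th) (fun y => f (y + th *m J))).
      by move=> h; rewrite dotDr dotZr dot_delta addrC.
    move=> u u0 uc; have := @schwartz_sderiv _ _ _ f i (y + th *m J) sf u u0 uc.
    by apply: cvgn_ext => k; rewrite addrA.
  have := @sderiv_linear R _ _ _ (fun b : A => (p eta * gauss eta) *: (b *a a)) _ _ _ _ _ _ _ sr.
  rewrite amulDl scalerDr amul_realZl scalerA mulrAC; apply.
  - by move=> b d; rewrite amulDl scalerDr.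
  - by move=> r b; rewrite amul_realZl !scalerA mulrC.
  - by move=> u b ub; apply: cvgZl_tmp; apply: jcont_amul ub _; exact: cvg_cst.
- by move=> y; have [] := nice_gterm y e01 pp sf.
- by move=> y; have [] := niceD (nice_gterm y e01 pq sif) (nice_gterm y e01 pp sdf).
- move=> y eta; have := gC eps y eta e01; rewrite expr0 mul1r => /le_trans; apply.
  by rewrite ler_wpM2r// lerDl addr_ge0.
- move=> y eta; have := gD eps y eta e01; have := gF eps y eta e01.
  rewrite !expr0 !mul1r => h1 h2; apply: le_trans (ler_normD _ _) _.
  rewrite !mulrDl -[leLHS]add0r lerD ?mulr_ge0// lerD//.
Qed.

(** The class for [schwartz_coind]; sums are included because the derivative of one [gsum] is a sum
    of two. *)
Inductive gsum_class eps : ('rV[R]_n -> A) -> Prop :=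
| GsumClass p f : polyfun p -> schwartz f -> gsum_class eps (gsum eps p f)
| GsumClassD F G : gsum_class eps F -> gsum_class eps G ->
    gsum_class eps (fun x => F x + G x).

Lemma schwartz_gsum eps p f : 0 <= eps <= 1 -> polyfun p -> schwartz f ->
  schwartz (gsum eps p f).
Proof.
move=> e01 pp sf; apply: (@schwartz_coind _ _ _ (gsum_class eps)); last exact: GsumClass.
move=> F0; elim=> {p f pp sf F0} [p f pp sf|F G _ [sF rF dF] _ [sG rG dG]]; split.
- exact: scont_gsum.
- by move=> N; have [C _ gC] := gsum_bound N pp sf; exists C => x; exact: gC.
- move=> i; eexists; last by move=> x; exact: sderiv_gsum.
  apply: GsumClassD; apply: GsumClass => //.
  + by apply: polyfunM => //; exact: polyfun_freq.
  + exact: schwartz_cscale.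
  + exact: schwartz_partials.
- by move=> u p up; apply: cvgD; [exact: sF up|exact: sG up].
- exact: rapidD.
- move=> i; have [F' QF' dF'] := dF i; have [G' QG' dG'] := dG i.
  exists (fun x => F' x + G' x); first exact: GsumClassD.
  by move=> x; apply: sderivD.
Qed.

End plane_waves.

(** * Twisted products with Gaussian packets *)

Section twisted_product.
Context {R : realType} {n : nat} {A : cstarAlgType R}.
Variables (J : 'M[R]_n) (zeta : 'rV[R]_n) (a : A).
Implicit Types (f : 'rV[R]_n -> A) (x xi eta theta : 'rV[R]_n).
Local Notation c := (integralRn (@gauss R n)).
Local Notation kap := (Num.sqrt (2 * pi) ^- n : R).
Local Notation one := (fun=> 1 : R).

Definition gpacket (eps : R) : 'rV[R]_n -> A :=
  heisenberg 0 zeta (fun x => gauss (eps *: x) *: a).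

Lemma schwartz_gpacket eps : 0 < eps -> schwartz (gpacket eps).
Proof. by move=> e0; apply: schwartz_heisenberg; exact: schwartz_gauss. Qed.

(* The Gaussian in the second factor is a superposition of plane waves, which *)
(* turns the twisted product into a superposition of right multiplications by *)
(* plane waves once the transform of f is inverted.                           *)
Lemma twist_gpacket eps f x : 0 < eps <= 1 -> schwartz f ->
  twist J f (gpacket eps) x = (kap ^+ 2 * c) *: gsum J zeta a eps one f x.
Proof.
move=> /andP[e0 e1] sf; have sg := schwartz_gpacket e0.
have c0 : c != 0 by rewrite gt_eqF// integral_gauss_gt0.
have [sw [C wC]] := nice_waveT sf; have C0 := bound_ge0 wC.
have [M M0 gM] := @gauss_bound R n.
pose Y xi := x + xi *m J^T.
(* The integrand in both variables: integrating over eta rebuilds the packet at Y xi ([E1]),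
   integrating over xi inverts the transform of f at x + theta J ([E2]). *)
pose H xi eta := cexp (dot x xi + dot (freq zeta eps eta) (Y xi)) *c:
  (gauss eta *: (wave f xi *a a)).
have Y_cvg (u : nat -> 'rV[R]_n) u0 : u k @[k --> \oo] --> u0 ->
    Y (u k) @[k --> \oo] --> Y u0.
  by move=> hu; apply: cvgD; [exact: cvg_cst|exact: scont_mulmx hu].
have jH : jcont H.
  move=> u w u0 w0 hu hw; apply: jcont_cexp.
    apply: cvgD; first by apply: jcont_dot => //; exact: cvg_cst.
    by apply: jcont_dot; [apply: cvg_freq => //; exact: cvg_cst|exact: Y_cvg].
  apply: cvgZ; first exact: scont_gauss hw.
  by apply: jcont_amul; [exact: sw hu|exact: cvg_cst].
have HC xi eta : `|H xi eta| <= (M * (C * `|a|)) * wt xi * wt eta.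
  rewrite norm_cexp_scale normrZ gtr0_norm ?gauss_gt0//.
  have h : `|wave f xi *a a| <= C * wt xi * `|a|.
    by apply: le_trans (norm_amul _ _) _; rewrite ler_wpM2r.
  apply: le_trans (ler_pM (ltW (gauss_gt0 _)) (normr_ge0 _) (gM eta) h) _.
  by rewrite le_eqVlt; apply/orP; left; apply/eqP; ring.
have E1 xi : integralRn (H xi) =
    c *: (cexp (dot x xi) *c: (wave f xi *a gpacket eps (Y xi))).
  have -> : H xi = fun eta => cexp (dot x xi + dot zeta (Y xi)) *c:
      (cexp (dot (eps *: Y xi) eta) *c: (gauss eta *: (wave f xi *a a))).
    apply/funext => eta; rewrite /H cscaleA -cexpD; congr (cexp _ *c: _).
    by rewrite /freq dotDl -addrA !dotZl [dot eta _]dotC.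
  rewrite integral_cscale; last exact: nice_gwave.
  rewrite -[X in _ *c: X]/(gwave (wave f xi *a a) (eps *: Y xi)) gwaveE integral_gaussZ.
  rewrite /gpacket /heisenberg subr0 cscaleAr amul_realZr cscaleA -cexpD.
  by rewrite -!cscalerZ; congr (_ *c: _); rewrite !scalerA mulrC.
have E2 eta : integralRn (H ^~ eta) = c ^+ 2 *: gterm J zeta a eps one f x eta.
  set th := freq zeta eps eta.
  have nxw : nice (fun xi => cexp (dot (x + th *m J) xi) *c: wave f xi).
    by apply: nice_cexp; [exact: scont_dotr|exact: nice_waveT].
  have -> : H ^~ eta = fun xi => (cexp (dot th x) *c: (gauss eta *:
      ((cexp (dot (x + th *m J) xi) *c: wave f xi) *a a))).
    apply/funext => xi; rewrite /H cscaleAl -[gauss eta *: (cexp _ *c: _)]cscalerZ cscaleA -cexpD.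
    congr (cexp _ *c: _).
    by rewrite -/th /Y dotDr dotDl dot_mulmx addrCA addrA.
  have L := @integral_linear _ _ n A (fun v => cexp (dot th x) *c: (gauss eta *: (v *a a)))
    (gauss eta * `|a|) _ _ _ _ nxw.
  rewrite L ?fourier_inversion//.
  - by rewrite /gterm rwaveE mul1r amul_realZl scalerA mulrC -scalerA cscalerZ
    -/th cscaleAl cscalerZ.
  - by move=> u v; rewrite amulDl scalerDr cscaleDr.
  - by move=> r v; rewrite amul_realZl -!cscalerZ !scalerA [_ * r]mulrC.
  - move=> v; rewrite norm_cexp_scale normrZ gtr0_norm ?gauss_gt0// -mulrA.
    by rewrite ler_wpM2l ?(ltW (gauss_gt0 _))// mulrC norm_amul.
have nE1 : nice (fun xi => cexp (dot x xi) *c: (wave f xi *a gpacket eps (Y xi))).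
  split.
    move=> u u0 hu; apply: jcont_cexp; first exact: scont_dotr hu.
    by apply: jcont_amul; [exact: sw hu|apply: (schwartz_scont sg); exact: Y_cvg].
  exists (C * `|a|) => xi; rewrite norm_cexp_scale mulrAC.
  apply: le_trans (norm_amul _ _) _; apply: ler_pM => //.
  rewrite norm_cexp_scale normrZ gtr0_norm ?gauss_gt0//.
  by rewrite ler_piMl// gauss_le1.
have F := integralRn_fubini jH HC.
have nG : nice (gterm J zeta a eps one f x).
  by apply: nice_gterm => //; [rewrite (ltW e0)|exact: polyfun_cst].
rewrite /twist /dbar.
have -> : (fun xi => cexp (dot x xi) *c: (fourier f xi *a gpacket eps (x + xi *m J^T))) =
   fun xi => kap *: (cexp (dot x xi) *c: (wave f xi *a gpacket eps (Y xi))).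
  by apply/funext => xi; rewrite fourierE amul_realZl cscalerZ.
rewrite integralZ// scalerA -expr2 -scalerA; congr (_ *: _).
(* [E1] carries the factor c and [E2] the factor c^2, so cancelling c leaves the single c of the
   statement. *)
apply: (scalerI c0); rewrite -integralZ//
  -[LHS](_ : integralRn (fun xi => integralRn (H xi)) = _); last first.
  by congr integralRn; apply/funext => xi; rewrite E1.
rewrite F (_ : (fun y => _) = fun eta => c ^+ 2 *: gterm J zeta a eps one f x eta); last first.
  by apply/funext => eta; rewrite E2.
by rewrite integralZ// scalerA expr2.
Qed.

End twisted_product.

(** * Operators on the completion and the Heisenberg operators *)

Section completion.
Context {R : realType} {n : nat} {A : cstarAlgType R} {E : hilbertModType A}.
Variable iota : ('rV[R]_n -> A) -> E.
Hypothesis SC : schwartz_completion iota.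
Implicit Types (f g : 'rV[R]_n -> A) (u v w : E).

Lemma iota_scale (r : R) f : schwartz f -> iota (fun x => r *: f x) = r *: iota f.
Proof.
move=> sf; rewrite -cscale_real -(iotaZ SC)//; congr iota.
by apply/funext => x; rewrite cscale_real.
Qed.

Lemma iotaB f g : schwartz f -> schwartz g ->
  iota (fun x => f x - g x) = iota f - iota g.
Proof.
move=> sf sg; rewrite -[- iota g]scaleN1r -iota_scale// -(Defs.iotaD SC)//.
  by congr iota; apply/funext => x; rewrite scaleN1r.
exact: schwartz_scale.
Qed.

Lemma dense_seq (S : set E) u : dense S ->
  exists s : nat -> E, (forall k, S (s k)) /\ s k @[k --> \oo] --> u.
Proof.
move=> dS; have /choice[s sP] k : exists w, S w /\ `|u - w| < k.+1%:R^-1.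
  have k0 : 0 < k.+1%:R^-1 :> R by [].
  have [|w [uw Sw]] := dS (ball u k.+1%:R^-1) _ (ball_open _ _).
    by exists u; exact: (ballxx u k0).
  by exists w; split=> //; move: uw; rewrite -ball_normE.
exists s; split; first by move=> k; have [] := sP k.
apply/cvgrPdist_lt => e e0; have := harmonic_nbhs e0.
by apply: filterS => k; apply: lt_trans; have [] := sP k.
Qed.

Lemma schwartz_seq u : exists f_ : nat -> 'rV[R]_n -> A,
  (forall k, schwartz (f_ k)) /\ iota (f_ k) @[k --> \oo] --> u.
Proof.
have [s [Ss su]] := dense_seq u (iota_dense SC).
have /choice[f_ fP] k : exists f, schwartz f /\ iota f = s k.
  by have [f sf fE] := Ss k; exists f.
exists f_; split=> [k|]; first by have [] := fP k.
by under eq_fun do rewrite (fP _).2.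
Qed.

Lemma scont_bop (W : bop E) : scont W.
Proof. by apply/scontP; exact: bop_cts. Qed.

Lemma bop_ext (W W' : bop E) : (forall u, W u = W' u) -> W = W'.
Proof. by move=> h; apply/val_inj/funext. Qed.

Lemma bop_eq_on_schwartz (W W' : bop E) :
  (forall f, schwartz f -> W (iota f) = W' (iota f)) -> W = W'.
Proof.
move=> h; apply: bop_ext => u; have [f_ [sf fu]] := schwartz_seq u.
exact: (cvgn_eq (fun k => h _ (sf k)) (scont_bop fu) (scont_bop fu)).
Qed.

Lemma bop_real (W : bop E) : (forall u v, W (u + v) = W u + W v) /\
  (forall (r : R) u, W (r *: u) = r *: W u).
Proof.
have W0 : W 0 = 0.
  by have := bop_linear W (-1) 0 0; rewrite scaler0 addr0 scaleN1r addNr.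
split=> [u v|r u]; first by have := bop_linear W 1 u v; rewrite !scale1r.
by have := bop_linear W r u 0; rewrite W0 !addr0.
Qed.

Lemma bopB (W : bop E) u v : W (u - v) = W u - W v.
Proof.
have [WD WZ] := bop_real W; rewrite WD; congr (_ + _).
by rewrite -scaleN1r WZ scaleN1r.
Qed.

Definition schwartz_bounded (P : ('rV[R]_n -> A) -> 'rV[R]_n -> A) (K : R) :=
  [/\ forall f, schwartz f -> schwartz (P f),
      forall f g, schwartz f -> schwartz g ->
        P (fun x => f x + g x) = fun x => P f x + P g x,
      forall (z : R[i]) f, schwartz f -> P (fun x => z *c: f x) = fun x => z *c: P f x &
      forall f, schwartz f -> `|iota (P f)| <= K * `|iota f|].

(** Extension of a bounded linear map from a dense subspace to a complete space; it shows that
    [extension iota P] is a true extension and not the default value 0. *)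
Lemma extensionP P (K : R) : schwartz_bounded P K ->
  extends iota P (extension iota P) /\ forall u, `|extension iota P u| <= K * `|u|.
Proof.
move=> [Ps PD PZ PK].
have K'0 : 0 <= `|K| by [].
have PK' f : schwartz f -> `|iota (P f)| <= `|K| * `|iota f|.
  by move=> sf; apply: le_trans (PK f sf) _; rewrite ler_wpM2r// ler_norm.
have PB f g : schwartz f -> schwartz g -> P (fun x => f x - g x) = fun x => P f x - P g x.
  move=> sf sg; have -> : (fun x => f x - g x) = fun x => f x + (- 1)%:C *c: g x.
    by apply/funext => x; rewrite cscale_real scaleN1r.
  rewrite PD//; last exact: schwartz_cscale.
  by rewrite PZ//; apply/funext => x; rewrite cscale_real scaleN1r.
(* The graph of the extension: existence of w comes from the Cauchy criterion, uniqueness and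
   linearity from comparing approximating sequences. *)
pose lim_of u w := exists f_ : nat -> 'rV[R]_n -> A,
  [/\ forall k, schwartz (f_ k), iota (f_ k) @[k --> \oo] --> u &
      iota (P (f_ k)) @[k --> \oo] --> w].
have dist f g : schwartz f -> schwartz g ->
    `|iota (P f) - iota (P g)| <= `|K| * `|iota f - iota g|.
  move=> sf sg; rewrite -(iotaB sf sg) -(iotaB (Ps _ sf) (Ps _ sg)) -PB//.
  by apply: PK'; exact: schwartzB.
have lim_ex u : exists w, lim_of u w.
  have [f_ [sf fu]] := schwartz_seq u.
  have /cauchy_cvg/cvg_ex[w fw] : cauchy (iota (P (f_ k)) @[k --> \oo]).
    have cu : cauchy (iota (f_ k) @[k --> \oo]) by apply: cvg_cauchy; apply/cvg_ex; exists u.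
    apply/cauchy_ballP => e e0.
    have K1 : 0 < `|K| + 1 by rewrite ltr_wpDl.
    have e1 : 0 < e / 2 / (`|K| + 1) by rewrite !divr_gt0.
    have /cvgrPdist_lt/(_ _ e1) hu := fu.
    pose S := (fun k => iota (P (f_ k))) @` [set k | `|u - iota (f_ k)| < e / 2 / (`|K| + 1)].
    have FS : (iota (P (f_ k)) @[k --> \oo]) S by apply: filterS hu => k kk; exists k.
    exists (S, S) => // -[_ _] [[k kk <-] [m mm <-]] /=.
    rewrite -ball_normE/=; apply: le_lt_trans (dist _ _ (sf k) (sf m)) _.
    have h : `|iota (f_ k) - iota (f_ m)| < e / (`|K| + 1).
      have -> : iota (f_ k) - iota (f_ m) = (u - iota (f_ m)) - (u - iota (f_ k)).
        by rewrite opprB [RHS]addrC addrA subrK.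
      apply: le_lt_trans (ler_normB _ _) _; rewrite [e]splitr mulrDl.
      by apply: ltrD.
    apply: (@le_lt_trans _ _ ((`|K| + 1) * `|iota (f_ k) - iota (f_ m)|)).
      by rewrite ler_wpM2r// lerDl.
    by rewrite mulrC -ltr_pdivlMr.
  by exists w, f_.
pose W u := xget 0 (lim_of u).
have WP u : lim_of u (W u) by apply: xgetPex.
have lim_uniq u w w' : lim_of u w -> lim_of u w' -> w = w'.
  move=> [f_ [sf fu fw]] [g_ [sg gu gw]].
  apply/eqP; rewrite -subr_eq0 -normr_le0.
  have h1 : `|iota (P (f_ k)) - iota (P (g_ k))| @[k --> \oo] --> `|w - w'|.
    by apply: cvg_norm; exact: cvgB.
  have h2 : `|K| * `|iota (f_ k) - iota (g_ k)| @[k --> \oo] --> (0 : R).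
    rewrite -(mulr0 `|K|) -(normr0 E) -(subrr u); apply: cvgMl_tmp.
    by apply: cvg_norm; exact: cvgB.
  by apply: ler_cvg_to h1 h2 _; apply: nearW => k; exact: dist.
have WE f : schwartz f -> W (iota f) = iota (P f).
  move=> sf; apply: lim_uniq (WP _) _.
  by exists (fun=> f); split=> //; exact: cvg_cst.
have Wlin z u v : W (z *c: u + v) = z *c: W u + W v.
  have [f_ [sf fu fw]] := WP u; have [g_ [sg gu gw]] := WP v.
  apply: lim_uniq (WP _) _; exists (fun k x => z *c: f_ k x + g_ k x); split.
  - by move=> k; apply: schwartzD => //; exact: schwartz_cscale.
  - have e k : iota (fun x => z *c: f_ k x + g_ k x) = z *c: iota (f_ k) + iota (g_ k).
      by rewrite (Defs.iotaD SC)// ?(iotaZ SC)//; exact: schwartz_cscale.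
    by apply: (cvgn_ext e); apply: cvgD => //; exact: scont_cscale.
  - have e k : iota (P (fun x => z *c: f_ k x + g_ k x)) = z *c: iota (P (f_ k)) + iota (P (g_ k)).
      rewrite PD//; last exact: schwartz_cscale.
      rewrite PZ// (Defs.iotaD SC)//; [|by apply: schwartz_cscale; exact: Ps|exact: Ps].
      by rewrite (iotaZ SC)//; exact: Ps.
    by apply: (cvgn_ext e); apply: cvgD => //; exact: scont_cscale.
have Wb u : `|W u| <= K * `|u|.
  have [f_ [sf fu fw]] := WP u.
  have h1 : `|iota (P (f_ k))| @[k --> \oo] --> `|W u| by exact: cvg_norm.
  have h2 : K * `|iota (f_ k)| @[k --> \oo] --> K * `|u|.
    by apply: cvgMl_tmp; exact: cvg_norm.
  by apply: ler_cvg_to h1 h2 _; apply: nearW => k; exact: PK.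
have Wc : continuous W.
  apply/scontP; apply: (@bounded_scont _ _ _ _ K) => // u v.
  have := Wlin (- 1)%:C v u; rewrite !cscale_real !scaleN1r addrC => ->.
  by rewrite addrC.
have iW : is_bop W by apply/asboolP; split.
have ext : extends iota P (Bop iW) by move=> f sf; split; [exact: Ps|exact: WE].
have ext' : extends iota P (extension iota P).
  by apply: (@xgetPex _ 0 [set W | extends iota P W]); exists (Bop iW).
split=> // u; rewrite (_ : extension iota P = Bop iW) ?Wb//.
by apply: bop_eq_on_schwartz => f sf; rewrite (ext' f sf).2 (ext f sf).2.
Qed.

Lemma nice_inner f g : schwartz f -> schwartz g -> nice (fun x => star (f x) *a g x).
Proof.
move=> sf sg; have [B fB] := rapid_bounded (schwartz_rapid sf).
apply: (nice_le (f := g) (C := B)) (nice_schwartz sg) _ => [u p up|x].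
  apply: jcont_amul; last exact: schwartz_scont sg _ _ up.
  by apply: scont_star; exact: schwartz_scont sf _ _ up.
apply: le_trans (norm_amul _ _) _.
by rewrite norm_star ler_wpM2r.
Qed.

(** The phases cancel against their conjugates, and the integral is translation invariant. *)
Lemma inner_heisenberg z zeta f g : schwartz f -> schwartz g ->
  inner (iota (heisenberg z zeta f)) (iota (heisenberg z zeta g)) =
  inner (iota f) (iota g).
Proof.
move=> sf sg; rewrite !(iota_inner SC)//; [|exact: schwartz_heisenberg..].
have [sF [C FC]] := nice_inner sf sg.
have := integralRn_affine (- z) ltr01 sF FC; rewrite expr1n invr1 scale1r; apply: etrans.
congr integralRn; apply/funext => x; rewrite /heisenberg scale1r addrC.
rewrite starZ cscaleAl cscaleAr cscaleA conjc_cexp -cexpD addNr cexp0.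
by rewrite cscale1.
Qed.

Lemma norm_heisenberg z zeta f : schwartz f ->
  `|iota (heisenberg z zeta f)| = `|iota f|.
Proof.
move=> sf; apply/eqP; rewrite -(@eqrXn2 _ 2)//.
by rewrite !norm_inner inner_heisenberg.
Qed.

Lemma heisenberg_bounded z zeta : schwartz_bounded (heisenberg z zeta) 1.
Proof.
split=> [f|f g sf sg|w f sf|f sf].
- exact: schwartz_heisenberg.
- by apply/funext => x; rewrite /heisenberg cscaleDr.
- by apply/funext => x; rewrite /heisenberg !cscaleA mulrC.
- by rewrite norm_heisenberg// mul1r.
Qed.

Lemma EopE z zeta f : schwartz f ->
  Eop iota z zeta (iota f) = iota (heisenberg z zeta f).
Proof.
by move=> sf; have [ext _] := extensionP (heisenberg_bounded z zeta); have [] := ext f sf.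
Qed.

Lemma norm_Eop z zeta u : `|Eop iota z zeta u| <= `|u|.
Proof.
by have [_ h] := extensionP (heisenberg_bounded z zeta); have := h u; rewrite mul1r.
Qed.

(** The Weyl form of the commutation relations: a composition is again a Heisenberg operator up to a
    scalar phase. *)
Lemma heisenberg_comp z zeta z' zeta' f :
  heisenberg z zeta (heisenberg z' zeta' f) =
  fun x => cexp (- dot zeta' z) *c: heisenberg (z + z') (zeta + zeta') f x.
Proof.
apply/funext => x; rewrite /heisenberg !cscaleA -!cexpD opprD addrA; congr (cexp _ *c: _).
by rewrite dotDl dotDr [dot zeta' (- z)]dotC dotNl [dot z _]dotC; ring.
Qed.

Lemma heisenberg0 f : heisenberg 0 0 f = f.
Proof. by apply/funext => x; rewrite /heisenberg dot0l cexp0 cscale1 subr0. Qed.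

(** The inverse is the operator for (- z, - zeta) corrected by the phase exp(- i zeta.z). It ensures
    that [binv] does not take its default value 0 here. *)
Lemma Eop_invertible z zeta : exists S : bop E,
  bcomp S (Eop iota z zeta) = bid /\ bcomp (Eop iota z zeta) S = bid.
Proof.
have P1 := heisenberg_bounded z zeta.
pose P f := fun x => cexp (- dot zeta z) *c: heisenberg (- z) (- zeta) f x.
have Pb : schwartz_bounded P 1.
  have [h1 h2 h3 h4] := heisenberg_bounded (- z) (- zeta); split=> [f sf|f g sf sg|w f sf|f sf].
  - by apply: schwartz_cscale; exact: h1.
  - by rewrite /P h2//; apply/funext => x; rewrite cscaleDr.
  - by rewrite /P h3//; apply/funext => x; rewrite !cscaleA [w * _]mulrC.
  - by rewrite (iotaZ SC) ?norm_cexp_scale; [exact: h4|exact: h1].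
have [extP _] := extensionP Pb.
exists (extension iota P); split; apply: bop_eq_on_schwartz => f sf /=.
  have sh := schwartz_heisenberg z zeta sf.
  rewrite EopE// (extP _ sh).2; congr iota; rewrite /P heisenberg_comp.
  rewrite !addNr heisenberg0; apply/funext => x; rewrite cscaleA -cexpD.
  by rewrite [dot zeta (- z)]dotC dotNl [dot z _]dotC opprK addNr cexp0 cscale1.
rewrite (extP _ sf).2 EopE; last by have [] := extP _ sf.
congr iota; apply/funext => x; rewrite /P.
have [_ _ h _] := P1; rewrite h; last by apply: schwartz_heisenberg.
rewrite heisenberg_comp !subrr heisenberg0 cscaleA -cexpD dotNl opprK addNr cexp0.
by rewrite cscale1.
Qed.

Lemma binv_Eop z zeta :
  bcomp (binv (Eop iota z zeta)) (Eop iota z zeta) = bid /\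
  bcomp (Eop iota z zeta) (binv (Eop iota z zeta)) = bid.
Proof.
exact: (@xgetPex _ 0 [set S | bcomp S (Eop iota z zeta) = bid /\
  bcomp (Eop iota z zeta) S = bid] (Eop_invertible z zeta)).
Qed.

End completion.

(** * From packets to plane waves: uniform bounds and strong limits *)

Section gaussian_packets.
Context {R : realType} {n : nat} {A : cstarAlgType R} {E : hilbertModType A}.
Variable iota : ('rV[R]_n -> A) -> E.
Hypothesis SC : schwartz_completion iota.
Variables (J : 'M[R]_n) (zeta : 'rV[R]_n) (a : A).
Implicit Types (f F : 'rV[R]_n -> A) (x eta theta : 'rV[R]_n) (u v : E).
Local Notation c := (integralRn (@gauss R n)).
Local Notation kap := (Num.sqrt (2 * pi) ^- n : R).
Local Notation one := (fun=> 1 : R).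
Local Notation gsumJ := (gsum J zeta a).
Local Notation gtermJ := (gterm J zeta a).

Let one_poly : polyfun (one : 'rV[R]_n -> R). Proof. exact: polyfun_cst. Qed.

(** By Fubini the pairing of F with the average is the Gaussian average of the pairings of F with
    the functions [rwave], multiplied by a. These have the norm of f, so K is independent of eps;
    its factor 4 comes from [norm_inner_le]. *)
Lemma inner_gsum : exists2 K, 0 <= K & forall eps f F, 0 <= eps <= 1 ->
  schwartz f -> schwartz F ->
  `|inner (iota F) (iota (gsumJ eps one f))| <= K * (`|iota F| * `|iota f|).
Proof.
have [M M0 gM] := @gauss_bound R n.
exists (4 * `|a| * M * pi ^+ n); first by rewrite !mulr_ge0// exprn_ge0// pi_ge0.
move=> eps f F e01 sf sF.
have sG := schwartz_gsum J zeta a e01 one_poly sf.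
have [C C0 gC] := gterm_bound J zeta a 0 one_poly sf.
have [cF [B FB]] := nice_schwartz sF; have B0 := bound_ge0 FB.
pose H x eta := star (F x) *a gtermJ eps one f x eta.
have jH : jcont H.
  move=> u w u0 w0 hu hw; apply: jcont_amul; first by apply: scont_star; exact: cF hu.
  by apply: (@jcont_gterm _ _ _ J zeta a eps one f one_poly (schwartz_scont sf)).
have HC x eta : `|H x eta| <= B * C * wt x * wt eta.
  apply: le_trans (norm_amul _ _) _; rewrite norm_star [B * C]mulrC -[C * B * _]mulrA.
  rewrite [C * _]mulrC -[leRHS]mulrA.
  have := gC eps x eta e01; rewrite expr0 mul1r => h.
  by apply: ler_pM.
have E2 eta : integralRn (H ^~ eta) =
    gauss eta *: (inner (iota F) (iota (rwave J (freq zeta eps eta) f)) *a a).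
  have sr := schwartz_heisenberg (- (freq zeta eps eta *m J)) (freq zeta eps eta) sf.
  have [nr1 [D nrD]] := nice_inner sF sr.
  have nr : nice (fun x => star (F x) *a rwave J (freq zeta eps eta) f x *a a).
    apply: (nice_le (C := `|a|) _ (nice_inner sF sr)) => [u u0 hu|x].
      by apply: jcont_amul; [exact: nr1 hu|exact: cvg_cst].
    by rewrite mulrC norm_amul.
  rewrite (iota_inner SC)// /schwartz_inner -integral_amulr; last exact: nice_inner.
  rewrite -integralZ//; congr integralRn; apply/funext => x.
  by rewrite /H /gterm mul1r amul_realZr amulA.
have cE : scont (fun eta => integralRn (H ^~ eta)).
  move=> u eta hu; apply: (integralRn_dominated (C := B * C)) => [k|||].
  - exact: jcont_l.
  - exact: jcont_l.
  - move=> k x; apply: le_trans (HC _ _) _.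
    by rewrite ler_piMr ?wt_le1// !mulr_ge0// wt_ge0.
  - by move=> x; exact: (@jcont_r _ _ _ _ _ x jH).
rewrite (iota_inner SC)// /schwartz_inner.
rewrite (_ : (fun x => _) = fun x => integralRn (H x)); last first.
  by apply/funext => x; rewrite /H integral_amull//; exact: nice_gterm.
rewrite (integralRn_fubini jH HC).
rewrite [leRHS](_ : _ = 4 * `|a| * M * (`|iota F| * `|iota f|) * pi ^+ n); last by ring.
apply: integralRn_norm_le => // eta; rewrite E2 normrZ gtr0_norm ?gauss_gt0//.
apply: (@le_trans _ _ (M * wt eta * (4 * (`|iota F| * `|iota f|) * `|a|))); last first.
  by rewrite le_eqVlt; apply/orP; left; apply/eqP; ring.
apply: ler_pM => //; first exact: ltW (gauss_gt0 _).
apply: le_trans (norm_amul _ _) _; rewrite ler_wpM2r//.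
by apply: le_trans (norm_inner_le _ _) _; rewrite (norm_heisenberg SC).
Qed.

(** Take for F in [inner_gsum] the average itself and divide by its norm. *)
Lemma norm_gsum : exists2 K, 0 <= K & forall eps f, 0 <= eps <= 1 ->
  schwartz f -> `|iota (gsumJ eps one f)| <= K * `|iota f|.
Proof.
have [K K0 KP] := inner_gsum; exists K => // eps f e01 sf.
have sG := schwartz_gsum J zeta a e01 one_poly sf.
have := KP _ _ _ e01 sf sG; rewrite -norm_inner expr2 mulrCA.
have [->|G0] := eqVneq `|iota (gsumJ eps one f)| 0; first by rewrite mulr_ge0.
by rewrite ler_pM2l// lt_neqAle eq_sym G0 normr_ge0.
Qed.

Lemma twist_gpacket_bounded : exists2 K, 0 <= K & forall eps, 0 < eps <= 1 ->
  schwartz_bounded iota (fun f => twist J f (gpacket zeta a eps)) K.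
Proof.
have [K K0 KP] := norm_gsum.
have k0 : 0 <= kap ^+ 2 * c.
  by rewrite mulr_ge0 ?sqr_ge0// ltW// integral_gauss_gt0.
exists (kap ^+ 2 * c * K); first exact: mulr_ge0.
move=> eps e01; have e01' : 0 <= eps <= 1 by case/andP: e01 => /ltW -> ->.
have twE f : schwartz f -> twist J f (gpacket zeta a eps) =
    fun x => (kap ^+ 2 * c) *: gsumJ eps one f x.
  by move=> sf; apply/funext => x; rewrite twist_gpacket.
have sG f : schwartz f -> schwartz (gsumJ eps one f).
  by move=> sf; exact: schwartz_gsum.
have nG f x : schwartz f -> nice (gtermJ eps one f x) by move=> sf; exact: nice_gterm.
split=> [f sf|f g sf sg|z f sf|f sf].
- by rewrite twE//; apply: schwartz_scale; exact: sG.
- rewrite !twE//; last exact: schwartzD.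
  apply/funext => x; rewrite -scalerDr; congr (_ *: _).
  rewrite /gsum -integralD; [|exact: nG..].
  congr integralRn; apply/funext => eta.
  by rewrite /gterm !rwaveE cscaleDr amulDl scalerDr.
- rewrite !twE//; last exact: schwartz_cscale.
  apply/funext => x; rewrite cscalerZ; congr (_ *: _).
  rewrite /gsum -integral_cscale; last exact: nG.
  congr integralRn; apply/funext => eta.
  by rewrite /gterm !rwaveE cscaleA [cexp _ * _]mulrC -cscaleA cscaleAl cscalerZ.
- rewrite twE// (iota_scale SC); last exact: sG.
  by rewrite normrZ ger0_norm// -mulrA ler_wpM2l// KP.
Qed.

(** The averages converge pointwise to the one at eps = 0 under a multiple of [wt] uniform in eps,
    so the inner squares of the differences tend to 0. *)
Lemma cvg_gsum f (eps : nat -> R) : schwartz f -> (forall k, 0 <= eps k <= 1) ->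
  eps k @[k --> \oo] --> 0 ->
  iota (gsumJ (eps k) one f) @[k --> \oo] -->
    c *: ract (Eop iota (- (zeta *m J)) zeta (iota f)) a.
Proof.
move=> sf e01 e0; have cf := schwartz_scont sf.
have e00 : 0 <= (0 : R) <= 1 by rewrite lexx ler01.
have sG e (h : 0 <= e <= 1) := schwartz_gsum J zeta a h one_poly sf.
have sr : schwartz (rwave J zeta f) by exact: schwartz_heisenberg.
(* At eps = 0 the frequency is zeta for every eta, and the Gaussian integrates out to c. *)
have -> : c *: ract (Eop iota (- (zeta *m J)) zeta (iota f)) a = iota (gsumJ 0 one f).
  rewrite (EopE SC)// -(iotaM SC)// -(iota_scale SC); last exact: schwartz_amulr.
  congr iota; apply/funext => x; rewrite /gsum -integral_gaussZ.
  by congr integralRn; apply/funext => eta; rewrite /gterm /freq scale0r addr0 mul1r.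
(* Decay of order 2 n is what [wt_nrm_ge1] converts into domination by [wt]. *)
have [C C0 gC] := gsum_bound J zeta a (2 * n) one_poly sf.
pose D k x := gsumJ (eps k) one f x - gsumJ 0 one f x.
have sD k : schwartz (D k) by apply: schwartzB; exact: sG.
have gw e x : 0 <= e <= 1 -> `|gsumJ e one f x| <= C * wt x.
  move=> h; apply: (@le_trans _ _ (wt x * (1 + `|x|) ^+ (2 * n) * `|gsumJ e one f x|)).
    by rewrite ler_peMl// wt_nrm_ge1.
  by rewrite -mulrA mulrC ler_wpM2r ?wt_ge0// gC.
have Dw k x : `|D k x| <= 2 * C * wt x.
  apply: le_trans (ler_normB _ _) _; rewrite -mulrA mulr2n mulrDl mul1r.
  by apply: lerD; exact: gw.
have D0 x : D k x @[k --> \oo] --> (0 : A).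
  rewrite -(subrr (gsumJ 0 one f x)); apply: cvgB; last exact: cvg_cst.
  have [B B0 gB] := gterm_bound J zeta a 0 one_poly sf.
  apply: (integralRn_dominated (C := B)).
  - by move=> k; have [] := nice_gterm J zeta a x (e01 k) one_poly sf.
  - by have [] := nice_gterm J zeta a x e00 one_poly sf.
  - by move=> k eta; have := gB _ x eta (e01 k); rewrite expr0 mul1r.
  - move=> eta; apply: cvgZl_tmp; apply: jcont_amul; last exact: cvg_cst.
    apply: (@jcont_rwave _ _ _ J f cf _ (fun=> x)); last exact: cvg_cst.
    by apply: cvg_freq => //; exact: cvg_cst.
have C2 : 0 <= 2 * C by rewrite mulr_ge0.
have I0 : `|inner (iota (D k)) (iota (D k))| @[k --> \oo] --> (0 : R).
  rewrite -(normr0 A); apply: cvg_norm.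
  rewrite -(_ : integralRn (fun _ : 'rV[R]_n => (0 : A)) = 0); last first.
    have n0 : nice (fun _ : 'rV[R]_n => (0 : A)).
      by split; [move=> u u0 _; exact: cvg_cst|exists 0 => x; rewrite normr0 mul0r].
    by have := integralZ 0 n0; rewrite [RHS]scale0r scale0r.
  have e k : inner (iota (D k)) (iota (D k)) = integralRn (fun x => star (D k x) *a D k x).
    by rewrite (iota_inner SC).
  apply: (cvgn_ext e); apply: (integralRn_dominated (C := 2 * C * (2 * C))).
  - by move=> k; have [] := nice_inner (sD k) (sD k).
  - by move=> u u0 _; exact: cvg_cst.
  - move=> k x; apply: le_trans (norm_amul _ _) _; rewrite norm_star -[leRHS]mulrA.
    by apply: ler_pM => //; apply: le_trans (Dw k x) _; rewrite ler_piMr// wt_le1.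
  - move=> x; rewrite [X in _ --> X](_ : _ = star 0 *a (0 : A)); last first.
      by have := amul_realZr 0 (star 0) (0 : A); rewrite !scale0r.
    by apply: jcont_amul => //; exact: scont_star.
have h : `|iota (D k)| @[k --> \oo] --> (0 : R).
  rewrite -(sqrtr0 R).
  have e k : `|iota (D k)| = Num.sqrt `|inner (iota (D k)) (iota (D k))|.
    by rewrite -norm_inner sqrtr_sqr normr_id.
  by apply: (cvgn_ext e); apply: continuous_cvg => //; exact: sqrt_continuous.
apply/cvgrPdist_lt => d d0; have /cvgrPdist_lt/(_ _ d0) := h.
apply: filterS => k; rewrite sub0r normrN normr_id /D (iotaB SC); [|exact: sG..].
by rewrite distrC.
Qed.

(** The three-epsilon argument: uniformly bounded operators that converge on a dense set converge
    everywhere. *)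
Lemma strong_cvg (W : nat -> bop E) (L : E -> E) (K : R) : 0 <= K ->
  (forall k u, `|W k u| <= K * `|u|) -> (forall u v, L (u - v) = L u - L v) ->
  (forall u, `|L u| <= K * `|u|) ->
  (forall f, schwartz f -> W k (iota f) @[k --> \oo] --> L (iota f)) ->
  forall u, W k u @[k --> \oo] --> L u.
Proof.
move=> K0 WK LB LK WL u; apply/cvgrPdist_lt => e e0.
have [f_ [sf fu]] := schwartz_seq SC u.
have d0 : 0 < e / 3 / (K + 1) by rewrite !divr_gt0// ltr_wpDl.
have [f [sf' fd]] : exists f, schwartz f /\ `|u - iota f| < e / 3 / (K + 1).
  have /cvgrPdist_lt/(_ _ d0)[N _ /(_ N (leqnn N)) h] := fu.
  by exists (f_ N).
have Kd : K * `|u - iota f| < e / 3.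
  move: fd; rewrite ltr_pdivlMr ?ltr_wpDl// => h.
  by apply: le_lt_trans h; rewrite mulrDr mulr1 mulrC lerDl.
have e3 : 0 < e / 3 by rewrite divr_gt0.
have /cvgrPdist_lt/(_ _ e3) := WL f sf'; apply: filterS => k hk.
have -> : L u - W k u = L (u - iota f) + (L (iota f) - W k (iota f)) - W k (u - iota f).
  by rewrite LB bopB opprB !subrKA.
apply: le_lt_trans (ler_normB _ _) _.
have h1 := le_lt_trans (LK (u - iota f)) Kd.
have h2 := le_lt_trans (WK k (u - iota f)) Kd.
have h3 := ler_normD (L (u - iota f)) (L (iota f) - W k (iota f)).
by lra.
Qed.

Variable T : bop E.
Hypothesis T_twist : forall g : 'rV[R]_n -> A, schwartz g ->
  bcomp T (Rop iota J g) = bcomp (Rop iota J g) T.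

(** The operators R_g for the packets converge strongly to a positive multiple of v |-> (V v) a. T
    is continuous and commutes with each of them, hence with the limit, and the multiple is
    cancelled. *)
Lemma comm_ract_wave u :
  T (ract (Eop iota (- (zeta *m J)) zeta u) a) =
  ract (Eop iota (- (zeta *m J)) zeta (T u)) a.
Proof.
set V := Eop iota _ zeta.
have [K K0 KP] := twist_gpacket_bounded.
pose eps k : R := k.+1%:R^-1.
have eps0 k : 0 < eps k <= 1.
  by rewrite invr_gt0 ltr0Sn invf_le1// ler1n.
have eps0' k : 0 <= eps k <= 1 by case/andP: (eps0 k) => /ltW -> ->.
have eps_cvg : eps k @[k --> \oo] --> 0 by exact: cvg_harmonic.
pose W k := Rop iota J (gpacket zeta a (eps k)).
(* [twist_gpacket_bounded] makes each [Rop] a genuine extension, with the same bound K for all k. *)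
have WP k := extensionP SC (KP _ (eps0 k)).
have c0 : 0 < c := @integral_gauss_gt0 R n.
have kap0 : 0 < kap by rewrite invr_gt0 exprn_gt0// sqrtr_gt0 mulr_gt0// pi_gt0.
pose L v := (kap ^+ 2 * c * c) *: ract (V v) a.
have LB v w : L (v - w) = L v - L w by rewrite /L bopB ractBl scalerBr.
(* A common bound for all W k and for the limit L. *)
pose K' := K + kap ^+ 2 * c * c * `|a|.
have k0 : 0 < kap ^+ 2 * c * c by rewrite !mulr_gt0// exprn_gt0.
have WL v : W k v @[k --> \oo] --> L v.
  apply: (@strong_cvg W L K') => //.
  - by rewrite addr_ge0// mulr_ge0// ltW.
  - move=> k w; apply: le_trans ((WP k).2 w) _.
    by rewrite ler_wpM2r// lerDl mulr_ge0// ltW.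
  - move=> w; rewrite /L normrZ gtr0_norm// [leRHS]mulrDl.
    apply: (@le_trans _ _ (kap ^+ 2 * c * c * (`|w| * `|a|))).
      rewrite ler_wpM2l ?(ltW k0)//; apply: le_trans (norm_ract _ _) _.
      by rewrite ler_wpM2r// norm_Eop.
    by rewrite [`|w| * _]mulrC mulrA lerDr mulr_ge0.
  - move=> f sf; rewrite /L -scalerA.
    have e k : W k (iota f) = (kap ^+ 2 * c) *: iota (gsumJ (eps k) one f).
      rewrite ((WP k).1 f sf).2 -(iota_scale SC); last exact: schwartz_gsum.
      by congr iota; apply/funext => x; rewrite twist_gpacket.
    by apply: (cvgn_ext e); apply: cvgZl_tmp; exact: cvg_gsum.
have TW k : T (W k u) = W k (T u).
  have sg : schwartz (gpacket zeta a (eps k)).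
    by apply: schwartz_gpacket; case/andP: (eps0 k).
  by have := T_twist sg => /(congr1 (fun S : bop E => S u)).
have := cvgn_eq TW (scont_bop (WL u)) (WL (T u)).
by rewrite /L (bop_real T).2 => /scalerI; apply; rewrite gt_eqF.
Qed.

End gaussian_packets.

(** * Conjugation by Heisenberg operators reduces to translation *)

Section heisenberg_conjugates.
Context {R : realType} {n : nat} {A : cstarAlgType R} {E : hilbertModType A}.
Variable iota : ('rV[R]_n -> A) -> E.
Hypothesis SC : schwartz_completion iota.
Implicit Types (u v w : E) (z zeta : 'rV[R]_n).

Lemma inner_nondegenerate u v : (forall w, inner w u = inner w v) -> u = v.
Proof.
move=> h; apply/eqP; rewrite -subr_eq0; apply/eqP/inner_self_eq0.
by rewrite innerDr innerNr h subrr.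
Qed.

(** Against any w, moving T to its adjoint and back lets the right action of a come out of the inner
    product. *)
Lemma adjointable_ract (T : bop E) u (a : A) : adjointable T -> T (ract u a) = ract (T u) a.
Proof.
move=> [T' TT']; apply: inner_nondegenerate => w.
by rewrite -[LHS]star_inner TT' star_inner !innerMr -[inner w (T u)]star_inner TT' star_inner.
Qed.

(** Choosing a = <w, w> gives <w, w>^* <w, w> = <w, w a> = 0, and the C*-identity concludes. *)
Lemma ract_eq0 w : (forall a : A, ract w a = 0) -> w = 0.
Proof.
move=> h; apply: inner_self_eq0; apply/eqP; rewrite -normr_eq0 -sqrf_eq0 -norm_starM.
by rewrite star_inner -innerMr h inner0r normr0.
Qed.

Variables (J : 'M[R]_n) (T : bop E).
Hypothesis T_adj : adjointable T.
Hypothesis T_twist : forall g : 'rV[R]_n -> A, schwartz g ->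
  bcomp T (Rop iota J g) = bcomp (Rop iota J g) T.

(** By A-linearity of T, [comm_ract_wave] says that the difference of the two sides at u is
    annihilated by every a in A. *)
Lemma comm_wave zeta :
  bcomp T (Eop iota (- (zeta *m J)) zeta) = bcomp (Eop iota (- (zeta *m J)) zeta) T.
Proof.
apply: bop_ext => u /=; apply/eqP; rewrite -subr_eq0; apply/eqP/ract_eq0 => a.
by rewrite ractBl -(adjointable_ract _ _ T_adj) comm_ract_wave// subrr.
Qed.

(** In [heisenberg_comp] the phase is trivial, because the operator applied first is a pure
    translation. *)
Lemma Eop_factor z zeta :
  Eop iota z zeta = bcomp (Eop iota (- (zeta *m J)) zeta) (Eop iota (z + zeta *m J) 0).
Proof.
apply: (bop_eq_on_schwartz SC) => f sf /=; rewrite !(EopE SC)//; last exact: schwartz_heisenberg.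
rewrite heisenberg_comp dot0l oppr0 cexp0 addr0 [- _ + _]addrC addrK.
by congr iota; apply/funext => x; rewrite cscale1.
Qed.

(* T commutes with the plane wave of frequency zeta, which is a Heisenberg    *)
(* operator of the same frequency: only a translation is left to act on T.    *)
Lemma conjT_shift z zeta : conjT iota T z zeta = conjT iota T (z + zeta *m J) 0.
Proof.
set V := Eop iota (- (zeta *m J)) zeta; set S := Eop iota (z + zeta *m J) 0.
have ZE u : Eop iota z zeta u = V (S u) by rewrite (Eop_factor z zeta).
have [bZ _] := binv_Eop SC z zeta; have [_ Sb] := binv_Eop SC (z + zeta *m J) 0.
have bZE u : binv (Eop iota z zeta) (V (S u)) = u.
  by rewrite -ZE; have := congr1 (fun X : bop E => X u) bZ.
have SbE u : S (binv S u) = u by have := congr1 (fun X : bop E => X u) Sb.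
apply: bop_ext => u; rewrite /conjT /= ZE.
have -> : T (V (S u)) = V (T (S u)).
  by have := congr1 (fun X : bop E => X (S u)) (comm_wave zeta).
by rewrite -{1}[T (S u)]SbE bZE.
Qed.

(** The map (z, zeta) |-> z + zeta J is multiplication by the block column of the identity and J. *)
Lemma translation_smooth_heisenberg_smooth :
  translation_smooth iota T -> heisenberg_smooth iota T.
Proof.
move=> /(smooth_comp_mulmx (col_mx 1%:M J)); congr smooth; apply/funext => p.
by rewrite [RHS]conjT_shift -{1}[p]hsubmxK mul_row_col mulmx1.
Qed.

End heisenberg_conjugates.

Theorem mainTheorem2 (R : realType) (n : nat) (A : cstarAlgType R)
    (J : 'M[R]_n) (E : hilbertModType A) (iota : ('rV[R]_n -> A) -> E)
    (T : bop E) :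
  is_separable A ->
  J^T = - J ->
  schwartz_completion iota ->
  adjointable T ->
  (forall g : 'rV[R]_n -> A, schwartz g ->
     bcomp T (Rop iota J g) = bcomp (Rop iota J g) T) ->
  translation_smooth iota T ->
  heisenberg_smooth iota T.
Proof.
by move=> _ _ SC T_adj T_twist; apply: translation_smooth_heisenberg_smooth T_twist.
Qed.
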